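(* Assume $\mathbf d\in\mathbf X$. There exists a Markov process $(\eta_t)_{t\ge 0}$ with values in $\mathbf X$ and with generator $L$, in the sense that for every bounded continuous function $f$ depending on finitely many coordinates and every $t\ge 0$, almost surely $$\lim_{u\downarrow 0}\frac1u\,\mathsf E\big[f(\eta_{t+u})-f(\eta_t)\,\big|\,\mathcal F_t\big]=Lf(\eta_t),$$ where $\mathcal F_t$ is the sigma algebra generated by $(\eta_s,\ s\le t)$.
   Context: Fix $d\ge1$, a norm $|\cdot|$ on $\mathbb Z^d$, and $\alpha\in(0,1)$. Let $P=(p(i,j))_{i,j\in\mathbb Z^d}$ be a space-homogeneous, finite-range, symmetric stochastic matrix: $p(i,j)\ge0$, $\sum_jp(i,j)=1$, $p(i,i+j)=p(0,j)$, $p(i,j)=p(j,i)$, and $p(0,j)=0$ if $|j|\ge R$, where $R>0$ is fixed. Let $$\mathbf X=\Big\{\mathbf x\in\mathbb R^{\mathbb Z^d}:\ \sum_{j\in\mathbb Z^d}|\mathbf x(j)|\,\alpha^{|j|/R}<\infty\Big\}.$$ $\mathbf d\in\mathbb R^{\mathbb Z^d}$ is a fixed configuration (the data). For $k\in\mathbb Z^d$, $z\in\mathbb R$ and $\mathbf x\in\mathbf X$ let $\Theta_{k,z}\mathbf x$ be the configuration with $(\Theta_{k,z}\mathbf x)(j)=\mathbf x(j)$ for $j\ne k$ and $(\Theta_{k,z}\mathbf x)(k)=\alpha\sum_{i}p(k,i)\mathbf x(i)+(1-\alpha)\mathbf d(k)+z$. With $G(\mathrm dz)=\frac1{\sqrt{2\pi}}e^{-z^2/2}\mathrm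 dz$, the generator is $$Lf(\mathbf x)=\sum_{k\in\mathbb Z^d}L_kf(\mathbf x),\qquad L_kf(\mathbf x)=\int G(\mathrm dz)\,\big[f(\Theta_{k,z}\mathbf x)-f(\mathbf x)\big],$$ for $f$ depending on finitely many coordinates. *)

(* Defs.v *)
From HB Require Import structures.
From mathcomp Require Import all_boot all_order all_algebra.
From mathcomp Require Import all_classical all_reals all_analysis.
Set Implicit Arguments.
Unset Strict Implicit.
Unset Printing Implicit Defensive.
Import Order.TTheory GRing.Theory Num.Theory.
Import numFieldNormedType.Exports.
Local Open Scope classical_set_scope.
Local Open Scope ring_scope.

Notation "'Zd' d" := 'rV[int]_d (at level 10, d at level 8).

Section space.
Context (R : realType) (d : nat).

(* [prod_topology] makes the topology on R^(Z^d) the product one. *)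
Definition conf := prod_topology (fun _ : Zd d => R).

(* Nonnegativity and [N 0 = 0] follow from these axioms. *)
Definition is_norm (N : 'rV[R]_d -> R) : Prop :=
  [/\ forall v, N v = 0 -> v = 0,
      forall a v, N (a *: v) = `|a| * N v
    & forall v w, N (v + w) <= N v + N w].

(* The norm on Z^d is the restriction of a norm on R^d.  The norm axioms on
   the group Z^d alone would also allow (a, b) |-> |a + b sqrt 2|, whose balls
   are infinite. *)
Definition Znorm (N : 'rV[R]_d -> R) (j : Zd d) : R := N (map_mx intr j).

Variables (N : 'rV[R]_d -> R) (alpha r : R).

Definition XX : set conf :=
  [set x : conf | (\esum_(j in [set: Zd d])
                    (`|x j| * alpha `^ (Znorm N j / r))%:E < +oo)%E].

Definition state : Type := {x : conf | x \in XX}.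

Lemma zero_in_XX : ((fun=> 0) : conf) \in XX.
Proof. by rewrite inE /XX/= esum1 ?ltry// => j _; rewrite normr0 mul0r. Qed.

HB.instance Definition _ := Choice.copy state {x : conf | x \in XX}.
HB.instance Definition _ := isPointed.Build state (exist (fun x : conf => x \in XX) _ zero_in_XX).

Definition coord_sets : set (set state) :=
  \bigcup_(j in [set: Zd d])
    preimage_set_system setT (fun x : state => sval x j) measurable.

(* The sigma-algebra on X is generated by the coordinates; it is also the Borel
   sigma-algebra of the weighted l^1 norm defining X. *)
HB.instance Definition _ := Measurable.copy state (g_sigma_algebraType coord_sets).

End space.
Arguments state {R d} N alpha r.

Section generator.
Context (R : realType) (d : nat).
Variables (alpha : R) (p : Zd d -> Zd d -> R) (dat : conf R d).

(* [\sum_(i \in A)] is the sum of a finitely supported family.  Here p(k, .) has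
   finite support by the finite-range assumption. *)
Definition Theta (k : Zd d) (z : R) (x : conf R d) : conf R d :=
  fun j => if j == k
           then alpha * (\sum_(i \in [set: Zd d]) p k i * x i)
                + (1 - alpha) * dat k + z
           else x j.

Definition gen_at (k : Zd d) (f : conf R d -> R) (x : conf R d) : R :=
  (\int[normal_prob 0 1]_z (f (Theta k z x) - f x))%R.

(* Finitely supported for [f] as in [local_test]: [gen_at k f] vanishes unless
   [f] depends on coordinate k. *)
Definition gen (f : conf R d -> R) (x : conf R d) : R :=
  \sum_(k \in [set: Zd d]) gen_at k f x.

(* Test functions are taken on all of R^(Z^d): since X projects onto R^S for
   every finite S, a function on X depending on the coordinates in S has a
   unique extension depending on these coordinates, and it is continuous iff
   the extension is. *)
Definition local_test (f : conf R d -> R) : Prop :=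
  [/\ exists S : seq (Zd d), forall x y : conf R d,
        {in S, forall j, x j = y j} -> f x = f y,
      exists M, forall x, `|f x| <= M
    & continuous f].

End generator.

Section markov.
Context (R : realType).

(* [Z] is a version of E[Y | F]. *)
Definition is_cond_exp dO (Om : measurableType dO) (P : probability Om R)
    (F : set (set Om)) (Y Z : Om -> R) : Prop :=
  [/\ forall B : set R, measurable B -> F (Z @^-1` B),
      P.-integrable setT (EFin \o Z)
    & forall A, F A ->
        (\int[P]_(w in A) (Z w)%:E = \int[P]_(w in A) (Y w)%:E)%E].

Context dT (T : measurableType dT).

Definition transition_function (K : R -> R.-pker T ~> T) : Prop :=
  (forall (x : T) (B : set T), measurable B -> K 0 x B = \d_x B) /\
  (forall s t : R, 0 <= s -> 0 <= t ->
     forall (x : T) (B : set T), measurable B ->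
       K (s + t) x B = (\int[K s x]_y K t y B)%E).

Context dO (Om : measurableType dO) (P : probability Om R) (eta : R -> Om -> T).

Definition past (t : R) : set (set Om) :=
  <<s \bigcup_(s in `[0, t]) preimage_set_system setT (eta s) measurable >>.

(* Only times t >= 0 matter; [eta] is unconstrained at negative times. *)
Definition markov_process : Prop :=
  (forall t, 0 <= t -> measurable_fun setT (eta t)) /\
  exists K : R -> R.-pker T ~> T, transition_function K /\
    forall t u, 0 <= t -> 0 <= u -> forall B : set T, measurable B ->
      is_cond_exp P (past t) (\1_(eta (t + u) @^-1` B))
                             (fun w => fine (K u (eta t w) B)).

End markov.

(* Main.v *)
(* The dynamics is a superposition of rate-1 updates.  In a finite box the
   generator is bounded and its semigroup is a Poisson mixture of iterates of the
   uniformized chain.  For a test function depending on sites in S, the semigroups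
   of two boxes containing all sites of size at most n differ by O(1/n), with a constant
   depending only on S and t: attaching to each site k the weight 1 + |k|_1, one update
   spreads the dependence of a function to finitely many neighbours of comparable
   weight, so the total weight of the sites involved grows at most exponentially and
   Markov's inequality applies.  Hence the box semigroups converge uniformly on
   R^(Z^d), and the limit inherits the semigroup property and the generator estimate
   |P_t f - f - t L f| <= D t^2 from the boxes.  The weighted norm defining X, plus a
   constant, is a Lyapunov function with drift bounded independently of the box, so X
   is invariant.  The process is obtained from the transition kernels by Kolmogorov's
   extension theorem, and conditioning on the past reduces the limit in the theorem to
   the pointwise generator estimate. *)
Require Import Defs.
From HB Require Import structures.
From mathcomp Require Import all_boot all_order all_algebra.
From mathcomp Require Import all_classical all_reals all_analysis.
From mathcomp Require Import measurable_realfun ring lra.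
Import Order.TTheory GRing.Theory Num.Theory.
Import numFieldNormedType.Exports.
Local Open Scope classical_set_scope.
Local Open Scope ring_scope.

Set Implicit Arguments.
Unset Strict Implicit.
Unset Printing Implicit Defensive.

(** Kernels act only on nonnegative measurable functions with values in the extended reals, so no
    integrability is carried along. The price is that identities with differences are written with
    the negative terms on the other side, and that a signed test function is first rescaled affinely
    to [[0, 1]]. Uniformized chains of boxes of different sizes run on different clocks; Poisson
    thinning brings two boxes to a common clock, and only then can they be compared step by step, by
    induction on the number of updates. The comparison is uniform over all [[0, 1]]-valued functions
    depending on a given finite set of sites. This takes the place of tightness: the box marginals
    converge uniformly over measurable sets, and such a limit is again a probability. Kolmogorov's
    theorem is used twice: over sites, to build the kernel for a fixed time and starting point, and
    over times, to build the process. The evolution lives first on all of R^(Z^d), where limits of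
    finite-dimensional probabilities can be glued, and is restricted to X afterwards. *)

Section probability_of_measure.
Context {R : realType} {d} {T : measurableType d}.
Variables (nu : {measure set T -> \bar R}) (nu1 : nu setT = 1%E).

Let nu' : set T -> \bar R := nu.

HB.instance Definition _ := Measure.on nu'.
HB.instance Definition _ := Measure_isProbability.Build d T R nu' nu1.

Lemma probability_of_measure : exists P : probability T R, forall A, P A = nu A.
Proof. by exists nu'. Qed.

End probability_of_measure.

Section pushforward_measure.
Context {R : realType} {d d'} {X : measurableType d} {Y : measurableType d'}.
Variables (f : X -> Y) (mf : measurable_fun setT f).

Lemma measure_pushforward (m : {measure set X -> \bar R}) :
  exists m' : {measure set Y -> \bar R}, forall A, m' A = m (f @^-1` A).
Proof.
pose m' : {measure set Y -> \bar R} := pushforward m f.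
by exists (m' mf).
Qed.

Lemma probability_pushforward (P : probability X R) :
  exists P' : probability Y R, forall A, P' A = P (f @^-1` A).
Proof.
have [m' m'E] := measure_pushforward P.
have [|P' P'E] := @probability_of_measure _ _ _ m'.
  rewrite m'E preimage_setT; exact: (@probability_setT _ _ _ P).
by exists P' => A; rewrite P'E m'E.
Qed.

End pushforward_measure.

Section pkernel_of_probability.
Context {R : realType} {d d'} {X : measurableType d} {Y : measurableType d'}.
Variables (k : X -> probability Y R).
Hypothesis mk : forall U, measurable U -> measurable_fun setT (k ^~ U).

Let k' : X -> {measure set Y -> \bar R} := fun x => k x.

HB.instance Definition _ := isKernel.Build d d' X Y R k' mk.

Let k'1 x : k' x setT = 1%E. Proof. exact: (@probability_setT _ _ _ (k x)). Qed.

HB.instance Definition _ := Kernel_isProbability.Build d d' X Y R k' k'1.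

Lemma pkernel_of_probability : exists K : R.-pker X ~> Y,
  forall (x : X) (U : set Y), K x U = k x U.
Proof.
have @K : R.-pker X ~> Y := k'.
exists K => x U.
reflexivity.
Qed.

End pkernel_of_probability.

Lemma probability_eq_pi {R : realType} {d} {T : measurableType d}
    (G : set (set T)) (P Q : {measure set T -> \bar R}) :
  @measurable d T = <<s G >> -> setI_closed G -> (P setT < +oo)%E ->
  P setT = Q setT -> (forall A, G A -> P A = Q A) ->
  forall A, measurable A -> P A = Q A.
Proof.
move=> mG GI Poo PQT PQ A mA.
have PQ' B : (G `|` [set setT]) B -> P B = Q B by case=> [/PQ //|->].
(* Adjoining [setT] to the generating class supplies the exhausting sequence of sets of finite
   measure. *)
apply: (@measure_unique _ R T (G `|` [set setT]) (fun=> setT)) => //.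
- rewrite mG; apply/seteqP; split.
    by apply: sub_smallest2r; [exact: smallest_sigma_algebra|move=> B; left].
  apply: smallest_sub; first exact: smallest_sigma_algebra.
  move=> B [GB|->]; first exact: sub_sigma_algebra.
  by have := @measurableT _ T; rewrite mG.
- move=> B C [GB|->] [GC|->]; rewrite ?setTI ?setIT; [left; exact: GI|by left|by left|by right].
- by move=> _; right.
- by rewrite bigcup_const//; exists 0%N.
Qed.

(** * Product spaces and cylinders *)

(** An alias of the function type that carries the product sigma-algebra. The index set is
    arbitrary: it serves for sites, times and bits. *)
Definition prodsp (I T : Type) := I -> T.

Section prodsp_measurable.
Context {I : Type} {d} {T : measurableType d}.

HB.instance Definition _ := Choice.on (prodsp I T).
HB.instance Definition _ := isPointed.Build (prodsp I T) (fun=> point).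

Definition prod_coord_sets : set (set (prodsp I T)) :=
  \bigcup_(i in [set: I])
    preimage_set_system setT (fun x : prodsp I T => x i) measurable.

HB.instance Definition _ :=
  Measurable.copy (prodsp I T) (g_sigma_algebraType prod_coord_sets).

Lemma measurable_coord i : measurable_fun setT (fun x : prodsp I T => x i).
Proof.
move=> _ B mB; apply: sub_sigma_algebra; exists i => //.
by exists B => //; rewrite setTI.
Qed.

Lemma measurable_fun_prodsp {d'} {X : measurableType d'} (f : X -> prodsp I T) :
  (forall i, measurable_fun setT (fun x => f x i)) -> measurable_fun setT f.
Proof.
move=> mf; apply: (measurability prod_coord_sets) => //.
move=> _ [_ [i _ [B mB <-]] <-].
by have := mf i measurableT B mB; rewrite !setTI.
Qed.

End prodsp_measurable.
Arguments prod_coord_sets I {d} T.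

Section local.
Context {I : eqType} {T : Type}.

Definition local {Y : Type} (S : seq I) (f : (I -> T) -> Y) :=
  forall x y, {in S, forall i, x i = y i} -> f x = f y.

Definition local_set (S : seq I) (A : set (I -> T)) :=
  forall x y, {in S, forall i, x i = y i} -> A x -> A y.

Lemma local_sub {Y : Type} (S S' : seq I) (f : (I -> T) -> Y) :
  {subset S <= S'} -> local S f -> local S' f.
Proof. by move=> SS' Sf x y xy; apply: Sf => i /SS'; exact: xy. Qed.

Lemma local_set_sub (S S' : seq I) (A : set (I -> T)) :
  {subset S <= S'} -> local_set S A -> local_set S' A.
Proof. by move=> SS' Sf x y xy; apply: Sf => i /SS'; exact: xy. Qed.

Lemma local_preimage {Y : Type} (S : seq I) (f : (I -> T) -> Y) (B : set Y) :
  local S f -> local_set S (f @^-1` B).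
Proof. by move=> Sf x y xy; rewrite /preimage /= (Sf _ _ xy). Qed.

Lemma local_setI (S S' : seq I) (A B : set (I -> T)) :
  local_set S A -> local_set S' B -> local_set (S ++ S') (A `&` B).
Proof.
move=> SA SB x y xy [Ax Bx]; split.
  by apply: SA Ax => i iS; apply: xy; rewrite mem_cat iS.
by apply: SB Bx => i iS; apply: xy; rewrite mem_cat iS orbT.
Qed.

Lemma local_setC (S : seq I) (A : set (I -> T)) :
  local_set S A -> local_set S (~` A).
Proof. by move=> SA x y xy nAx Ay; apply: nAx; apply: SA Ay => i /xy. Qed.

Lemma local_indic {R : realType} (S : seq I) (A : set (I -> T)) :
  local_set S A -> local S (\1_A : (I -> T) -> R).
Proof.
move=> SA x y xy; rewrite !indicE; congr (_%:R); congr nat_of_bool.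
apply/idP/idP; rewrite !inE; first exact: SA.
by apply: SA => i /xy.
Qed.

End local.

(** Sets determined by finitely many coordinates, with any measurable base, form the pi-system on
    which measures and kernels on a product are identified. *)
Lemma local_generate (I : eqType) d (T : measurableType d) :
  @measurable _ (prodsp I T) =
  <<s [set A : set (prodsp I T) | measurable A /\ exists S, local_set S A] >>.
Proof.
apply/seteqP; split; last first.
  by apply: smallest_sub; [exact: sigma_algebra_measurable|move=> A []].
apply: sub_smallest2r; first exact: smallest_sigma_algebra.
move=> A [i _ [B mB <-]]; split.
  by rewrite setTI -[X in measurable X]setTI; exact: measurable_coord.
by exists [:: i]; rewrite setTI => x y xy; rewrite /preimage /= (xy i) ?inE.
Qed.

Lemma local_setI_closed (I : eqType) d (T : measurableType d) :
  setI_closed [set A : set (prodsp I T) | measurable A /\ exists S, local_set S A].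
Proof.
move=> A B [mA [S SA]] [mB [S' SB]]; split; first exact: measurableI.
by exists (S ++ S'); exact: local_setI.
Qed.

Lemma eq_local_measure {R : realType} {I : eqType} {d} {T : measurableType d}
    (P Q : {measure set (prodsp I T) -> \bar R}) : (P setT < +oo)%E ->
  P setT = Q setT ->
  (forall S (A : set (prodsp I T)), measurable A -> local_set S A -> P A = Q A) ->
  forall A, measurable A -> P A = Q A.
Proof.
move=> Poo PQT PQ A mA.
apply: (probability_eq_pi (local_generate I T)) => //.
- exact: local_setI_closed.
- by move=> B [mB [S SB]]; exact: PQ SB.
Qed.

(** * Cylinders of bit sequences and compactness *)

Definition cylsp (J : Type) := J -> bool.

Section cylinders.
Context {J : choiceType}.

HB.instance Definition _ := Choice.on (cylsp J).
HB.instance Definition _ := isPointed.Build (cylsp J) (fun=> false).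

Definition cylinder : set (set (cylsp J)) := [set A | exists s, local_set s A].

Lemma cylinder0 : cylinder set0.
Proof. by exists [::] => x y. Qed.

Lemma cylinderU : setU_closed cylinder.
Proof.
move=> A B [s As] [s' Bs]; exists (s ++ s') => x y xy [Ax|Bx].
  by left; apply: As Ax => i iS; apply: xy; rewrite mem_cat iS.
by right; apply: Bs Bx => i iS; apply: xy; rewrite mem_cat iS orbT.
Qed.

Lemma cylinderC : setC_closed cylinder.
Proof. by move=> A [s As]; exists s; exact: local_setC. Qed.

HB.instance Definition _ := isAlgebraOfSets.Build default_measure_display (cylsp J)
  cylinder0 cylinderU cylinderC.

Let top := prod_topology (fun _ : J => bool).

HB.instance Definition _ := Topological.on top.
HB.instance Definition _ := isPointed.Build top (fun=> false).

Lemma cylinder_open (A : set (cylsp J)) : cylinder A -> open (A : set top).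
Proof.
move=> [s As]; rewrite openE => x Ax; rewrite /interior.
pose x' : top := x.
have FF : Filter (nbhs x') := nbhs_filter x'.
have : nbhs x' (fun y : top => {in s, forall j, x j = y j}).
  elim: s {As} => [|j s IH]; first by apply: (@filterE top (nbhs x')) => y i.
  have xj : nbhs x' (fun y : top => y j = x j).
    apply: (@proj_continuous J (fun=> bool) j x' [set x j]).
    by apply: open_nbhs_nbhs; split => //; exact: discrete_open.
  apply: filterS2 xj IH => y yj ys i; rewrite inE => /orP[/eqP ->//|].
  exact: ys.
by apply: filterS => y xy; exact: As xy Ax.
Qed.

(** By Tychonoff the bit space is compact, and a cylinder is both open and closed; a union of
    cylinders that is itself a cylinder therefore has a finite subcover. *)
Lemma cylinder_finite_union (F : (set (cylsp J))^nat) :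
  (forall n, cylinder (F n)) -> cylinder (\bigcup_n F n) ->
  exists n0, \bigcup_n F n `<=` \bigcup_(k < n0) F k.
Proof.
move=> cF cU.
have cpt : @compact top (\bigcup_n F n).
  have cT : compact [set f : top | forall i : J, [set: bool] (f i)].
    by apply: (@tychonoff J (fun=> bool) (fun=> setT)) => i; exact: bool_compact.
  apply: (@subclosed_compact top _ _ _ cT); last by move=> x _ i.
  rewrite -[X in closed X]setCK closedC; apply: cylinder_open; exact: cylinderC.
rewrite (@compact_cover top) in cpt.
have := cpt nat setT F; case=> [i _|//|D _ FD]; first exact: cylinder_open.
exists (\max_(i <- finmap.enum_fset D) i.+1)%N => x /FD [k kD Fkx].
by exists k => //=; exact: (leq_bigmax_seq (F := succn)).
Qed.

End cylinders.

(* Through [enc] the cylinders of [T^I] become cylinders of the compact space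
   [{0,1}^(I * J)], on which finite additivity implies sigma-additivity, so that no
   topology on [T] is needed. *)
Section kolmogorov.
Context {R : realType} {I J : choiceType} {d} {T : measurableType d}.
Variables (enc : T -> J -> bool) (dec : prodsp J bool -> T).
Hypothesis menc : forall j, measurable [set t | enc t j].
Hypothesis mdec : measurable_fun setT dec.
Hypothesis encK : forall t, dec (enc t) = t.
Variable mu : seq I -> probability (prodsp I T) R.
Hypothesis mu_consistent : forall S S' (A : set (prodsp I T)),
  {subset S <= S'} -> measurable A -> local_set S A -> mu S' A = mu S A.

Notation K := (I * J)%type.

Let encP (x : prodsp I T) : cylsp K := fun k => enc (x k.1) k.2.

Let decP (b : g_sigma_algebraType (@cylinder K)) : prodsp I T :=
  fun i => dec (fun j => b (i, j)).

Let encPK x : decP (encP x) = x.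
Proof. by apply/funext => i; rewrite -[RHS]encK. Qed.

Let local_encP s A : local_set s A -> local_set (map fst s) (encP @^-1` A).
Proof.
move=> sA x y xy; apply: sA => k ks; rewrite /encP; congr enc.
by apply: xy; exact: map_f.
Qed.

(** Induction on the list of bits: splitting along bit [k] and freezing it in each half leaves
    cylinders on the remaining bits. *)
Let measurable_encP A : cylinder A -> measurable (encP @^-1` A).
Proof.
move=> [s]; elim: s A => [A A0|k s IH A sA].
  have [->|/set0P[x Ax]] := eqVneq A set0; first by rewrite preimage_set0.
  suff -> : encP @^-1` A = setT by [].
  by apply/seteqP; split => // y _; apply: A0 Ax.
pose upd (c : bool) (b : cylsp K) : cylsp K := fun k' => if k' == k then c else b k'.
have mA c : measurable (encP @^-1` (upd c @^-1` A)).
  apply: IH => x y xy; apply: sA => k'; rewrite inE /upd.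
  by case: eqP => //= _ /xy.
have mk : measurable [set x : prodsp I T | enc (x k.1) k.2].
  have := @measurable_coord I _ T k.1 measurableT _ (menc k.2).
  by rewrite setTI.
rewrite (_ : encP @^-1` A =
    ([set x : prodsp I T | enc (x k.1) k.2] `&` encP @^-1` (upd true @^-1` A)) `|`
    (~` [set x : prodsp I T | enc (x k.1) k.2] `&` encP @^-1` (upd false @^-1` A))).
  by apply: measurableU; apply: measurableI => //; exact: measurableC.
have updE x : upd (enc (x k.1) k.2) (encP x) = encP x.
  by apply/funext => k'; rewrite /upd; case: eqP => // ->.
apply/seteqP; split => x; rewrite /preimage /= => H.
- by case xk : (enc (x k.1) k.2); [left|right]; split => //; rewrite -xk updE.
- by case: H => -[xk]; [|move/negP/negbTE: xk => xk]; rewrite -xk updE.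
Qed.

(** An arbitrary choice of supporting sites. By consistency of [mu], [cE] shows that the content [c]
    does not depend on it; the empty list off the cylinders is a dummy. *)
Let supp (A : set (cylsp K)) : seq I :=
  if pselect (cylinder A) is left pf then map fst (projT1 (cid pf)) else [::].

Let c (A : set (cylsp K)) : \bar R := mu (supp A) (encP @^-1` A).

Let cE s S A : local_set s A -> {subset map fst s <= S} ->
  c A = mu S (encP @^-1` A).
Proof.
move=> sA sS; rewrite /c /supp; case: pselect => [pf|]; last by case; exists s.
case: cid => s' /= s'A.
have mA : measurable (encP @^-1` A) by apply: measurable_encP; exists s.
have h1 := @mu_consistent (map fst s') (map fst s' ++ S) _ _ mA (local_encP s'A).
have h2 := @mu_consistent S (map fst s' ++ S) _ _ mA
  (local_set_sub sS (local_encP sA)).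
by rewrite -h1 ?h2 // => i iS; rewrite mem_cat iS ?orbT.
Qed.

Let c0 : c set0 = 0%E.
Proof. by rewrite /c preimage_set0 measure0. Qed.

Let c_ge0 A : (0 <= c A)%E. Proof. exact: measure_ge0. Qed.

(** By compactness only finitely many sets of the disjoint sequence are nonempty. One finite set of
    sites supports all of them, and there [c] is an honest measure pulled back by [encP]. *)
Let c_additive : semi_sigma_additive c.
Proof.
move=> F mF tF mU.
have [n0 Fn0] := @cylinder_finite_union K F mF mU.
have F0 n : (n0 <= n)%N -> F n = set0.
  move=> n0n; apply/seteqP; split => // x Fnx.
  have [|m /= mn0 Fmx] := Fn0 x; first by exists n.
  have /trivIsetP/(_ n m Logic.I Logic.I) := tF.
  have [nm|_ /(_ isT)] := eqVneq n m; first by rewrite -nm ltnNge n0n in mn0.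
  by move=> /seteqP[/(_ x) + _]; apply.
have [s sF] := choice mF.
pose S := flatten [seq map fst (s n) | n <- iota 0 n0].
have cF n : c (F n) = mu S (encP @^-1` F n).
  have [n0n|nn0] := leqP n0 n; first by rewrite F0// c0 preimage_set0 measure0.
  apply: (cE (sF n)) => i ins; apply/flattenP; exists (map fst (s n)) => //.
  by apply/mapP; exists n => //; rewrite mem_iota.
have cU : c (\bigcup_n F n) = mu S (encP @^-1` \bigcup_n F n).
  apply: (cE (s := flatten [seq s n | n <- iota 0 n0])) => [x y xy [n _ Fnx]|].
    have [n0n|nn0] := leqP n0 n; first by move: Fnx; rewrite F0.
    exists n => //; apply: sF Fnx => i ins; apply: xy; apply/flattenP.
    by exists (s n) => //; apply/mapP; exists n => //; rewrite mem_iota.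
  move=> i; rewrite /S map_flatten -map_comp; exact.
rewrite cU preimage_bigcup; under eq_fun do under eq_bigr do rewrite cF.
apply: measure_semi_sigma_additive.
- by move=> n; exact: (measurable_encP (mF n)).
- apply/trivIsetP => n m _ _ nm; rewrite -preimage_setI.
  by move/trivIsetP : tF => /(_ n m Logic.I Logic.I nm) ->; rewrite preimage_set0.
- by apply: bigcupT_measurable => n; exact: (measurable_encP (mF n)).
Qed.

HB.instance Definition _ := isMeasure.Build _ _ _ c c0 c_ge0 c_additive.

Let Pc := measure_extension (c : {measure set (cylsp K) -> \bar R}).

Let PcE A : cylinder A -> Pc A = c A.
Proof. by move=> cA; rewrite /Pc /= /measure_extension measurable_mu_extE. Qed.

Let cT : c setT = 1%E.
Proof. by rewrite /c preimage_setT probability_setT. Qed.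

Let measurable_decP : measurable_fun setT decP.
Proof.
apply: measurable_fun_prodsp => i; apply: (measurableT_comp mdec).
apply: (@measurable_fun_prodsp J) => j _ B _; rewrite setTI.
apply: sub_sigma_algebra; exists [:: (i, j)] => x y xy.
by rewrite /preimage /= xy// inE.
Qed.

(** A measurable set depending on [S] may involve infinitely many bits of each coordinate, so it
    need not come from a cylinder. The map [rs] erases the bits outside [S]; after it the extended
    measure and the image of [mu S] agree on cylinders, hence on all measurable sets. *)
Let PE P : (forall A, P A = Pc (decP @^-1` A)) ->
  forall S (A : set (prodsp I T)), measurable A -> local_set S A -> P A = mu S A.
Proof.
move=> PcP S A mA SA; rewrite PcP.
pose rs (b : cylsp K) : cylsp K := fun k => if k.1 \in S then b k else false.
have rsK B s : local_set s B ->
    local_set [seq k <- s | k.1 \in S] (rs @^-1` B).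
  move=> sB x y xy; apply: sB => k ks; rewrite /rs; case: ifP => // kS.
  by apply: xy; rewrite mem_filter kS.
pose G := g_sigma_algebraType (@cylinder K).
have mrs : measurable_fun setT (rs : G -> G).
  apply: (@measurability _ _ _ G setT _ (@cylinder K)) => //.
  move=> _ [B [s sB] <-]; rewrite setTI; apply: sub_sigma_algebra.
  by exists [seq k <- s | k.1 \in S]; exact: rsK.
have menc' : measurable_fun setT (encP : prodsp I T -> G).
  apply: (@measurability _ _ _ G setT _ (@cylinder K)) => //.
  by move=> _ [B cB <-]; rewrite setTI; exact: measurable_encP.
have mre : measurable_fun setT (rs \o encP : prodsp I T -> G).
  exact: (measurableT_comp mrs menc').
have [m1 m1E] := measure_pushforward mrs Pc.
have [m2 m2E] := measure_pushforward mre (mu S).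
have m12 B : cylinder B -> m1 B = m2 B.
  move=> [s sB]; rewrite m1E m2E.
  transitivity (c (rs @^-1` B)).
    by apply: PcE; exists [seq k <- s | k.1 \in S]; exact: rsK.
  rewrite (cE (S := S) (rsK _ _ sB))// => i /mapP[k].
  by rewrite mem_filter => /andP[kS _] ->.
have cylT : cylinder [set: cylsp K] by exists [::] => x y.
have {}m12 : forall B, measurable B -> m1 B = m2 B.
  apply: (@probability_eq_pi _ _ G (@cylinder K) m1 m2) => //.
  - exact: (@measurableI _ (cylsp K)).
  - rewrite (m12 _ cylT) m2E preimage_setT.
    by rewrite (_ : _ setT = 1%E) ?ltry//; exact: (@probability_setT _ _ _ (mu S)).
  - exact: m12.
have mdA : measurable (decP @^-1` A : set G).
  by rewrite -[X in measurable X]setTI; exact: measurable_decP.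
have rsA : rs @^-1` (decP @^-1` A) = decP @^-1` A.
  apply/seteqP; split => b; apply: SA => i iS; rewrite /decP /rs; congr dec;
    by apply/funext => j /=; rewrite iS.
transitivity (m1 (decP @^-1` A)); first by rewrite m1E rsA.
rewrite m12// m2E; congr (mu S _).
rewrite comp_preimage rsA; apply/seteqP; split => x; rewrite /preimage /=;
  by rewrite encPK.
Qed.

Theorem kolmogorov_extension : exists P : probability (prodsp I T) R,
  forall S (A : set (prodsp I T)), measurable A -> local_set S A -> P A = mu S A.
Proof.
have [P PPc] := measure_pushforward measurable_decP Pc.
have [|Q QE] := @probability_of_measure _ _ _ P.
  rewrite PPc preimage_setT -[RHS]cT; apply: PcE.
  by exists [::] => x y.
by exists Q => S A mA SA; rewrite QE; exact: PE.
Qed.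

End kolmogorov.

(** * Probability kernels *)

Local Open Scope ereal_scope.

(** The class on which kernel integrals are additive, homogeneous and monotone with no finiteness
    condition; kernels preserve it, so they can be iterated. *)
Definition nnmf {R : realType} {d} {T : measurableType d} (f : T -> \bar R) :=
  measurable_fun setT f /\ forall x, 0 <= f x.

HB.lock Definition kint {R : realType} {d d'} {X : measurableType d} {Y : measurableType d'}
  (K : R.-pker X ~> Y) (f : Y -> \bar R) (x : X) : \bar R := \int[K x]_y f y.

Lemma kintE {R : realType} {d d'} {X : measurableType d} {Y : measurableType d'}
  (K : R.-pker X ~> Y) (f : Y -> \bar R) (x : X) : kint K f x = \int[K x]_y f y.
Proof. by rewrite kint.unlock. Qed.

Lemma eq_kint {R : realType} {d d'} {X : measurableType d} {Y : measurableType d'}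
  (K : R.-pker X ~> Y) (f g : Y -> \bar R) (x : X) :
  (forall y, f y = g y) -> kint K f x = kint K g x.
Proof. by move=> fg; congr (kint K _ x); exact/funext. Qed.

Section nnmf_theory.
Context {R : realType} {d} {T : measurableType d}.
Implicit Types (f g : T -> \bar R).

Lemma nnmf_cst (c : \bar R) : 0 <= c -> nnmf (fun _ : T => c).
Proof. by split. Qed.

Lemma nnmfD f g : nnmf f -> nnmf g -> nnmf (fun x => f x + g x).
Proof.
move=> [mf f0] [mg g0]; split; first exact: emeasurable_funD.
by move=> x; rewrite adde_ge0.
Qed.

Lemma nnmfZ (c : \bar R) f : 0 <= c -> nnmf f -> nnmf (fun x => c * f x).
Proof.
move=> c0 [mf f0]; split; first exact: measurable_funeM.
by move=> x; rewrite mule_ge0.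
Qed.

Lemma nnmf_sum (I : Type) (s : seq I) (h : I -> T -> \bar R) :
  (forall i, nnmf (h i)) -> nnmf (fun x => \sum_(i <- s) h i x).
Proof.
move=> hh; split; first by apply: emeasurable_sum => i; exact: (hh i).1.
by move=> x; apply: sume_ge0 => i _; exact: (hh i).2.
Qed.

Lemma nnmf_series (h : nat -> T -> \bar R) :
  (forall i, nnmf (h i)) -> nnmf (fun x => \sum_(0 <= i <oo) h i x).
Proof.
move=> hh; split.
  by apply: ge0_emeasurable_sum => [i x _ _|i _]; [exact: (hh i).2|exact: (hh i).1].
by move=> x; apply: nneseries_ge0 => i _ _; exact: (hh i).2.
Qed.

Lemma nnmf_indic (A : set T) : measurable A -> nnmf (fun x => (\1_A x)%:E : \bar R).
Proof.
move=> mA; split; last by move=> x; rewrite lee_fin.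
by apply/measurable_EFinP; exact: measurable_indic.
Qed.

End nnmf_theory.

Section kint_theory.
Context {R : realType} {d d'} {X : measurableType d} {Y : measurableType d'}.
Variable K : R.-pker X ~> Y.
Implicit Types (f g : Y -> \bar R).

Lemma pkerT x : K x setT = 1.
Proof. by have := @prob_kernel _ _ _ _ _ K x. Qed.

Lemma nnmf_kint f : nnmf f -> nnmf (kint K f).
Proof.
move=> [mf f0]; split; last by move=> x; rewrite kintE; apply: integral_ge0.
rewrite (_ : kint K f = fun x => \int[K x]_y f y); last exact/funext/kintE.
by apply: measurable_fun_integral_kernel => // U mU; exact: measurable_kernel.
Qed.

Lemma kintD f g x : nnmf f -> nnmf g ->
  kint K (fun y => f y + g y) x = kint K f x + kint K g x.
Proof. by move=> [mf f0] [mg g0]; rewrite !kintE ge0_integralD. Qed.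

Lemma kintZ (c : \bar R) f x : 0 <= c -> nnmf f ->
  kint K (fun y => c * f y) x = c * kint K f x.
Proof. by move=> c0 [mf f0]; rewrite !kintE ge0_integralZl. Qed.

Lemma kint_cst (c : \bar R) x : 0 <= c -> kint K (fun=> c) x = c.
Proof.
by move=> c0; rewrite !kintE integral_cst// pkerT mule1.
Qed.

Lemma kint_le f g x : nnmf f -> nnmf g -> (forall y, f y <= g y) ->
  kint K f x <= kint K g x.
Proof. by move=> [mf f0] [mg g0] fg; rewrite !kintE; apply: ge0_le_integral. Qed.

Lemma kint_sum (I : Type) (s : seq I) (h : I -> Y -> \bar R) x :
  (forall i, nnmf (h i)) ->
  kint K (fun y => \sum_(i <- s) h i y) x = \sum_(i <- s) kint K (h i) x.
Proof.
move=> hh; rewrite kintE ge0_integral_sum//.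
- by apply: eq_bigr => i _; rewrite kintE.
- by move=> i; exact: (hh i).1.
- by move=> i y _; exact: (hh i).2.
Qed.

Lemma kint_series (h : nat -> Y -> \bar R) x : (forall i, nnmf (h i)) ->
  kint K (fun y => \sum_(0 <= i <oo) h i y) x = \sum_(0 <= i <oo) kint K (h i) x.
Proof.
move=> hh; rewrite kintE integral_nneseries//.
- by apply: eq_eseriesr => i _; rewrite kintE.
- by move=> i; exact: (hh i).1.
- by move=> i y _; exact: (hh i).2.
Qed.

Lemma kint_indic (A : set Y) x : measurable A ->
  kint K (fun y => (\1_A y)%:E) x = K x A.
Proof. by move=> mA; rewrite !kintE integral_indic ?setIT. Qed.

End kint_theory.

Section kernel_constructions.
Context {R : realType}.

Lemma pkernel_of_measure {d d'} {X : measurableType d} {Y : measurableType d'}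
    (k : X -> {measure set Y -> \bar R}) :
  (forall x, k x setT = 1) ->
  (forall U, measurable U -> measurable_fun setT (k ^~ U)) ->
  exists K : R.-pker X ~> Y, forall (x : X) (f : Y -> \bar R),
    kint K f x = \int[k x]_y f y.
Proof.
move=> k1 mk.
have [q qE] := choice (fun x => probability_of_measure (k1 x)).
have [|K KE] := pkernel_of_probability (k := q).
  by move=> U mU; under eq_fun do rewrite qE; exact: mk.
exists K => x f; rewrite !kintE; apply: eq_measure_integral => A mA _.
by rewrite KE qE.
Qed.

Lemma pkernel_random {d d' dz} {X : measurableType d} {Y : measurableType d'}
    {Z : measurableType dz} (nu : probability Z R) (F : X * Z -> Y) :
  measurable_fun setT F ->
  exists K : R.-pker X ~> Y, forall (x : X) (f : Y -> \bar R), nnmf f ->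
    kint K f x = \int[nu]_z f (F (x, z)).
Proof.
move=> mF.
have mFx x : measurable_fun setT (fun z => F (x, z)).
  by apply: (measurableT_comp mF); exact: measurable_pair1.
pose pf x : {measure set Y -> \bar R} := pushforward nu (fun z => F (x, z)).
pose k := pf mFx.
have [||K KE] := @pkernel_of_measure _ _ X Y k.
- move=> x; rewrite /k /pf /= /pushforward preimage_setT.
  exact: (@probability_setT _ _ _ nu).
- move=> U mU.
  have mFU : measurable (F @^-1` U).
    by rewrite -[X in measurable X]setTI; exact: mF.
  rewrite (_ : (fun x => _) = fubini_F nu (fun xz => (\1_(F @^-1` U) xz)%:E)).
    apply: measurable_fun_fubini_tonelli_F; last by move=> xz; rewrite lee_fin.
    by apply/measurable_EFinP; exact: measurable_indic.
  apply/funext => x; rewrite /fubini_F.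
  rewrite -[RHS]/(\int[nu]_z (\1_((fun z => F (x, z)) @^-1` U) z)%:E).
  rewrite integral_indic// ?setIT// -[X in measurable X]setTI; exact: (mFx x).
- exists K => x f [mf f0]; rewrite KE /k /pf ge0_integral_pushforward//.
Qed.

Lemma pkernel_dirac {d} (X : measurableType d) :
  exists K : R.-pker X ~> X, forall (x : X) (f : X -> \bar R), nnmf f ->
    kint K f x = f x.
Proof.
have mid : measurable_fun setT (@id X) by exact: measurable_id.
exists (kdirac mid) => x f [mf f0].
by rewrite !kintE /= integral_dirac// diracT mul1e.
Qed.

Lemma pkernel_comp {d d' d''} {X : measurableType d} {Y : measurableType d'}
    {Z : measurableType d''} (K : R.-pker X ~> Y) (L : R.-pker Y ~> Z) :
  exists M : R.-pker X ~> Z, forall (x : X) (f : Z -> \bar R), nnmf f ->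
    kint M f x = kint K (kint L f) x.
Proof.
(* In [mkcomp] the second kernel also sees the starting point, so [L] is lifted to pairs by ignoring
   the first component. *)
have [||L' L'E] := @pkernel_of_measure _ _ (X * Y)%type Z (fun xy => L xy.2).
- by move=> xy; exact: pkerT.
- move=> U mU.
  by apply: (measurableT_comp (@measurable_kernel _ _ _ _ _ L U mU)).
have [||M ME] := @pkernel_of_measure _ _ X Z (mkcomp K L').
- move=> x; rewrite /mkcomp /= /kcomp.
  under eq_integral do rewrite pkerT.
  by rewrite integral_cst// mul1e pkerT.
- by move=> U mU; exact: measurable_kernel.
exists M => x f [mf f0]; rewrite ME integral_kcomp//.
by rewrite kintE; apply: eq_integral => y _; rewrite -[LHS]kintE L'E kintE.
Qed.

Lemma pkernel_mix {d d'} {X : measurableType d} {Y : measurableType d'}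
    (p : nat -> R) (K : nat -> R.-pker X ~> Y) :
  (forall n, 0 <= p n)%R -> \sum_(0 <= n <oo) (p n)%:E = 1 ->
  exists M : R.-pker X ~> Y, forall (x : X) (f : Y -> \bar R), nnmf f ->
    kint M f x = \sum_(0 <= n <oo) (p n)%:E * kint (K n) f x.
Proof.
move=> p0 p1.
pose k x : {measure set Y -> \bar R} :=
  mseries (fun n => mscale (NngNum (p0 n)) (K n x) : {measure set Y -> \bar R}) 0.
have [||M ME] := @pkernel_of_measure _ _ X Y k.
- move=> x; rewrite /k /= /mseries -[RHS]p1; apply: eq_eseriesr => n _.
  by rewrite -[LHS]/((p n)%:E * K n x setT) pkerT mule1.
- move=> U mU; rewrite /k /= /mseries; apply: ge0_emeasurable_sum => n *.
    by rewrite /mscale mule_ge0.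
  by apply: measurable_funeM; exact: measurable_kernel.
exists M => x f [mf f0]; rewrite ME ge0_integral_measure_series//.
by apply: eq_eseriesr => n _; rewrite kintE ge0_integral_mscale.
Qed.

End kernel_constructions.
Local Close Scope ereal_scope.

(** * Poisson mixtures *)

Section poisson_sums.
Context {R : realType}.
Local Open Scope ereal_scope.
Implicit Types (a : nat -> \bar R) (b : nat -> nat -> \bar R) (l q : R).

(** Summation along antidiagonals: [c] pads the triangle [j <= m] with zeros, which makes the
    interchange of two full series applicable. *)
Lemma nneseries_diagonal b : (forall i j, 0 <= b i j) ->
  \sum_(0 <= m <oo) \sum_(0 <= j < m.+1) b j (m - j)%N =
  \sum_(0 <= j <oo) \sum_(0 <= i <oo) b j i.
Proof.
move=> b0.
pose c m j := if (j <= m)%N then b j (m - j)%N else 0.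
have c0 m j : 0 <= c m j by rewrite /c; case: ifP.
transitivity (\sum_(0 <= m <oo) \sum_(0 <= j <oo) c m j).
  apply: eq_eseriesr => m _.
  rewrite [RHS](nneseries_split 0 m.+1)// add0n [X in _ = _ + X]eseries0 => [|j].
    by rewrite adde0; apply: eq_big_nat => j /andP[_ jm]; rewrite /c -ltnS jm.
  by move=> mj _; rewrite /c leqNgt mj.
rewrite nneseries_interchange//; apply: eq_eseriesr => j _.
rewrite (nneseries_split 0 j)// add0n big_nat_cond big1 ?add0e; last first.
  by move=> m /andP[/andP[_ mj] _]; rewrite /c leqNgt mj.
rewrite -nneseries_addn//; apply: eq_eseriesr => i _.
by rewrite /c leq_addl addnK.
Qed.

(** The Poisson probabilities of mean [l]. Thus [psum l a] below is the expectation of [a] at a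
    Poisson variable. *)
Definition pw l m : R := (expR (- l) * exp_coeff l m)%R.

Definition psum l a : \bar R := \sum_(0 <= m <oo) (pw l m)%:E * a m.

Lemma pw_ge0 l m : (0 <= l -> 0 <= pw l m)%R.
Proof. by move=> l0; rewrite mulr_ge0 ?expR_ge0// exp_coeff_ge0. Qed.

Lemma nneseries_exp_coeff l : (0 <= l)%R ->
  \sum_(0 <= m <oo) (exp_coeff l m)%:E = (expR l)%:E.
Proof.
move=> l0; rewrite /expR -EFin_lim; last exact: is_cvg_series_exp_coeff.
by apply/congr_lim/funext => n /=; rewrite /series /= -sumEFin.
Qed.

Lemma eq_psum l a a' : (forall m, a m = a' m) -> psum l a = psum l a'.
Proof. by move=> aa'; apply: eq_eseriesr => m _; rewrite aa'. Qed.

Lemma le_psum l a a' : (0 <= l)%R -> (forall m, 0 <= a m) ->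
  (forall m, a m <= a' m) -> psum l a <= psum l a'.
Proof.
move=> l0 a0 aa'; apply: lee_nneseries => [m _ _|m _].
  by rewrite mule_ge0// lee_fin pw_ge0.
by rewrite lee_wpmul2l// lee_fin pw_ge0.
Qed.

Lemma psumD l a a' : (0 <= l)%R -> (forall m, 0 <= a m) -> (forall m, 0 <= a' m) ->
  psum l (fun m => a m + a' m) = psum l a + psum l a'.
Proof.
move=> l0 a0 a'0; rewrite /psum -nneseriesD; last 2 first.
- by move=> m _ _; rewrite mule_ge0// lee_fin pw_ge0.
- by move=> m _ _; rewrite mule_ge0// lee_fin pw_ge0.
by apply: eq_eseriesr => m _; rewrite ge0_muleDr.
Qed.

Lemma psumZ l a c : (0 <= l)%R -> (0 <= c)%R -> (forall m, 0 <= a m) ->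
  psum l (fun m => c%:E * a m) = c%:E * psum l a.
Proof.
move=> l0 c0 a0; rewrite /psum -nneseriesZl => [|m _]; last first.
  by rewrite mule_ge0// lee_fin pw_ge0.
by apply: eq_eseriesr => m _; rewrite muleCA.
Qed.

Lemma psum_geom l q : (0 <= l)%R -> (0 <= q)%R ->
  psum l (fun m => (q ^+ m)%:E) = (expR (l * (q - 1)))%:E.
Proof.
move=> l0 q0; rewrite mulrBr mulr1 addrC expRD EFinM -(@nneseries_exp_coeff (l * q)) ?mulr_ge0//.
rewrite -nneseriesZl => [|m _]; last by rewrite lee_fin exp_coeff_ge0// mulr_ge0.
apply: eq_eseriesr => m _; rewrite -!EFinM; congr EFin.
by rewrite /pw /exp_coeff /= exprMn; ring.
Qed.

Lemma psum_cst l (c : \bar R) : (0 <= l)%R -> 0 <= c -> psum l (fun=> c) = c.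
Proof.
case: c => [c| |//]; last first.
  move=> l0 _; apply: (@nneseries_pinfty _ _ _ 0%N) => //.
    by move=> m _; rewrite mule_ge0// lee_fin pw_ge0.
  rewrite gt0_muley// lte_fin /pw /exp_coeff /=.
  by rewrite mulr_gt0 ?expR_gt0// expr0 fact0 divr1.
rewrite lee_fin => l0 c0; rewrite -[RHS]mule1 -[in RHS]expR0 -[in RHS](mulr0 l).
rewrite -[in RHS](subrr 1%R) -psum_geom// -psumZ//.
by apply: eq_psum => m; rewrite expr1n mule1.
Qed.

Lemma pwS l m : (pw l m.+1 * m.+1%:R = l * pw l m)%R.
Proof.
rewrite /pw /exp_coeff /= factS natrM exprS.
have := fact_gt0 m; have := ltn0Sn m; rewrite -(ltr_nat R) -(ltr_nat R 0 m`!).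
by move=> /lt0r_neq0 m0 /lt0r_neq0 m1; field; rewrite nat1r m0 m1.
Qed.

(** The Chen-Stein identity of the Poisson law; applied once and twice it gives the first two
    factorial moments. *)
Lemma psum_shift l a : (0 <= l)%R -> (forall m, 0 <= a m) ->
  psum l (fun m => m%:R%:E * a m) = l%:E * psum l (fun m => a m.+1).
Proof.
move=> l0 a0; rewrite /psum nneseries_recl//; last first.
  by move=> m _; rewrite !mule_ge0// lee_fin ?pw_ge0.
rewrite mul0e mule0 add0e -[LHS]nneseries_addn; last first.
  by move=> m; rewrite !mule_ge0// lee_fin ?pw_ge0.
rewrite -nneseriesZl => [|m _]; last by rewrite mule_ge0// lee_fin pw_ge0.
by apply: eq_eseriesr => m _; rewrite addn1 !muleA -!EFinM pwS.
Qed.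

Lemma psum_id l : (0 <= l)%R -> psum l (fun m => m%:R%:E) = l%:E.
Proof.
move=> l0; rewrite -[RHS]mule1 -[in RHS](@psum_cst l 1)//.
by rewrite -(@psum_shift l (fun=> 1))//; apply: eq_psum => m; rewrite mule1.
Qed.

Lemma psum_falling l : (0 <= l)%R ->
  psum l (fun m => (m * m.-1)%:R%:E) = (l ^+ 2)%:E.
Proof.
move=> l0; under eq_psum do rewrite natrM EFinM.
by rewrite psum_shift//= psum_id// -EFinM expr2.
Qed.

Lemma pw_add l l' m :
  (pw (l + l') m = \sum_(0 <= j < m.+1) pw l j * pw l' (m - j))%R.
Proof.
rewrite /pw /exp_coeff /= opprD expRD exprDn big_mkord mulr_suml mulr_sumr.
rewrite (reindex_inj rev_ord_inj) /=; apply: eq_bigr => j _.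
have jm : (j <= m)%N by rewrite -ltnS.
rewrite subSS subKn// bin_sub// -mulr_natr -(bin_fact jm) !natrM.
have b0 : ('C(m, j)%:R != 0 :> R)%R by rewrite pnatr_eq0 -lt0n bin_gt0.
have j0 : (j`!%:R != 0 :> R)%R by rewrite pnatr_eq0 -lt0n fact_gt0.
have i0 : ((m - j)`!%:R != 0 :> R)%R by rewrite pnatr_eq0 -lt0n fact_gt0.
by field; rewrite b0 j0 i0.
Qed.

(** The sum of independent Poisson variables is Poisson; this becomes the semigroup property of
    [poisk]. *)
Lemma psum_add l l' a : (0 <= l)%R -> (0 <= l')%R -> (forall m, 0 <= a m) ->
  psum (l + l') a = psum l (fun i => psum l' (fun j => a (i + j)%N)).
Proof.
move=> l0 l'0 a0; rewrite /psum.
transitivity (\sum_(0 <= j <oo) \sum_(0 <= i <oo)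
    (pw l j * pw l' i)%:E * a (j + i)%N).
  rewrite -nneseries_diagonal => [|i j]; last first.
    by rewrite mule_ge0// lee_fin mulr_ge0 ?pw_ge0.
  apply: eq_eseriesr => m _; rewrite pw_add -sumEFin ge0_sume_distrl => [|j _].
    by apply: eq_big_nat => j /andP[_ jm]; rewrite subnKC -1?ltnS.
  by rewrite lee_fin mulr_ge0 ?pw_ge0.
apply: eq_eseriesr => j _; rewrite -nneseriesZl => [|i _]; last first.
  by rewrite mule_ge0// lee_fin pw_ge0.
by apply: eq_eseriesr => i _; rewrite EFinM muleA.
Qed.

(** Thinning: among a Poisson number of trials, the successes [j] and failures [i] are independent
    Poisson variables of means [l * p] and [l * (1 - p)], and the failures sum out. *)
Lemma psum_thin l p a : (0 <= l)%R -> (0 <= p <= 1)%R -> (forall m, 0 <= a m) ->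
  psum l (fun m => \sum_(0 <= j < m.+1)
    ('C(m, j)%:R * p ^+ j * (1 - p) ^+ (m - j))%:E * a j) = psum (l * p) a.
Proof.
move=> l0 /andP[p0 p1] a0.
have q0 : (0 <= 1 - p)%R by rewrite subr_ge0.
transitivity (\sum_(0 <= j <oo) \sum_(0 <= i <oo)
    (pw (l * p) j)%:E * a j * (pw (l * (1 - p)) i)%:E).
  rewrite -nneseries_diagonal => [|i j]; last first.
    by rewrite !mule_ge0// lee_fin ?pw_ge0// mulr_ge0.
  apply: eq_eseriesr => m _; rewrite ge0_sume_distrr => [|j _]; last first.
    by rewrite mule_ge0// lee_fin !mulr_ge0// exprn_ge0.
  apply: eq_big_nat => j /andP[_ jm].
  rewrite muleAC muleA -!EFinM; congr (_%:E * _).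
  rewrite /pw /exp_coeff /= [in RHS]mulrACA -expRD -opprD -mulrDr subrKC mulr1.
  have jm' : (j <= m)%N by rewrite -ltnS.
  rewrite -[in X in (X / _)%R](subnKC jm') -(bin_fact jm') !exprMn exprD !natrM.
  have b0 : ('C(m, j)%:R != 0 :> R)%R by rewrite pnatr_eq0 -lt0n bin_gt0.
  have j0 : (j`!%:R != 0 :> R)%R by rewrite pnatr_eq0 -lt0n fact_gt0.
  have i0 : ((m - j)`!%:R != 0 :> R)%R by rewrite pnatr_eq0 -lt0n fact_gt0.
  by field; rewrite b0 j0 i0.
apply: eq_eseriesr => j _; rewrite -[RHS](@psum_cst (l * (1 - p))) ?mulr_ge0//.
  by apply: eq_eseriesr => i _; rewrite muleC.
by rewrite mule_ge0// lee_fin pw_ge0// mulr_ge0.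
Qed.

End poisson_sums.

Local Open Scope ereal_scope.

Section poisson_kernel.
Context {R : realType} {d} {X : measurableType d}.
Implicit Types (K V W : R.-pker X ~> X) (f g : X -> \bar R) (l t : R).

Lemma nnmf_iter K m f : nnmf f -> nnmf (iter m (kint K) f).
Proof. by move=> nf; elim: m => //= m IH; exact: nnmf_kint. Qed.

Lemma iterD_kint K m f g x : nnmf f -> nnmf g ->
  iter m (kint K) (fun y => f y + g y) x = iter m (kint K) f x + iter m (kint K) g x.
Proof.
move=> nf ng; elim: m x => //= m IH x.
rewrite -kintD; [|exact: nnmf_iter..].
by apply: eq_kint => y; exact: IH.
Qed.

Lemma iterZ_kint K m (c : \bar R) f x : 0 <= c -> nnmf f ->
  iter m (kint K) (fun y => c * f y) x = c * iter m (kint K) f x.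
Proof.
move=> c0 nf; elim: m x => //= m IH x.
rewrite -kintZ//; last exact: nnmf_iter.
by apply: eq_kint => y; exact: IH.
Qed.

Lemma iter_sum_kint K m (J : Type) (s : seq J) (h : J -> X -> \bar R) x :
  (forall i, nnmf (h i)) ->
  iter m (kint K) (fun y => \sum_(i <- s) h i y) x =
  \sum_(i <- s) iter m (kint K) (h i) x.
Proof.
move=> nh; elim: m x => //= m IH x.
rewrite -kint_sum => [|i]; last exact: nnmf_iter.
by apply: eq_kint => y; exact: IH.
Qed.

Lemma iter_series_kint K m (h : nat -> X -> \bar R) x :
  (forall i, nnmf (h i)) ->
  iter m (kint K) (fun y => \sum_(0 <= i <oo) h i y) x =
  \sum_(0 <= i <oo) iter m (kint K) (h i) x.
Proof.
move=> nh; elim: m x => //= m IH x.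
rewrite -kint_series => [|i]; last exact: nnmf_iter.
by apply: eq_kint => y; exact: IH.
Qed.

Lemma iter_kint_le K m f g x : nnmf f -> nnmf g -> (forall y, f y <= g y) ->
  iter m (kint K) f x <= iter m (kint K) g x.
Proof.
move=> nf ng fg; elim: m x => //= m IH x.
by apply: kint_le => //; exact: nnmf_iter.
Qed.

Lemma iter_kint_cst K m (c : \bar R) x : 0 <= c -> iter m (kint K) (fun=> c) x = c.
Proof.
move=> c0; elim: m x => //= m IH x; rewrite -[RHS](@kint_cst _ _ _ _ _ K c x)//.
by apply: eq_kint => y; exact: IH.
Qed.

Lemma poisson_kernel_exists K l : exists M : R.-pker X ~> X, (0 <= l)%R ->
  forall f, nnmf f -> forall x, kint M f x = psum l (fun m => iter m (kint K) f x).
Proof.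
(* A negative rate gets a dummy kernel, so that [poisk] is defined for every real [l]. *)
have [l0|l0] := boolP (0 <= l)%R; last by exists K.
have iterk m : exists M : R.-pker X ~> X,
    forall f, nnmf f -> forall x, kint M f x = iter m (kint K) f x.
  elim: m => [|m [M ME]].
    by have [M ME] := @pkernel_dirac R _ X; exists M => f nf x; exact: ME.
  have [M' M'E] := pkernel_comp K M; exists M' => f nf x.
  by rewrite M'E//=; apply: eq_kint => y; exact: ME.
have [Km KmE] := choice iterk.
have [m||M ME] := @pkernel_mix R _ _ X X (pw l) Km; first exact: pw_ge0.
  rewrite -[RHS](@psum_cst R l 1)//.
  by apply: eq_eseriesr => m _; rewrite mule1.
exists M => _ f nf x; rewrite ME//.
by apply: eq_eseriesr => m _; rewrite KmE.
Qed.

Definition poisk K l : R.-pker X ~> X := projT1 (cid (poisson_kernel_exists K l)).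

Lemma poiskE K l f x : (0 <= l)%R -> nnmf f ->
  kint (poisk K l) f x = psum l (fun m => iter m (kint K) f x).
Proof. by move=> l0 nf; rewrite /poisk; case: cid => M /= ->. Qed.

Lemma poisk0 K f x : nnmf f -> kint (poisk K 0) f x = f x.
Proof.
move=> nf; rewrite poiskE// /psum (nneseries_split 0 1)// => [|k _]; last first.
  by rewrite mule_ge0 ?lee_fin ?pw_ge0//; exact: (nnmf_iter _ _ nf).2.
rewrite add0n big_nat1 eseries0 ?adde0 => [|[|k]//= _ _].
  by rewrite /pw /exp_coeff /= oppr0 expR0 expr0 fact0 divr1 mulr1 mul1e.
by rewrite /pw /exp_coeff /= expr0n /= mul0r mulr0 mul0e.
Qed.

Lemma poisk_semigroup K s t f x : (0 <= s)%R -> (0 <= t)%R -> nnmf f ->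
  kint (poisk K (s + t)) f x = kint (poisk K s) (kint (poisk K t) f) x.
Proof.
move=> s0 t0 nf.
rewrite !poiskE ?addr_ge0//; last exact: nnmf_kint.
rewrite psum_add// => [|m]; last exact: (nnmf_iter _ _ nf).2.
apply: eq_psum => i.
rewrite (_ : kint (poisk K t) f =
    fun y => \sum_(0 <= j <oo) (pw t j)%:E * iter j (kint K) f y); last first.
  by apply/funext => y; rewrite poiskE.
rewrite iter_series_kint => [|j]; last first.
  by apply: nnmfZ; [rewrite lee_fin pw_ge0|exact: nnmf_iter].
apply: eq_eseriesr => j _; rewrite iterZ_kint ?lee_fin ?pw_ge0//.
  by rewrite iterD.
exact: nnmf_iter.
Qed.

(** Pascal's rule: the binomial mean for [m.+1] trials, conditioned on the outcome of one of
    them. *)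
Lemma binomial_mix q m (a : nat -> \bar R) : (0 <= q <= 1)%R ->
  (forall j, 0 <= a j) ->
  q%:E * (\sum_(0 <= j < m.+1)
      ('C(m, j)%:R * q ^+ j * (1 - q) ^+ (m - j))%:E * a j.+1) +
  (1 - q)%:E * (\sum_(0 <= j < m.+1)
      ('C(m, j)%:R * q ^+ j * (1 - q) ^+ (m - j))%:E * a j) =
  \sum_(0 <= j < m.+2)
      ('C(m.+1, j)%:R * q ^+ j * (1 - q) ^+ (m.+1 - j))%:E * a j.
Proof.
move=> /andP[q0 q1] a0.
have q'0 : (0 <= 1 - q)%R by rewrite subr_ge0.
pose c n j : R := ('C(n, j)%:R * q ^+ j * (1 - q) ^+ (n - j))%R.
have c0 n j : (0 <= c n j)%R by rewrite /c !mulr_ge0 ?exprn_ge0.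
have ca0 n j i : 0 <= (c n j)%:E * a i by rewrite mule_ge0// lee_fin.
rewrite -/(c _ _) [RHS]big_nat_recl// !ge0_sume_distrr//; try by move=> j _; exact: ca0.
rewrite [X in _ + X]big_nat_recl//.
have -> : \sum_(0 <= i < m) (1 - q)%:E * ((c m i.+1)%:E * a i.+1) =
    \sum_(0 <= i < m.+1) (1 - q)%:E * ((c m i.+1)%:E * a i.+1).
  by rewrite [RHS]big_nat_recr//= {3}/c bin_small// !mul0r mul0e mule0 adde0.
rewrite addeCA -big_split /=; congr (_ + _).
  by rewrite muleA -EFinM /c !bin0 !expr0 !mulr1 !mul1r !subn0 exprS.
apply: eq_big_nat => j /andP[_ jm]; rewrite !muleA -!EFinM.
rewrite -ge0_muleDl; [|by rewrite lee_fin mulr_ge0 ?c0..].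
congr (_ * _); rewrite -EFinD; congr (_%:E).
rewrite /c binS natrD subSS exprS.
have [mj|mj] := leqP m j.
  have -> : j = m by apply/eqP; rewrite eqn_leq -ltnS jm.
  by rewrite (@bin_small m m.+1)// binn subnn mulr0n; ring.
have -> : (m - j = (m - j.+1).+1)%N by rewrite subnSK.
rewrite !exprS; ring.
Qed.

(* [V] performs a step of [W] with probability [q] and otherwise stays put. *)
Lemma poisk_thin V W q l f x : (0 <= q <= 1)%R -> (0 <= l)%R ->
  (forall g y, nnmf g -> kint V g y = q%:E * kint W g y + (1 - q)%:E * g y) ->
  nnmf f -> kint (poisk V l) f x = kint (poisk W (l * q)) f x.
Proof.
move=> /andP[q0 q1] l0 VW nf.
rewrite !poiskE ?mulr_ge0// -psum_thin ?q0//; last first.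
  by move=> m; exact: (nnmf_iter _ _ nf).2.
apply: eq_psum => m.
have q'0 : (0 <= 1 - q)%R by rewrite subr_ge0.
elim: m x => [|m IH] x.
  by rewrite big_nat1 bin0 subnn !expr0 !mul1r mul1e.
rewrite /= VW; last exact: nnmf_iter.
rewrite IH -(binomial_mix m (a := fun j => iter j (kint W) f x)) ?q0//; last first.
  by move=> j; exact: (nnmf_iter _ _ nf).2.
congr (q%:E * _ + _); transitivity (kint W (fun y => \sum_(0 <= j < m.+1)
    ('C(m, j)%:R * q ^+ j * (1 - q) ^+ (m - j))%:E * iter j (kint W) f y) x).
  by apply: eq_kint => y; exact: IH.
have c0 j : 0 <= ('C(m, j)%:R * q ^+ j * (1 - q) ^+ (m - j))%:E.
  by rewrite lee_fin !mulr_ge0 ?exprn_ge0.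
rewrite kint_sum => [|j]; last by apply: nnmfZ => //; exact: nnmf_iter.
by apply: eq_bigr => j _; rewrite kintZ//; exact: nnmf_iter.
Qed.

End poisson_kernel.
Local Close Scope ereal_scope.

(** * Finite-volume dynamics *)

Local Open Scope ereal_scope.

Section finite_volume.
Context {R : realType} {I : choiceType}.
Notation C := (prodsp I R).
Variables (th : I -> R.-pker C ~> C) (nb : I -> seq I).
Implicit Types (f g : C -> \bar R) (L S : seq I).
Hypothesis th_out : forall k S (f : C -> \bar R), nnmf f -> local S f ->
  k \notin S -> forall x, kint (th k) f x = f x.
Hypothesis th_local : forall k S (f : C -> \bar R), nnmf f -> local S f ->
  local (S ++ nb k) (kint (th k) f).

Let stay : R.-pker C ~> C := projT1 (cid (@pkernel_dirac R _ C)).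

Let stayE f x : nnmf f -> kint stay f x = f x.
Proof. by move=> nf; rewrite /stay; case: cid => K /= ->. Qed.

Let unif (c i : nat) : R := if (i < c.+1)%N then (c.+1%:R^-1)%R else 0%R.

Let unif_ge0 c i : (0 <= unif c i)%R.
Proof. by rewrite /unif; case: ifP. Qed.

Let unif_series c (a : nat -> \bar R) : (forall i, 0 <= a i) ->
  \sum_(0 <= i <oo) (unif c i)%:E * a i =
  (c.+1%:R^-1)%:E * \sum_(0 <= i < c.+1) a i.
Proof.
move=> a0; rewrite (nneseries_split 0 c.+1) => [|i _]; last first.
  by rewrite mule_ge0// lee_fin.
rewrite add0n [X in _ + X]eseries0 => [|i ci _]; last first.
  by rewrite /unif ltnNge ci mul0e.
rewrite adde0 ge0_sume_distrr//; apply: eq_big_nat => i /andP[_ ic].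
by rewrite /unif ic.
Qed.

Let unif1 c : \sum_(0 <= i <oo) (unif c i)%:E = 1.
Proof.
transitivity (\sum_(0 <= i <oo) (unif c i)%:E * 1).
  by apply: eq_eseriesr => i _; rewrite mule1.
rewrite unif_series// sumEFin sumr_const_nat subn0 -EFinM.
by rewrite mulVf// pnatr_eq0.
Qed.

Lemma stepk_exists L c : exists K : R.-pker C ~> C,
  (size L <= c.+1)%N -> forall f x, nnmf f -> kint K f x = (c.+1%:R^-1)%:E *
    (\sum_(k <- L) kint (th k) f x + (c.+1 - size L)%:R%:E * f x).
Proof.
(* A slot is drawn uniformly among [c.+1]; the default [stay] of [nth] fills those beyond
   [size L]. *)
have [K KE] := pkernel_mix (fun i => nth stay (map th L) i) (unif_ge0 c) (unif1 c).
exists K => Lc f x nf; rewrite KE//.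
rewrite unif_series => [|i]; last exact: (nnmf_kint _ nf).2.
congr (_ * _); rewrite (big_cat_nat (leq0n _) Lc)//=; congr (_ + _).
  transitivity (\sum_(K <- map th L) kint K f x); last by rewrite big_map.
  by rewrite (big_nth stay) size_map.
rewrite (eq_big_nat _ _ (F2 := fun=> f x)) => [|i /andP[Li _]]; last first.
  by rewrite nth_default ?size_map// stayE.
under eq_bigr do rewrite -[f x]mul1e.
by rewrite -ge0_sume_distrl// sumEFin sumr_const_nat.
Qed.

(* One step of the [c.+1]-uniformized chain updating only the sites of [L]; the
   excess of the clock over [size L] leaves the configuration unchanged. *)
Definition stepk (L : seq I) (c : nat) : R.-pker C ~> C :=
  projT1 (cid (stepk_exists L c)).

Lemma stepkE L c f x : (size L <= c.+1)%N -> nnmf f ->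
  kint (stepk L c) f x = (c.+1%:R^-1)%:E *
    (\sum_(k <- L) kint (th k) f x + (c.+1 - size L)%:R%:E * f x).
Proof. by move=> Lc nf; rewrite /stepk; case: cid => K /= KE; rewrite KE. Qed.

(** Clock rate [(size L).+1] times probability [1 / (size L).+1] per slot: each entry of [L] is
    updated at rate 1. The one idle slot keeps the number of slots positive when [L] is empty. *)
Definition fvol (L : seq I) (t : R) := poisk (stepk L (size L)) ((size L).+1%:R * t).

(** A faster clock with more idle slots gives the same semigroup, by thinning with
    [q = (size L).+1 / c.+1]. This lets two volumes share one clock. *)
Lemma fvolE L c t f x : (0 <= t)%R -> (size L <= c)%N -> nnmf f ->
  kint (fvol L t) f x = kint (poisk (stepk L c) (c.+1%:R * t)) f x.
Proof.
move=> t0 Lc nf; rewrite /fvol.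
have c0 : (c.+1%:R != 0 :> R)%R by rewrite pnatr_eq0.
have -> : ((size L).+1%:R * t = c.+1%:R * t * ((size L).+1%:R / c.+1%:R) :> R)%R.
  by field; rewrite nat1r.
apply/esym/poisk_thin => //.
- by rewrite divr_ge0//= ler_pdivrMr ?ltr0n// mul1r ler_nat ltnS.
- by rewrite mulr_ge0.
move=> g y ng; rewrite !stepkE//; last by rewrite (leq_trans Lc).
set S := \sum_(k <- L) _.
have S0 : 0 <= S by apply: sume_ge0 => k _; exact: (nnmf_kint _ ng).2.
have gy0 := ng.2 y.
rewrite subSnn mul1e muleA -EFinM.
have -> : ((size L).+1%:R / c.+1%:R / (size L).+1%:R = c.+1%:R^-1 :> R)%R.
  by field; rewrite !nat1r !pnatr_eq0.
rewrite !ge0_muleDr ?mule_ge0 ?lee_fin// -addeA; congr (_ + _).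
have q1 : (0 <= 1 - (size L).+1%:R / c.+1%:R :> R)%R.
  by rewrite subr_ge0 ler_pdivrMr ?ltr0n// mul1r ler_nat ltnS.
rewrite muleA -EFinM -ge0_muleDl ?lee_fin// -EFinD; congr (_%:E * _).
rewrite natrB ?(leq_trans Lc)//; field; by rewrite nat1r.
Qed.

Variables (phi : I -> R) (Cn : R).
Hypothesis phi_ge0 : forall i, (0 <= phi i)%R.
Hypothesis Cn_ge0 : (0 <= Cn)%R.
Hypothesis phi_nb : forall k, (\sum_(j <- nb k) phi j <= Cn * phi k)%R.

(** Updates outside [S] do not change [f], so their slots merge with the idle ones. The result no
    longer depends on [L]. *)
Lemma stepk_local L c S f x : uniq L -> (size L <= c.+1)%N -> nnmf f ->
  local S f -> uniq S -> {subset S <= L} ->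
  kint (stepk L c) f x = (c.+1%:R^-1)%:E *
    (\sum_(k <- S) kint (th k) f x + (c.+1 - size S)%:R%:E * f x).
Proof.
move=> uL Lc nf Sf uS SL; rewrite stepkE//; congr (_ * _).
have SLc : (size S <= c.+1)%N by rewrite (leq_trans _ Lc)// uniq_leq_size.
rewrite (bigID (mem S)) /= -addeA; congr (_ + _).
  rewrite -big_filter; apply: perm_big; apply: uniq_perm => //.
    exact: filter_uniq.
  by move=> k; rewrite mem_filter; case: (boolP (k \in S)) => //= /SL ->.
have szS : size [seq k <- L | k \in S] = size S.
  apply/perm_size/uniq_perm => //; first exact: filter_uniq.
  by move=> k; rewrite mem_filter; case: (boolP (k \in S)) => //= /SL ->.
have -> : \sum_(k <- L | k \notin S) kint (th k) f x =
    (size L - size S)%:R%:E * f x.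
  rewrite (eq_bigr (fun=> 1 * f x)) => [|k kS]; last by rewrite mul1e (th_out nf Sf).
  rewrite -ge0_sume_distrl// sumEFin -big_filter big_const_seq count_predT.
  rewrite iter_addr_0 -szS !size_filter -(count_predC (mem S) L) addKn.
  by congr (_%:R%:E * _).
have fx0 := nf.2 x.
rewrite -ge0_muleDl ?lee_fin// -EFinD -natrD; congr (_%:R%:E * _).
by rewrite addnC addnBA ?subnK// uniq_leq_size.
Qed.

Lemma sum_undup_le S : (\sum_(j <- undup S) phi j <= \sum_(j <- S) phi j)%R.
Proof.
elim: S => [|k S IH] //=; rewrite big_cons; case: ifP => _.
  by rewrite (le_trans IH)// lerDr.
by rewrite big_cons lerD2l.
Qed.

(* [phi] bounds the spread of dependence: each step multiplies the total weight of the
   sites a function depends on by at most [1 + Cn / c.+1] on average, and an update on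
   which the two volumes disagree costs weight [M]. *)
Lemma iter_stepk_close L1 L2 c (M : R) S f m x : (0 < M)%R ->
  uniq L1 -> uniq L2 -> (size L1 <= c.+1)%N -> (size L2 <= c.+1)%N ->
  (forall j, j \notin L1 -> (M <= phi j)%R) ->
  (forall j, j \notin L2 -> (M <= phi j)%R) ->
  nnmf f -> local S f -> (forall y, f y <= 1) ->
  iter m (kint (stepk L1 c)) f x <= iter m (kint (stepk L2 c)) f x +
    ((\sum_(j <- S) phi j) / M * (1 + Cn / c.+1%:R) ^+ m)%:E.
Proof.
move=> M0 uL1 uL2 L1c L2c L1M L2M.
set q := (1 + Cn / c.+1%:R)%R.
have q1 : (1 <= q)%R by rewrite lerDl divr_ge0.
have qm m' : (0 <= q ^+ m')%R by rewrite exprn_ge0// (le_trans _ q1).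
have phiS S' : (0 <= \sum_(j <- S') phi j)%R by apply: sumr_ge0.
elim: m S f x => [|m IH] S f x nf Sf f1.
  by rewrite /= leeDl// lee_fin expr0 mulr1 divr_ge0// ltW.
(* A site of [S] missing from one of the volumes has weight at least [M]; the error term is then at
   least 1 and the bound is trivial. *)
have [/allP SL|/allPn[j jS]] := boolP (all (mem [predI L1 & L2]) S); last first.
  rewrite !inE negb_and => jL.
  have Mj : (M <= phi j)%R by case/orP: jL => [/L1M|/L2M].
  apply: (@le_trans _ _ 1).
    rewrite -[leRHS](@iter_kint_cst _ _ _ (stepk L1 c) m.+1 1 x)//.
    by apply: iter_kint_le => //; exact: nnmf_cst.
  rewrite -[leLHS]add0e leeD//; first exact: (nnmf_iter _ _ nf).2.
  rewrite lee_fin mulr_ege1 ?exprn_ege1// ler_pdivlMr// mul1r (le_trans Mj)//.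
  by rewrite (big_rem j)//= lerDl.
set S' := undup S.
have uS' : uniq S' by exact: undup_uniq.
have S'L1 : {subset S' <= L1} by move=> k; rewrite mem_undup => /SL /andP[].
have S'L2 : {subset S' <= L2} by move=> k; rewrite mem_undup => /SL /andP[].
have S'f : local S' f by apply: local_sub Sf => k; rewrite mem_undup.
have S'c : (size S' <= c.+1)%N by rewrite (leq_trans _ L1c)// uniq_leq_size.
pose b : R := (c.+1 - size S')%:R.
(* With [S'] inside both volumes, one step sends [f] to the same [g] in either. The remaining [m]
   steps are compared by the induction hypothesis, applied to each updated function and to [f]
   itself, with errors [e k] and [e0]. *)
pose g y := (c.+1%:R^-1)%:E * (\sum_(k <- S') kint (th k) f y + b%:E * f y).
have Vg L : uniq L -> (size L <= c.+1)%N -> {subset S' <= L} ->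
    kint (stepk L c) f = g.
  by move=> uL Lc S'L; apply/funext => y; exact: stepk_local.
have ng k : nnmf (kint (th k) f) by exact: nnmf_kint.
have b0 : (0 <= b)%R by rewrite /b.
have nbf : nnmf (fun y => b%:E * f y) by apply: nnmfZ.
have itg L : iter m (kint (stepk L c)) g x = (c.+1%:R^-1)%:E *
    (\sum_(k <- S') iter m (kint (stepk L c)) (kint (th k) f) x +
      b%:E * iter m (kint (stepk L c)) f x).
  rewrite /g iterZ_kint ?lee_fin//; last by apply: nnmfD => //; exact: nnmf_sum.
  by rewrite iterD_kint ?iter_sum_kint ?iterZ_kint//; exact: nnmf_sum.
pose e k : R := ((\sum_(j <- S') phi j + \sum_(j <- nb k) phi j) / M * q ^+ m)%R.
pose e0 : R := ((\sum_(j <- S') phi j) / M * q ^+ m)%R.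
have e_ge0 k : (0 <= e k)%R by rewrite mulr_ge0// divr_ge0 ?addr_ge0// ltW.
have e0_ge0 : (0 <= e0)%R by rewrite mulr_ge0// divr_ge0 ?addr_ge0// ltW.
have itSg L : uniq L -> (size L <= c.+1)%N -> {subset S' <= L} ->
    iter m.+1 (kint (stepk L c)) f x = (c.+1%:R^-1)%:E *
    (\sum_(k <- S') iter m (kint (stepk L c)) (kint (th k) f) x +
      b%:E * iter m (kint (stepk L c)) f x).
  by move=> uL Lc S'L; rewrite -itg -(Vg L)// -[RHS]/((iter m _ (kint _ f)) x) -iterSr.
rewrite (itSg L1 uL1 L1c S'L1) (itSg L2 uL2 L2c S'L2).
set U := stepk L2 c.
apply: (@le_trans _ _ ((c.+1%:R^-1)%:E *
    ((\sum_(k <- S') iter m (kint U) (kint (th k) f) x + b%:E * iter m (kint U) f x) +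
     (\sum_(k <- S') e k + b * e0)%:E))).
  apply: lee_wpmul2l; first by rewrite lee_fin.
  rewrite EFinD -sumEFin addeACA -big_split /=; apply: leeD.
    apply: lee_sum => k _; rewrite /e -big_cat; apply: IH => //; first exact: th_local.
    move=> y; rewrite -[leRHS](@kint_cst _ _ _ _ _ (th k) 1 y)//.
    by apply: kint_le => //; exact: nnmf_cst.
  rewrite EFinM -ge0_muleDr ?lee_fin//; last exact: (nnmf_iter _ _ nf).2.
  by rewrite lee_wpmul2l ?lee_fin//; exact: IH.
rewrite ge0_muleDr; last 2 first.
- apply: adde_ge0; first by apply: sume_ge0 => k _; exact: (nnmf_iter _ _ (ng k)).2.
  by rewrite mule_ge0 ?lee_fin//; exact: (nnmf_iter _ _ nf).2.
- by rewrite lee_fin addr_ge0 ?sumr_ge0// mulr_ge0.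
rewrite leeD2l// -EFinM lee_fin.
(* Each of the [c.+1] slots contributes the weight of [S']; the updated sites add the weights of
   their neighbourhoods, in total at most [Cn] times that of [S']. *)
have sum_e : (\sum_(k <- S') e k + b * e0 <=
    (c.+1%:R + Cn) * (\sum_(j <- S') phi j) / M * q ^+ m)%R.
  rewrite /e /e0 -mulr_suml -mulr_suml !mulrA -mulrDl -mulrDl.
  rewrite ler_wpM2r// ler_wpM2r ?invr_ge0 ?(ltW M0)//.
  rewrite big_split /= big_const_seq count_predT iter_addr_0.
  rewrite -[X in (X + _ + _ <= _)%R]mulr_natl addrAC -mulrDl /b natrB// subrKC mulrDl lerD2l.
  rewrite mulr_sumr; apply: ler_sum => k _; exact: phi_nb.
apply: (@le_trans _ _ ((c.+1%:R)^-1 *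
    ((c.+1%:R + Cn) * (\sum_(j <- S') phi j) / M * q ^+ m))%R).
  by rewrite ler_wpM2l.
have -> : ((c.+1%:R)^-1 * ((c.+1%:R + Cn) * (\sum_(j <- S') phi j) / M * q ^+ m) =
    (\sum_(j <- S') phi j) / M * q ^+ m.+1 :> R)%R.
  by rewrite /q exprS; field; rewrite nat1r pnatr_eq0 /= gt_eqF.
by rewrite ler_wpM2r// ler_wpM2r ?invr_ge0 ?(ltW M0)//; exact: sum_undup_le.
Qed.

(** Averaging the bound for [m] steps over the Poisson number of steps: the generating function
    turns [(1 + Cn / c.+1) ^+ m] into [expR (Cn * t)], which is free of the clock rate. *)
Lemma fvol_close L1 L2 (M : R) S f t x : (0 < M)%R -> (0 <= t)%R ->
  uniq L1 -> uniq L2 ->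
  (forall j, j \notin L1 -> (M <= phi j)%R) ->
  (forall j, j \notin L2 -> (M <= phi j)%R) ->
  nnmf f -> local S f -> (forall y, f y <= 1) ->
  kint (fvol L1 t) f x <= kint (fvol L2 t) f x +
    ((\sum_(j <- S) phi j) / M * expR (Cn * t))%:E.
Proof.
move=> M0 t0 uL1 uL2 L1M L2M nf Sf f1.
pose c := maxn (size L1) (size L2).
have L1c : (size L1 <= c)%N by rewrite leq_maxl.
have L2c : (size L2 <= c)%N by rewrite leq_maxr.
rewrite !(@fvolE _ c)//.
have l0 : (0 <= c.+1%:R * t)%R by rewrite mulr_ge0.
have S0 : (0 <= (\sum_(j <- S) phi j) / M)%R by rewrite divr_ge0 ?sumr_ge0// ltW.
have q0 : (0 <= 1 + Cn / c.+1%:R)%R by rewrite addr_ge0// divr_ge0.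
rewrite !poiskE//.
have -> : expR (Cn * t) = expR (c.+1%:R * t * ((1 + Cn / c.+1%:R) - 1)).
  by congr expR; field; rewrite nat1r.
rewrite EFinM -psum_geom// -psumZ//; last by move=> m; rewrite lee_fin exprn_ge0.
rewrite -psumD//; last 2 first.
- by move=> m; exact: (nnmf_iter _ _ nf).2.
- by move=> m; rewrite mule_ge0// lee_fin exprn_ge0.
apply: le_psum => //; first by move=> m; exact: (nnmf_iter _ _ nf).2.
by move=> m; rewrite -EFinM; apply: iter_stepk_close => //; rewrite leqW.
Qed.

End finite_volume.

(** A discrete Taylor formula: [g] drifts by at most [m * D / N] in [m] steps, and summing gives the
    falling factorial [m * (m - 1)]. Its Poisson mean is exactly the squared rate, so that the rate
    [N * t] leaves [D * t ^+ 2 / 2]. *)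
Lemma second_order_recurrence {R : realType} (a g : nat -> R) (N D : R) :
  (0 < N)%R -> (forall m, a m.+1 = a m + g m / N)%R ->
  (forall m, `|g m.+1 - g m| <= D / N)%R ->
  (forall m, `|a m - a 0%N - m%:R * (g 0%N / N)| <= (m * m.-1)%:R * (D / N ^+ 2 / 2))%R.
Proof.
move=> N0 aS gS.
have gm m : (`|g m - g 0%N| <= m%:R * (D / N))%R.
  elim: m => [|m IH]; first by rewrite subrr normr0 mul0r.
  rewrite (_ : g m.+1 - g 0%N = (g m.+1 - g m) + (g m - g 0%N))%R; last by ring.
  by rewrite (le_trans (ler_normD _ _))// -nat1r mulrDl mul1r lerD.
elim=> [|m IH]; first by rewrite subrr mul0r subr0 normr0 mul0n mul0r.
rewrite (_ : (a m.+1 - a 0%N - m.+1%:R * (g 0%N / N) =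
  (a m - a 0%N - m%:R * (g 0%N / N)) + (g m - g 0%N) / N)%R); last first.
  by rewrite aS -nat1r; ring.
rewrite (le_trans (ler_normD _ _))//.
apply: (@le_trans _ _ ((m * m.-1)%:R * (D / N ^+ 2 / 2) + m%:R * (D / N) / N)%R).
  by rewrite lerD// normrM normfV (gtr0_norm N0) ler_wpM2r// invr_ge0 ltW.
rewrite le_eqVlt; apply/orP; left; apply/eqP.
have N0' : (N != 0)%R by rewrite gt_eqF.
case: m {IH} => [|m] /=; first by rewrite !mul0n muln0 mulr0n !mul0r add0r.
by rewrite !natrM -!nat1r; field.
Qed.

Lemma lee_sum_size {R : realType} (J : Type) (s : seq J) (h : J -> \bar R) (B : R) :
  (forall k, h k <= B%:E) -> \sum_(k <- s) h k <= ((size s)%:R * B)%:E.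
Proof.
move=> hB; elim: s => [|k s IH]; first by rewrite big_nil mul0r.
by rewrite big_cons /= -nat1r mulrDl mul1r EFinD leeD.
Qed.

(** * The generator estimate in finite volume, uniform in the volume *)

Section generator_estimate.
Context {R : realType} {I : choiceType}.
Notation C := (prodsp I R).
Variable th : I -> R.-pker C ~> C.
Implicit Types (f g : C -> \bar R) (L S : seq I).
Hypothesis th_out : forall k S f, nnmf f -> local S f ->
  k \notin S -> forall x, kint (th k) f x = f x.

(** The increment of one step is the generator divided by the clock rate; the negative term is moved
    to the left to avoid subtraction in the extended reals. *)
Lemma stepk_balance L c S f x : uniq L -> (size L <= c.+1)%N -> nnmf f ->
  local S f -> uniq S -> {subset S <= L} ->
  kint (stepk th L c) f x + ((size S)%:R / c.+1%:R)%:E * f x =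
  f x + (c.+1%:R^-1)%:E * \sum_(k <- S) kint (th k) f x.
Proof.
move=> uL Lc nf Sf uS SL; rewrite (stepk_local th_out (S := S))//.
have SLc : (size S <= c.+1)%N by rewrite (leq_trans _ Lc)// uniq_leq_size.
have fx0 := nf.2 x.
have s0 : 0 <= \sum_(k <- S) kint (th k) f x.
  by apply: sume_ge0 => k _; exact: (nnmf_kint _ nf).2.
rewrite ge0_muleDr//; last by rewrite mule_ge0// lee_fin.
rewrite -addeA addeC; congr (_ + _).
rewrite muleA -EFinM -ge0_muleDl ?lee_fin ?mulr_ge0//.
rewrite -EFinD -[RHS]mul1e; congr (_%:E * _).
by rewrite natrB//; field; rewrite nat1r.
Qed.

Lemma stepk_close L c S f (B : R) x : (0 <= B)%R -> uniq L -> (size L <= c.+1)%N ->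
  nnmf f -> (forall y, f y <= B%:E) -> local S f -> uniq S -> {subset S <= L} ->
  kint (stepk th L c) f x <= f x + ((size S)%:R * B / c.+1%:R)%:E /\
  f x <= kint (stepk th L c) f x + ((size S)%:R * B / c.+1%:R)%:E.
Proof.
move=> B0 uL Lc nf fB Sf uS SL.
have bal := stepk_balance x uL Lc nf Sf uS SL.
have fx0 := nf.2 x.
have k0 := (nnmf_kint (stepk th L c) nf).2 x.
have s0 : 0 <= \sum_(k <- S) kint (th k) f x.
  by apply: sume_ge0 => k _; exact: (nnmf_kint _ nf).2.
split.
  apply: (@le_trans _ _ (f x + (c.+1%:R^-1)%:E * \sum_(k <- S) kint (th k) f x)).
    by rewrite -bal leeDl// mule_ge0// lee_fin.
  rewrite leeD2l// mulrC EFinM lee_wpmul2l ?lee_fin//.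
  apply: lee_sum_size => k.
  rewrite -[leRHS](@kint_cst _ _ _ _ _ (th k) B%:E x) ?lee_fin//.
  by apply: kint_le => //; apply: nnmf_cst; rewrite lee_fin.
apply: (@le_trans _ _ (f x + (c.+1%:R^-1)%:E * \sum_(k <- S) kint (th k) f x)).
  by rewrite leeDl// mule_ge0// lee_fin.
rewrite -bal leeD2l// mulrAC [leRHS]EFinM.
by apply: lee_wpmul2l => //; rewrite lee_fin divr_ge0.
Qed.

(** The two inequalities bound the second-order Taylor remainder, with the loss term
    [t * size S * f] added to both sides. The constant [D] involves only [S] and [S2], so the
    estimate survives the limit of growing volumes. *)
Lemma fvol_generator L S S2 f t x : uniq L -> (0 <= t)%R ->
  nnmf f -> (forall y, f y <= 1) -> local S f -> uniq S ->
  {subset S <= L} -> uniq S2 -> {subset S2 <= L} ->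
  local S2 (fun y => \sum_(k <- S) kint (th k) f y) ->
  let D : R := ((size S2)%:R * (size S)%:R + (size S)%:R * (size S)%:R)%R in
  kint (fvol th L t) f x + (t * (size S)%:R)%:E * f x <=
    f x + t%:E * (\sum_(k <- S) kint (th k) f x) + (D * t ^+ 2 / 2)%:E /\
  f x + t%:E * (\sum_(k <- S) kint (th k) f x) <=
    kint (fvol th L t) f x + (t * (size S)%:R)%:E * f x + (D * t ^+ 2 / 2)%:E.
Proof.
move=> uL t0 nf f1 Sf uS SL uS2 S2L S2H D.
pose H y := \sum_(k <- S) kint (th k) f y.
have nH : nnmf H by apply: nnmf_sum => k; exact: nnmf_kint.
pose s : R := (size S)%:R.
have Hs y : H y <= s%:E.
  rewrite /H /s -[X in X%:E]mulr1; apply: lee_sum_size => k.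
  rewrite -[leRHS](@kint_cst _ _ _ _ _ (th k) 1 y)//.
  by apply: kint_le => //; exact: nnmf_cst.
pose c := size L; pose N : R := c.+1%:R.
have N0 : (0 < N)%R by rewrite ltr0n.
pose V := stepk th L c.
have iterB g (B : R) m y : nnmf g -> (0 <= B)%R -> (forall y, g y <= B%:E) ->
    iter m (kint V) g y <= B%:E.
  move=> ng B0 gB; rewrite -[leRHS](@iter_kint_cst _ _ _ V m B%:E y) ?lee_fin//.
  by apply: iter_kint_le => //; apply: nnmf_cst; rewrite lee_fin.
have iterfin g (B : R) m y : nnmf g -> (0 <= B)%R -> (forall y, g y <= B%:E) ->
    iter m (kint V) g y \is a fin_num.
  move=> ng B0 gB; rewrite ge0_fin_numE; last exact: (nnmf_iter _ _ ng).2.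
  by rewrite (le_lt_trans (iterB _ _ _ _ ng B0 gB))// ltry.
pose a m : R := fine (iter m (kint V) f x).
pose h m : R := fine (iter m (kint V) H x).
have aE m : iter m (kint V) f x = (a m)%:E by rewrite fineK// (iterfin _ 1%R).
have hE m : iter m (kint V) H x = (h m)%:E by rewrite fineK// (iterfin _ s).
have aS m : (a m.+1 = a m + (h m - s * a m) / N)%R.
  have : iter m (kint V) (fun y => kint V f y + (s / N)%:E * f y) x =
      iter m (kint V) (fun y => f y + (N^-1)%:E * H y) x.
    by congr (iter m _ _ x); apply/funext => y; exact: stepk_balance.
  have sN0 : 0 <= (s / N)%:E by rewrite lee_fin divr_ge0// ltW.
  have N10 : 0 <= (N^-1)%:E by rewrite lee_fin invr_ge0 ltW.
  have nf1 := nnmfZ sN0 nf; have nH1 := nnmfZ N10 nH.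
  have nkf := nnmf_kint V nf.
  rewrite !iterD_kint//. rewrite !iterZ_kint//.
  rewrite -(iterSr m (kint V) f) !aE hE -!EFinM -!EFinD => -[E].
  apply/eqP; rewrite -(inj_eq (addIr (s / N * a m)%R)) E; apply/eqP.
  by field; rewrite gt_eqF.
have iter_step g (B : R) m : nnmf g -> (0 <= B)%R ->
    (forall y, kint V g y <= g y + B%:E /\ g y <= kint V g y + B%:E) ->
    iter m.+1 (kint V) g x <= iter m (kint V) g x + B%:E /\
    iter m (kint V) g x <= iter m.+1 (kint V) g x + B%:E.
  move=> ng B0 gB; have nB : nnmf (fun _ : C => B%:E) by apply: nnmf_cst; rewrite lee_fin.
  have nk := nnmf_kint V ng.
  have cB : iter m (kint V) (fun=> B%:E) x = B%:E by rewrite iter_kint_cst ?lee_fin.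
  rewrite (iterSr m (kint V) g) -cB -!iterD_kint//.
  split; apply: iter_kint_le => //; try exact: nnmfD.
    by move=> y; have [] := gB y.
  by move=> y; have [] := gB y.
(* The two summands of [D]: [H] is bounded by [s] and depends on [S2], so a step moves it by at most
   [size S2 * s / N]; [f] is bounded by 1 and depends on [S], so [s * f] moves by at most
   [s * s / N]. *)
have gS m : (`|(h m.+1 - s * a m.+1) - (h m - s * a m)| <= D / N)%R.
  have [h1 h2] : (h m.+1 <= h m + (size S2)%:R * s / N /\
      h m <= h m.+1 + (size S2)%:R * s / N)%R.
    rewrite -!lee_fin !EFinD -!hE; apply: iter_step => //.
      by rewrite divr_ge0 ?mulr_ge0// ltW.
    by move=> y; exact: stepk_close.
  have [a1 a2] : (a m.+1 <= a m + s / N /\ a m <= a m.+1 + s / N)%R.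
    rewrite -!lee_fin !EFinD -!aE; apply: iter_step => //.
      by rewrite divr_ge0// ltW.
    by move=> y; rewrite -[s]mulr1; exact: stepk_close.
  have s0 : (0 <= s)%R by rewrite /s.
  have sa1 : (s * a m.+1 <= s * a m + s * s / N)%R.
    by have := ler_wpM2l s0 a1; rewrite mulrDr mulrA.
  have sa2 : (s * a m <= s * a m.+1 + s * s / N)%R.
    by have := ler_wpM2l s0 a2; rewrite mulrDr mulrA.
  rewrite /D -/s mulrDl ler_norml; move: h1 h2 sa1 sa2.
  move: ((size S2)%:R * s / N)%R (s * s / N)%R (s * a m.+1)%R (s * a m)%R => u v w z.
  by move=> h1 h2 sa1 sa2; apply/andP; split; lra.
have key := second_order_recurrence N0 aS gS.
pose l : R := (N * t)%R.
have l0 : (0 <= l)%R by rewrite mulr_ge0// ltW.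
have D0 : (0 <= D)%R by rewrite addr_ge0// mulr_ge0.
pose e : R := (D / N ^+ 2 / 2)%R.
have e0 : (0 <= e)%R by rewrite divr_ge0// divr_ge0// sqr_ge0.
have a_ge0 m : (0 <= a m)%R by rewrite fine_ge0//; exact: (nnmf_iter _ _ nf).2.
have h_ge0 m : (0 <= h m)%R by rewrite fine_ge0//; exact: (nnmf_iter _ _ nH).2.
have s0 : (0 <= s)%R by rewrite /s.
have lin (c' : R) : (0 <= c')%R -> psum l (fun m => (m%:R * c')%:E) = (l * c')%:E.
  move=> c'0; under eq_psum do rewrite EFinM.
  by rewrite (@psum_shift R l (fun=> c'%:E))// psum_cst.
have quad : psum l (fun m => ((m * m.-1)%:R * e)%:E) = (D * t ^+ 2 / 2)%:E.
  rewrite (@eq_psum R l _ (fun m => e%:E * (m * m.-1)%:R%:E)) => [|m]; last first.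
    by rewrite -EFinM mulrC.
  rewrite psumZ// psum_falling// -EFinM /l /e; congr (_%:E).
  by field; rewrite gt_eqF.
have Kf : kint (fvol th L t) f x = psum l (fun m => (a m)%:E).
  by rewrite /fvol poiskE//; apply: eq_psum => m; exact: aE.
have fa : f x = (a 0%N)%:E by rewrite -aE.
have Hh : \sum_(k <- S) kint (th k) f x = (h 0%N)%:E by rewrite -hE.
have sa0 : (0 <= s * a 0%N / N)%R by rewrite divr_ge0 ?mulr_ge0// ltW.
have hN0 : (0 <= h 0%N / N)%R by rewrite divr_ge0// ltW.
have lsa : (t * s)%:E * f x = psum l (fun m => (m%:R * (s * a 0%N / N))%:E).
  rewrite lin// fa -EFinM; congr (_%:E); rewrite /l; field; by rewrite gt_eqF.
have lhh : t%:E * \sum_(k <- S) kint (th k) f x =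
    psum l (fun m => (m%:R * (h 0%N / N))%:E).
  rewrite lin// Hh -EFinM; congr (_%:E); rewrite /l; field; by rewrite gt_eqF.
have ffa : f x = psum l (fun=> (a 0%N)%:E) by rewrite psum_cst ?lee_fin.
rewrite -/s lsa lhh Kf -quad ffa.
have mn (m : nat) (c' : R) : (0 <= c')%R -> 0 <= (m%:R * c')%:E.
  by move=> c'0; rewrite lee_fin mulr_ge0.
rewrite -!psumD//; try by move=> m; rewrite -?EFinD lee_fin ?addr_ge0// mulr_ge0.
have keyE m : (a m + m%:R * (s * a 0%N / N) <=
      a 0%N + m%:R * (h 0%N / N) + (m * m.-1)%:R * e /\
    a 0%N + m%:R * (h 0%N / N) <=
      a m + m%:R * (s * a 0%N / N) + (m * m.-1)%:R * e)%R.
  have := key m; rewrite -/e.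
  have -> : (m%:R * ((h 0%N - s * a 0%N) / N) =
    m%:R * (h 0%N / N) - m%:R * (s * a 0%N / N))%R by ring.
  move: (m%:R * (h 0%N / N))%R (m%:R * (s * a 0%N / N))%R ((m * m.-1)%:R * e)%R.
  by move=> u v w; rewrite ler_norml => /andP[k1 k2]; split; lra.
have lhs1 m : (0 <= a m + m%:R * (s * a 0%N / N))%R by rewrite addr_ge0// mulr_ge0.
have lhs2 m : (0 <= a 0%N + m%:R * (h 0%N / N))%R by rewrite addr_ge0// mulr_ge0.
split; apply: le_psum => // m; rewrite -!EFinD lee_fin//.
  exact: (keyE m).1.
exact: (keyE m).2.
Qed.

End generator_estimate.
Local Close Scope ereal_scope.

(** * The infinite-volume limit *)

Lemma close_seq_cvg {R : realType} (u e : nat -> R) : e @ \oo --> 0 ->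
  (forall n m, (n <= m)%N -> `|u n - u m| <= e n) ->
  cvgn u /\ forall n, `|u n - limn u| <= e n.
Proof.
move=> e0 ue.
have cu : cvgn u.
  apply: cauchy_cvg; apply: cauchy_exP => eps eps0.
  have /cvgrPdist_lt/(_ eps eps0)[n _ en] := e0.
  exists (u n), n => // m /= nm; rewrite /ball /= (le_lt_trans (ue _ _ nm))//.
  by have := en n (leqnn n); rewrite /= sub0r normrN; apply: le_lt_trans; rewrite ler_norm.
split => // n.
have : (fun m => `|u n - u m|) @ \oo --> `|u n - limn u|.
  by apply: cvg_norm; apply: cvgB => //; exact: cvg_cst.
move=> h; rewrite -(cvg_lim _ h)//; apply: limr_le.
  by apply/cvg_ex; eexists; exact: h.
by near=> m; apply: ue; near: m; exact: nbhs_infty_ge.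
Unshelve. all: by end_near. Qed.

(** * Uniform setwise limits of probability measures *)

Section uniform_limit.
Context {R : realType} {d} {T : measurableType d}.
Variables (P : nat -> probability T R) (e : nat -> R).
Hypothesis e0 : e @ \oo --> 0.
Hypothesis Pe : forall n m A, (n <= m)%N -> measurable A ->
  `|fine (P n A) - fine (P m A)| <= e n.

Let p n A := fine (P n A).
Let q A := limn (fun n => p n A).

Let pE n A : measurable A -> P n A = (p n A)%:E.
Proof. by move=> mA; rewrite /p fineK// fin_num_measure. Qed.

Let p_ge0 n A : 0 <= p n A.
Proof. by rewrite /p fine_ge0. Qed.

Let p_cvg A : measurable A -> (fun n => p n A) @ \oo --> q A.
Proof.
by move=> mA; have [] := @close_seq_cvg _ (fun n => p n A) e e0 (fun n m nm => Pe nm mA).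
Qed.

Let p_close n A : measurable A -> `|p n A - q A| <= e n.
Proof.
move=> mA.
by have [_] := @close_seq_cvg _ (fun n => p n A) e e0 (fun n m nm => Pe nm mA); apply.
Qed.

Let q_ge0 A : measurable A -> 0 <= q A.
Proof.
move=> mA; apply: limr_ge; first by apply/cvg_ex; eexists; exact: p_cvg.
by apply: nearW => n; exact: p_ge0.
Qed.

(** A measure is required to be nonnegative on every set, while the limit [q] is controlled only on
    measurable ones; hence the default 0. *)
Let Q (A : set T) : \bar R := if pselect (measurable A) then (q A)%:E else 0%E.

Let QE A : measurable A -> Q A = (q A)%:E.
Proof. by rewrite /Q; case: pselect. Qed.

Let Q0 : Q set0 = 0%E.
Proof.
rewrite QE//; congr (_%:E); apply: (@cvg_lim _ _ _ (nbhs \oo)) => //.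
by under eq_fun do rewrite /p measure0; exact: cvg_cst.
Qed.

Let Q_ge0 A : (0 <= Q A)%E.
Proof. by rewrite /Q; case: pselect => //= mA; rewrite lee_fin q_ge0. Qed.

Let Q_additive : semi_sigma_additive Q.
Proof.
move=> F mF tF mU; rewrite QE//.
rewrite (_ : (fun n => _) = EFin \o (fun n => \sum_(0 <= i < n) q (F i))); last first.
  by apply/funext => n; rewrite /= -sumEFin; apply: eq_bigr => i _; rewrite QE.
apply: cvg_EFin; first by apply: nearW.
rewrite /comp /=.
(* The tail sets [G n] have small mass under the limit: [N] is fixed first so that [P N] is
   uniformly close, then [n] is taken large for the single measure [P N]. *)
pose U := \bigcup_n F n; pose G n := U `\` \big[setU/set0]_(i < n) F i.
have mB n : measurable (\big[setU/set0]_(i < n) F i) by exact: bigsetU_measurable.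
have mG n : measurable (G n) by apply: measurableD.
have pB N n : p N (\big[setU/set0]_(i < n) F i) = \sum_(0 <= i < n) p N (F i).
  apply: EFin_inj; rewrite -pE// -sumEFin measure_bigsetU// big_mkord.
  by apply: eq_bigr => i _; exact: (pE _ (mF i)).
have pG N n : p N (G n) = p N U - \sum_(0 <= i < n) p N (F i).
  rewrite -pB /G /p measureD//; last by rewrite ltey_eq fin_num_measure.
  rewrite setIidr ?fineB ?fin_num_measure//.
  by rewrite -bigcup_mkord => x [i _ Fix]; exists i.
have qG n : q (G n) = q U - \sum_(0 <= i < n) q (F i).
  apply: (@cvg_lim _ _ _ (nbhs \oo)) => //.
  under eq_fun do rewrite pG.
  apply: cvgB; first exact: p_cvg.
  by apply: cvg_big => [|i _]; [exact: add_continuous|exact: p_cvg].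
apply/cvgrPdist_le => eps eps0.
have /cvgrPdist_le/(_ (eps / 2)) := e0; case=> [|N _ eN]; first by rewrite divr_gt0.
have eN2 : e N <= eps / 2.
  have := eN N (leqnn N); rewrite /= sub0r normrN; apply: le_trans.
  by rewrite ler_norm.
have := measure_semi_sigma_additive (s := P N) _ mF tF mU.
rewrite (_ : (fun n => _) = EFin \o (fun n => \sum_(0 <= i < n) p N (F i))); last first.
  by apply/funext => n; rewrite /= -sumEFin; apply: eq_bigr => i _; rewrite pE.
rewrite pE// => /fine_cvgP[_] /cvgrPdist_le/(_ (eps / 2)).
case=> [|M _ HM]; first by rewrite divr_gt0.
exists M => // n /= Mn; rewrite -/U -qG ger0_norm ?q_ge0//.
have := p_close N (mG n); rewrite ler_norml => /andP[qp _].
have := HM n Mn; rewrite /= -/U -pG ger0_norm ?p_ge0// => pn.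
lra.
Qed.

HB.instance Definition _ := isMeasure.Build _ _ _ Q Q0 Q_ge0 Q_additive.

Let Q1 : Q setT = 1%E.
Proof.
rewrite QE//; congr (_%:E); apply: (@cvg_lim _ _ _ (nbhs \oo)) => //.
by under eq_fun do rewrite /p probability_setT; exact: cvg_cst.
Qed.

Lemma probability_uniform_limit : exists q : probability T R,
  forall n A, measurable A -> `|fine (P n A) - fine (q A)| <= e n.
Proof.
have [q' q'E] := probability_of_measure Q1.
by exists q' => n A mA; rewrite q'E /= QE// /=; exact: p_close.
Qed.

End uniform_limit.

(** * Layer-cake comparison of integrals *)

Section layers.
Context {R : realType}.
Local Open Scope ereal_scope.

Lemma layer_count (N : nat) (y : R) : (0 <= y)%R ->
  (\sum_(0 <= i < N) (i.+1%:R <= y)%R%:R <= y :> R)%R /\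
  ((y <= N%:R)%R -> (y <= \sum_(0 <= i < N) (i.+1%:R <= y)%R%:R + 1 :> R)%R).
Proof.
move=> y0.
have full n : (n%:R <= y)%R -> (\sum_(0 <= i < n) (i.+1%:R <= y)%R%:R = n%:R :> R)%R.
  move=> ny; rewrite (eq_big_nat _ _ (F2 := fun=> 1%R)) => [|i /andP[_ i_n]].
    by rewrite sumr_const_nat subn0.
  by rewrite (le_trans _ ny)// ler_nat.
elim: N => [|N [IH1 IH2]]; first by rewrite big_nil add0r; split => // /le_trans; apply.
rewrite big_nat_recr//=; have [Ny|yN] := lerP N.+1%:R y.
  rewrite full; last by rewrite (le_trans _ Ny)// ler_nat.
  split; first by rewrite natr1.
  by move=> yN; rewrite natr1 (le_trans yN)// lerDl.
rewrite addr0; split => // _; have [yN'|Ny] := lerP y N%:R; first exact: IH2.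
by rewrite full ?(ltW Ny)// natr1 ltW.
Qed.

(** Up to the mesh, [f] is the average of the indicators of [N.+1] superlevel sets. Each costs [e],
    so the average costs [e] as well: passing from sets to functions loses nothing. *)
Lemma layers_close {d} {T : measurableType d} (P Q : probability T R) (e : R)
    (f : T -> \bar R) : (0 <= e)%R -> nnmf f -> (forall x, f x <= 1) ->
  (forall c : R, P [set x | c%:E <= f x] <= Q [set x | c%:E <= f x] + e%:E) ->
  \int[P]_x f x <= \int[Q]_x f x + e%:E.
Proof.
move=> e0 [mf f0] f1 PQ.
have ff x : f x = (fine (f x))%:E by rewrite fineK// ge0_fin_numE// (le_lt_trans (f1 x))// ltry.
apply/lee_addgt0Pr => eps eps0.
have [N Neps] : exists N : nat, (N.+1%:R^-1 <= eps)%R.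
  have [N _ HN] := near_infty_natSinv_lt (PosNum eps0).
  by exists N; exact/ltW/(HN N (leqnn N)).
pose A i := [set x | (i.+1%:R / N.+1%:R)%:E <= f x].
have mA i : measurable (A i).
  rewrite -[A i]setTI; exact: emeasurable_fun_c_infty.
pose h x : \bar R := (N.+1%:R^-1)%:E * \sum_(0 <= i < N.+1) (\1_(A i) x)%:E.
have nh : nnmf h.
  apply: nnmfZ; first by rewrite lee_fin.
  by apply: nnmf_sum => i; exact: nnmf_indic.
have hE x : h x = (N.+1%:R^-1 *
    \sum_(0 <= i < N.+1) (i.+1%:R <= N.+1%:R * fine (f x))%R%:R)%:E.
  rewrite /h sumEFin -EFinM; congr (_%:E); congr (_ * _)%R; apply: eq_bigr => i _.
  rewrite indicE; congr (_%:R); congr nat_of_bool.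
  have -> : (x \in A i) = ((i.+1%:R / N.+1%:R)%:E <= f x).
    by apply/idP/idP; rewrite inE.
  by rewrite [in LHS]ff lee_fin ler_pdivrMr ?ltr0n// mulrC.
have fx0 x : (0 <= N.+1%:R * fine (f x))%R by rewrite mulr_ge0// fine_ge0.
have hf x : h x <= f x.
  rewrite hE [leRHS]ff lee_fin ler_pdivrMl ?ltr0n//.
  by have [] := @layer_count N.+1 _ (fx0 x).
have fh x : f x <= h x + eps%:E.
  rewrite hE [leLHS]ff -EFinD lee_fin.
  apply: (@le_trans _ _ (N.+1%:R^-1 *
    (\sum_(0 <= i < N.+1) (i.+1%:R <= N.+1%:R * fine (f x))%R%:R + 1))%R).
    rewrite ler_pdivlMl ?ltr0n//.
    have [_] := @layer_count N.+1 _ (fx0 x); apply.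
    by rewrite -[leRHS]mulr1 ler_wpM2l// -lee_fin -ff.
  by rewrite mulrDr mulr1 lerD2l.
have inth (m : probability T R) : \int[m]_x h x =
    (N.+1%:R^-1)%:E * \sum_(0 <= i < N.+1) m (A i).
  have [mS S0] : nnmf (fun x : T => \sum_(0 <= i < N.+1) (\1_(A i) x)%:E : \bar R).
    by apply: nnmf_sum => i; exact: nnmf_indic.
  rewrite /h ge0_integralZl ?lee_fin//.
  rewrite ge0_integral_sum//.
  - by congr (_ * _); apply: eq_bigr => i _; rewrite integral_indic ?setIT.
  - by move=> i; exact: (nnmf_indic (mA i)).1.
have epsE : 0 <= eps%:E by rewrite lee_fin ltW.
have [mh h0] := nh.
have [mhe he0] := nnmfD nh (nnmf_cst epsE).
apply: (@le_trans _ _ (\int[P]_x (h x + eps%:E))).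
  exact: ge0_le_integral.
rewrite ge0_integralD//.
have -> : \int[P]_x eps%:E = eps%:E.
  by rewrite integral_cst// (@probability_setT _ _ _ P) mule1.
rewrite leeD2r//.
apply: (@le_trans _ _ (\int[Q]_x h x + e%:E)); last first.
  by rewrite leeD2r//; exact: ge0_le_integral.
rewrite (inth P) (inth Q).
apply: (@le_trans _ _ ((N.+1%:R^-1)%:E * \sum_(0 <= i < N.+1) (Q (A i) + e%:E))).
  by apply: lee_wpmul2l; rewrite ?lee_fin//; apply: lee_sum => i _; exact: PQ.
rewrite big_split/= ge0_muleDr//; last 2 first.
- by apply: sume_ge0.
- by apply: sume_ge0 => i _; rewrite lee_fin.
rewrite leeD2l// sumEFin sumr_const_nat subn0 -EFinM -[(e *+ _)%R]mulr_natl.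
by rewrite mulKf// pnatr_eq0.
Qed.

End layers.

Section rational_cuts.
Context {R : realType}.

Definition nat_rat (n : nat) : R := ratr (odflt 0%Q (unpickle n)).

(* A real number is encoded by its rational upper cut. *)
Definition cut_enc (t : R) (n : nat) : bool := t < nat_rat n.

(** The supremum of the rationals not above the encoded number. Kolmogorov's construction decodes
    arbitrary bit sequences, so the map must be total and measurable; [fine] sends infinite suprema
    to 0. *)
Definition cut_dec (b : prodsp nat bool) : R :=
  fine (esups (fun n => if b n then -oo%E else (nat_rat n)%:E) 0).

Lemma measurable_cut_enc n : measurable [set t : R | cut_enc t n].
Proof.
exact: measurable_itv `]-oo, (nat_rat n)[.
Qed.

Lemma measurable_cut_dec : measurable_fun setT cut_dec.
Proof.
apply: (@measurableT_comp _ _ _ _ _ _ fine); first exact: fine_measurable.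
apply: measurable_fun_esups => n.
by apply: measurable_fun_ifT => //; exact: (@measurable_coord nat _ bool n).
Qed.

Lemma cut_encK t : cut_dec (cut_enc t) = t.
Proof.
rewrite /cut_dec; suff -> : esups (fun n => if cut_enc t n then -oo%E else
    (nat_rat n)%:E) 0 = t%:E by [].
apply/eqP; rewrite eq_le; apply/andP; split.
  apply: ge_ereal_sup => _ [n _ <-]; rewrite /cut_enc; case: ifPn => [_|].
    by rewrite leNye.
  by rewrite -leNgt lee_fin.
apply/lee_subgt0Pr => e e0.
have [q] := @rat_in_itvoo R (t - e) t ltac:(by rewrite ltrBlDr ltrDl).
rewrite in_itv /= => /andP[tq qt].
apply: (@le_trans _ _ (ratr q)%:E); first by rewrite -EFinB lee_fin ltW.
apply: ereal_sup_ubound; exists (pickle q) => //=.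
by rewrite /cut_enc /nat_rat pickleK /= ltNge (ltW qt).
Qed.

End rational_cuts.

Lemma measurable_kernel_pi {R : realType} {d d'} {X : measurableType d}
    {Y : measurableType d'} (G : set (set Y)) (k : X -> probability Y R) :
  @measurable _ Y = <<s G >> -> setI_closed G ->
  (forall U, G U -> measurable_fun setT (k ^~ U)) ->
  forall U, measurable U -> measurable_fun setT (k ^~ U).
Proof.
move=> mG GI kG U; rewrite [X in X U -> _]mG.
move: U; apply: (@dynkin_induction _ Y G (fun U => measurable_fun setT (k ^~ U))) => //.
- by under eq_fun do rewrite probability_setT; exact: measurable_cst.
- move=> U mU kU; under eq_fun do rewrite probability_setC//.
  by apply: emeasurable_funB => //; exact: measurable_cst.
- move=> F mF tF kF.
  rewrite (_ : (fun x => _) = fun x => \sum_(0 <= n <oo) k x (F n))%E.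
    by apply: ge0_emeasurable_sum => // n _; exact: kF.
  apply/funext => x; apply/esym/cvg_lim => //; apply: measure_semi_sigma_additive => //.
  exact: bigcupT_measurable.
Qed.

Local Open Scope ereal_scope.

(** * Existence of the infinite-volume kernel at a fixed time *)

Section infinite_volume.
Context {R : realType} {I : choiceType}.
Notation C := (prodsp I R).
Variables (th : I -> R.-pker C ~> C) (nb : I -> seq I).
Implicit Types (f g : C -> \bar R) (L S : seq I).
Hypothesis th_out : forall k S f, nnmf f -> local S f ->
  k \notin S -> forall x, kint (th k) f x = f x.
Hypothesis th_local : forall k S f, nnmf f -> local S f ->
  local (S ++ nb k) (kint (th k) f).
Variables (phi : I -> R) (Cn : R).
Hypothesis phi_ge0 : forall i, (0 <= phi i)%R.
Hypothesis Cn_ge0 : (0 <= Cn)%R.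
Hypothesis phi_nb : forall k, (\sum_(j <- nb k) phi j <= Cn * phi k)%R.
Variable Lam : nat -> seq I.
Hypothesis Lam_uniq : forall n, uniq (Lam n).
Hypothesis Lam_phi : forall n j, j \notin Lam n -> (n.+1%:R <= phi j)%R.

(** The bound of [fvol_close] with [M = n.+1], a lower bound for the weights of sites outside
    [Lam n]. *)
Definition box_err S (t : R) (n : nat) : R :=
  ((\sum_(j <- S) phi j) / n.+1%:R * expR (Cn * t))%R.

Lemma box_err_ge0 S t n : (0 <= box_err S t n)%R.
Proof. by rewrite !mulr_ge0 ?expR_ge0// sumr_ge0. Qed.

Lemma box_err_cvg S t : (box_err S t @ \oo --> 0)%R.
Proof.
rewrite /box_err -[X in _ --> X](mul0r (expR (Cn * t))).
apply: cvgM; last exact: cvg_cst.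
rewrite -[X in _ --> X](mulr0 (\sum_(j <- S) phi j)%R).
by apply: cvgM; [exact: cvg_cst|exact: cvg_harmonic].
Qed.

Lemma kint_fin d d' (X : measurableType d) (Y : measurableType d')
    (K : R.-pker X ~> Y) (f : Y -> \bar R) x :
  nnmf f -> (forall y, f y <= 1) -> kint K f x \is a fin_num.
Proof.
move=> nf f1; rewrite ge0_fin_numE; last exact: (nnmf_kint _ nf).2.
apply: (@le_lt_trans _ _ 1); last by rewrite ltry.
rewrite -[leRHS](@kint_cst _ _ _ _ _ K 1 x)//.
by apply: kint_le => //; exact: nnmf_cst.
Qed.

Lemma fine_close (u v : \bar R) (e : R) : u \is a fin_num -> v \is a fin_num ->
  u <= v + e%:E -> v <= u + e%:E -> (`|fine u - fine v| <= e)%R.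
Proof.
case: u v => [u| |] [v| |]//= _ _; rewrite -!EFinD !lee_fin => uv vu.
by rewrite ler_norml; apply/andP; split; lra.
Qed.

Lemma fvol_box_close S f t x n m : (0 <= t)%R -> nnmf f -> local S f ->
  (forall y, f y <= 1) -> (n <= m)%N ->
  (`|fine (kint (fvol th (Lam n) t) f x) - fine (kint (fvol th (Lam m) t) f x)|
    <= box_err S t n)%R.
Proof.
move=> t0 nf Sf f1 nm.
have H1 n' m' : (n <= n')%N -> (n <= m')%N ->
  kint (fvol th (Lam n') t) f x <= kint (fvol th (Lam m') t) f x + (box_err S t n)%:E.
  move=> nn nm'; apply: (fvol_close th_out th_local) => //.
  - by move=> j /Lam_phi; apply: le_trans; rewrite ler_nat ltnS.
  - by move=> j /Lam_phi; apply: le_trans; rewrite ler_nat ltnS.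
by apply: fine_close; [exact: kint_fin|exact: kint_fin|exact: H1|exact: H1].
Qed.

(** Represents the marginal on [S] as a measure on the whole product: every preimage under [rest S]
    depends on [S] only, so the box error for [S] applies to all measurable sets at once. *)
Let rest S (x : C) : C := fun i => if i \in S then x i else 0%R.

Let measurable_rest S : measurable_fun setT (rest S).
Proof.
apply: measurable_fun_prodsp => i; rewrite /rest; case: (i \in S).
  exact: measurable_coord.
exact: measurable_cst.
Qed.

Let local_rest S (A : set C) : local_set S (rest S @^-1` A).
Proof.
move=> x y xy; rewrite /preimage /=; suff -> : rest S x = rest S y by [].
by apply/funext => i; rewrite /rest; case: ifPn => // /xy.
Qed.

Let rest_local S (A : set C) : local_set S A -> rest S @^-1` A = A.
Proof.
by move=> SA; apply/seteqP; split => x; apply: SA => i iS; rewrite /rest iS.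
Qed.

Let indic_le1 (A : set C) y : (\1_A y)%:E <= 1 :> \bar R.
Proof. by rewrite lee_fin indicE; case: (_ \in _). Qed.

Section fixed_time.
Variable (t : R).
Hypothesis t_ge0 : (0 <= t)%R.

Let K n := fvol th (Lam n) t.

Let marginal x S : exists q : probability C R, forall n A, measurable A ->
  (`|fine (K n x (rest S @^-1` A)) - fine (q A)| <= box_err S t n)%R.
Proof.
have Pn n : exists P : probability C R, forall A, P A = K n x (rest S @^-1` A).
  have [P PE] := probability_of_measure (pkerT (K n) x).
  have [P' P'E] := probability_pushforward (measurable_rest S) P.
  by exists P' => A; rewrite P'E PE.
have [P PE] := choice Pn.
have [|q qE] := @probability_uniform_limit R _ C P _ (box_err_cvg S t).
  move=> n m A nm mA; rewrite !PE.
  have mr : measurable (rest S @^-1` A).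
    by rewrite -[X in measurable X]setTI; exact: measurable_rest.
  rewrite -!kint_indic//.
  apply: fvol_box_close => //; first exact: nnmf_indic.
  by move=> y z yz; congr (_%:E); apply: (local_indic (local_rest (S := S) (A := A))).
by exists q => n A mA; rewrite -PE; exact: qE.
Qed.

Let limit_measure x : exists q : probability C R, forall n S (A : set C),
  measurable A -> local_set S A ->
  (`|fine (q A) - fine (K n x A)| <= box_err S t n)%R.
Proof.
have [mu muE] := choice (marginal x).
have mu_loc n S (A : set C) : measurable A -> local_set S A ->
    (`|fine (K n x A) - fine (mu S A)| <= box_err S t n)%R.
  by move=> mA SA; rewrite -{1}(rest_local SA); exact: muE.
have [|q qE] := @kolmogorov_extension R I nat _ R cut_enc cut_dec
    measurable_cut_enc measurable_cut_dec cut_encK mu.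
  move=> S S' A SS' mA SA.
  have S'A := local_set_sub SS' SA.
  (* Consistency: both marginals assign to [A] the limit of the same sequence of box
     probabilities. *)
  have c1 : (fun n => fine (K n x A)) @ \oo --> fine (mu S A).
    apply/cvgrPdist_le => e e0.
    have /cvgrPdist_le/(_ e e0)[N _ HN] := box_err_cvg S t.
    exists N => // n Nn; rewrite distrC (le_trans (mu_loc n _ _ mA SA))//.
    by have := HN n Nn; rewrite /= sub0r normrN ger0_norm// box_err_ge0.
  have c2 : (fun n => fine (K n x A)) @ \oo --> fine (mu S' A).
    apply/cvgrPdist_le => e e0.
    have /cvgrPdist_le/(_ e e0)[N _ HN] := box_err_cvg S' t.
    exists N => // n Nn; rewrite distrC (le_trans (mu_loc n _ _ mA S'A))//.
    by have := HN n Nn; rewrite /= sub0r normrN ger0_norm// box_err_ge0.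
  have : fine (mu S' A) = fine (mu S A).
    by rewrite -(cvg_lim _ c1)// -(cvg_lim _ c2).
  move=> E; rewrite -[LHS]fineK ?fin_num_measure// -[RHS]fineK ?fin_num_measure//.
  by rewrite E.
by exists q => n S A mA SA; rewrite (qE S)// distrC; exact: mu_loc.
Qed.

Lemma infinite_volume_kernel : exists Kt : R.-pker C ~> C,
  forall n S f x, nnmf f -> (forall y, f y <= 1) -> local S f ->
  (`|fine (kint Kt f x) - fine (kint (fvol th (Lam n) t) f x)| <= box_err S t n)%R.
Proof.
have [q qE] := choice limit_measure.
have [|Kt KtE] := pkernel_of_probability (k := q).
  (* On local sets the kernel is a pointwise limit of box kernels, hence measurable in the starting
     point; the Dynkin argument extends this to all measurable sets. *)
  apply: (measurable_kernel_pi (local_generate I R)); first exact: local_setI_closed.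
  move=> U [mU [S SU]].
  apply: (emeasurable_fun_cvg (fun n x => K n x U)).
    by move=> n; exact: measurable_kernel.
  move=> x _; rewrite -[q x U]fineK ?fin_num_measure//.
  rewrite (_ : (fun n => _) = EFin \o (fun n => fine (K n x U))); last first.
    apply/funext => n /=; rewrite fineK// -kint_indic//; apply: kint_fin => //.
    exact: nnmf_indic.
  apply: cvg_EFin; first exact: nearW.
  rewrite /comp /=; apply/cvgrPdist_le => e e0.
  have /cvgrPdist_le/(_ e e0)[N _ HN] := box_err_cvg S t.
  exists N => // n Nn; rewrite (le_trans (qE x n _ _ mU SU))//.
  by have := HN n Nn; rewrite /= sub0r normrN ger0_norm// box_err_ge0.
exists Kt => n S f x nf f1 Sf.
have [Q QE] := probability_of_measure (pkerT (K n) x).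
have int1 : kint Kt f x = \int[q x]_y f y.
  by rewrite kintE; apply: eq_measure_integral => A mA _; rewrite KtE.
have int2 : kint (fvol th (Lam n) t) f x = \int[Q]_y f y.
  by rewrite kintE; apply: eq_measure_integral => A mA _; rewrite QE.
have close (c : R) :
    (`|fine (q x [set y | (c%:E <= f y)%E]) - fine (Q [set y | (c%:E <= f y)%E])|
      <= box_err S t n)%R.
  have mc : measurable [set y : C | c%:E <= f y].
    by rewrite -[X in measurable X]setTI; apply: emeasurable_fun_c_infty => //; exact: nf.1.
  rewrite QE; apply: qE => //.
  by move=> y z yz /=; rewrite (Sf _ _ yz).
have fE (P : probability C R) (c : R) : P [set y : C | c%:E <= f y] =
    (fine (P [set y : C | (c%:E <= f y)%E]))%:E.
  rewrite fineK// fin_num_measure//.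
  by rewrite -[X in measurable X]setTI; apply: emeasurable_fun_c_infty => //; exact: nf.1.
have h1 : \int[q x]_y f y <= \int[Q]_y f y + (box_err S t n)%:E.
  apply: layers_close => //; first exact: box_err_ge0.
  move=> c; rewrite (fE (q x)) (fE Q) -EFinD lee_fin.
  by have := close c; rewrite ler_norml => /andP[a b]; lra.
have h2 : \int[Q]_y f y <= \int[q x]_y f y + (box_err S t n)%:E.
  apply: layers_close => //; first exact: box_err_ge0.
  move=> c; rewrite (fE (q x)) (fE Q) -EFinD lee_fin.
  by have := close c; rewrite ler_norml => /andP[a b]; lra.
by apply: fine_close; rewrite ?int1 ?int2// -?int1 -?int2; exact: kint_fin.
Qed.

End fixed_time.
End infinite_volume.
Local Close Scope ereal_scope.

Lemma eq_of_small {R : realType} (a b : R) (e : nat -> R) : e @ \oo --> 0 ->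
  (forall n, `|a - b| <= e n) -> a = b.
Proof.
move=> e0 abe; apply/eqP; rewrite -subr_eq0 -normr_le0.
have <- : limn e = 0 by exact: cvg_lim.
apply: limr_ge; first by apply/cvg_ex; exists 0.
exact: nearW.
Qed.

Local Open Scope ereal_scope.

(** * Semigroup property and generator of the limit *)

Section limit_semigroup.
Context {R : realType} {I : choiceType}.
Notation C := (prodsp I R).
Variables (th : I -> R.-pker C ~> C) (nb : I -> seq I).
Implicit Types (f g : C -> \bar R) (L S : seq I).
Hypothesis th_out : forall k S f, nnmf f -> local S f ->
  k \notin S -> forall x, kint (th k) f x = f x.
Hypothesis th_local : forall k S f, nnmf f -> local S f ->
  local (S ++ nb k) (kint (th k) f).
Variables (phi : I -> R) (Cn : R).
Hypothesis phi_ge0 : forall i, (0 <= phi i)%R.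
Hypothesis Cn_ge0 : (0 <= Cn)%R.
Hypothesis phi_nb : forall k, (\sum_(j <- nb k) phi j <= Cn * phi k)%R.
Variable Lam : nat -> seq I.
Hypothesis Lam_uniq : forall n, uniq (Lam n).
Hypothesis Lam_phi : forall n j, j \notin Lam n -> (n.+1%:R <= phi j)%R.
Variable kap : R -> R.-pker C ~> C.
Hypothesis kapE : forall t n S f x, (0 <= t)%R -> nnmf f -> (forall y, f y <= 1) ->
  local S f ->
  (`|fine (kint (kap t) f x) - fine (kint (fvol th (Lam n) t) f x)|
    <= box_err phi Cn S t n)%R.

Lemma Lam_exhaust S : exists n0, forall n, (n0 <= n)%N -> {subset S <= Lam n}.
Proof.
elim: S => [|j S [n0 IH]]; first by exists 0%N.
exists (maxn n0 (Num.truncn (phi j))) => n; rewrite geq_max => /andP[n0n jn] i.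
rewrite inE => /orP[/eqP ->|]; last exact: IH.
apply: contraT => /Lam_phi; rewrite leNgt => /negP[].
by rewrite (lt_le_trans (truncnS_gt _))// ler_nat ltnS.
Qed.

Lemma local_stepk L c S f : (size L <= c.+1)%N -> nnmf f -> local S f ->
  (forall k, k \in L -> {subset nb k <= S}) -> local S (kint (stepk th L c) f).
Proof.
move=> Lc nf Sf LS x y xy; rewrite !stepkE//; congr (_ * (_ + _ * _)); last exact: Sf.
apply: eq_big_seq => k kL; apply: (th_local nf Sf) => i.
by rewrite mem_cat => /orP[/xy//|/(LS _ kL)/xy].
Qed.

(** Updates within [L] read only neighbours of sites of [L], so one finite set serves for any number
    of steps. Locality makes [kapE] applicable to box-evolved functions. *)
Lemma local_fvol L t S f : (0 <= t)%R -> nnmf f -> local S f ->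
  exists S', local S' (kint (fvol th L t) f).
Proof.
move=> t0 nf Sf; exists (S ++ flatten [seq nb k | k <- L]) => x y xy.
rewrite /fvol !poiskE ?mulr_ge0//; apply: eq_psum => m.
have Lnb k : k \in L -> {subset nb k <= S ++ flatten [seq nb k | k <- L]}.
  move=> kL i ik; rewrite mem_cat; apply/orP; right; apply/flattenP.
  by exists (nb k) => //; apply/mapP; exists k.
suff : local (S ++ flatten [seq nb k | k <- L])
    (iter m (kint (stepk th L (size L))) f) by apply.
elim: m => [|m IH] /=.
  by apply: local_sub Sf => i iS; rewrite mem_cat iS.
by apply: local_stepk => //; exact: nnmf_iter.
Qed.

Lemma fvol_le1 L t f x : nnmf f -> (forall y, f y <= 1) ->
  kint (fvol th L t) f x <= 1.
Proof.
move=> nf f1; rewrite -[leRHS](@kint_cst _ _ _ _ _ (fvol th L t) 1 x)//.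
by apply: kint_le => //; exact: nnmf_cst.
Qed.

Lemma fvol0 L f x : nnmf f -> kint (fvol th L 0) f x = f x.
Proof. by move=> nf; rewrite /fvol mulr0 poisk0. Qed.

Lemma fvol_semigroup L s t f x : (0 <= s)%R -> (0 <= t)%R -> nnmf f ->
  kint (fvol th L (s + t)) f x = kint (fvol th L s) (kint (fvol th L t) f) x.
Proof. by move=> s0 t0 nf; rewrite /fvol mulrDr poisk_semigroup// mulr_ge0. Qed.

Lemma kint_close (K : R.-pker C ~> C) f g (e : R) x : (0 <= e)%R ->
  nnmf f -> nnmf g -> (forall y, f y <= 1) -> (forall y, g y <= 1) ->
  (forall y, `|fine (f y) - fine (g y)| <= e)%R ->
  (`|fine (kint K f x) - fine (kint K g x)| <= e)%R.
Proof.
move=> e0 nf ng f1 g1 fg.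
have fin (h : C -> \bar R) (y : C) : nnmf h -> (forall y, h y <= 1) -> h y = (fine (h y))%:E.
  by move=> nh h1; rewrite fineK// ge0_fin_numE ?(le_lt_trans (h1 y)) ?ltry//; exact: nh.2.
have ne : nnmf (fun _ : C => e%:E) by apply: nnmf_cst; rewrite lee_fin.
have ce : kint K (fun=> e%:E) x = e%:E by rewrite kint_cst// lee_fin.
apply: fine_close; [exact: kint_fin|exact: kint_fin|..]; rewrite -ce -kintD//.
- apply: kint_le => //; first exact: nnmfD.
  move=> y; rewrite (fin f y)// (fin g y)// -EFinD lee_fin.
  by have := fg y; rewrite ler_norml => /andP[a b]; lra.
- apply: kint_le => //; first exact: nnmfD.
  move=> y; rewrite (fin f y)// (fin g y)// -EFinD lee_fin.
  by have := fg y; rewrite ler_norml => /andP[a b]; lra.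
Qed.

Lemma kap_local_fvol S f t x : (0 <= t)%R -> nnmf f -> (forall y, f y <= 1) ->
  local S f ->
  ((fun n => fine (kint (fvol th (Lam n) t) f x)) @ \oo --> fine (kint (kap t) f x))%R.
Proof.
move=> t0 nf f1 Sf; apply/cvgrPdist_le => e e0.
have /cvgrPdist_le/(_ e e0)[N _ HN] := box_err_cvg phi Cn S t.
exists N => // n Nn; rewrite (le_trans (kapE n x t0 nf f1 Sf))//.
by have := HN n Nn; rewrite /= sub0r normrN; apply: le_trans; rewrite ler_norm.
Qed.

Lemma kap0_local S f x : nnmf f -> (forall y, f y <= 1) -> local S f ->
  kint (kap 0) f x = f x.
Proof.
move=> nf f1 Sf.
have fx : f x \is a fin_num.
  by rewrite ge0_fin_numE ?(le_lt_trans (f1 x)) ?ltry//; exact: nf.2.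
rewrite -[RHS]fineK// -[LHS]fineK; last exact: kint_fin.
congr (_%:E); apply: (eq_of_small (box_err_cvg phi Cn S 0)) => n.
by rewrite -[X in (_ - fine X)%R](@fvol0 (Lam n) f x nf); exact: kapE.
Qed.

(** The function [kint (kap t) f] need not be local, so [kapE] does not reach the outer kernel. It
    is replaced by the local box version [g n] at cost [e n]; then box [m] grows with [n] fixed, and
    [g m] differs from [g n] by at most [e n] again. *)
Lemma kap_semigroup_local S f s t x : (0 <= s)%R -> (0 <= t)%R ->
  nnmf f -> (forall y, f y <= 1) -> local S f ->
  kint (kap (s + t)) f x = kint (kap s) (kint (kap t) f) x.
Proof.
move=> s0 t0 nf f1 Sf.
have kap1 y : kint (kap t) f y <= 1.
  rewrite -[leRHS](@kint_cst _ _ _ _ _ (kap t) 1 y)//.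
  by apply: kint_le => //; exact: nnmf_cst.
have nk := nnmf_kint (kap t) nf.
rewrite -[LHS]fineK; last exact: kint_fin.
rewrite -[RHS]fineK; last exact: kint_fin.
congr (_%:E).
pose e := box_err phi Cn S t.
have e2 : (fun n => 2 * e n)%R @ \oo --> 0%R.
  rewrite -[X in _ --> X](mulr0 2%R); apply: cvgM; first exact: cvg_cst.
  exact: box_err_cvg.
apply: (eq_of_small e2) => n.
have e_ge0 k : (0 <= e k)%R by exact: le_trans (normr_ge0 _) (kapE k x t0 nf f1 Sf).
pose g k := kint (fvol th (Lam k) t) f.
have ng k : nnmf (g k) by exact: nnmf_kint.
have g1 k y : g k y <= 1 by exact: fvol_le1.
have [S' S'g] := local_fvol (Lam n) t0 nf Sf.
have st0 : (0 <= s + t)%R by rewrite addr_ge0.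
have c1 := kap_local_fvol (x := x) st0 nf f1 Sf.
have c2 := kap_local_fvol (x := x) s0 (ng n) (g1 n) S'g.
have close1 : (`|fine (kint (kap s) (kint (kap t) f) x) -
    fine (kint (kap s) (g n) x)| <= e n)%R.
  by apply: kint_close => // y; exact: kapE.
suff close2 : (`|fine (kint (kap (s + t)) f x) - fine (kint (kap s) (g n) x)|
    <= e n)%R.
  move: close1 close2; rewrite !ler_norml => /andP[a b] /andP[c d].
  by apply/andP; split; lra.
have c3 : (fun m => `|fine (kint (fvol th (Lam m) (s + t)) f x) -
    fine (kint (fvol th (Lam m) s) (g n) x)|)%R @ \oo -->
    `|fine (kint (kap (s + t)) f x) - fine (kint (kap s) (g n) x)|%R.
  by apply: cvg_norm; apply: cvgB.
rewrite -(cvg_lim _ c3)//; apply: limr_le.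
  by apply/cvg_ex; eexists; exact: c3.
exists n => // m /= nm; rewrite fvol_semigroup//.
apply: (kint_close _ _ (e_ge0 n) (ng m) (ng n) (g1 m) (g1 n)) => y; rewrite distrC.
exact: (fvol_box_close th_out th_local phi_ge0 Cn_ge0 phi_nb Lam_uniq Lam_phi).
Qed.

Lemma eq_local_pker (K K' : R.-pker C ~> C) x :
  (forall S f, nnmf f -> (forall y, f y <= 1) -> local S f ->
    kint K f x = kint K' f x) ->
  forall f, nnmf f -> kint K f x = kint K' f x.
Proof.
move=> KK' f nf; rewrite !kintE; apply: eq_measure_integral => A mA _.
apply: (@eq_local_measure R I _ R (K x) (K' x)) => //.
- by rewrite pkerT ltry.
- by rewrite !pkerT.
- move=> S B mB SB; rewrite -!kint_indic//; apply: (KK' S).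
  + exact: nnmf_indic.
  + by move=> y; rewrite lee_fin indicE; case: (_ \in _).
  + by move=> y z yz; rewrite (local_indic SB yz).
Qed.

Lemma kap_dirac f x : nnmf f -> kint (kap 0) f x = f x.
Proof.
move=> nf; have [K KE] := @pkernel_dirac R _ C.
rewrite -[RHS]KE//; apply: eq_local_pker => // S g ng g1 Sg.
by rewrite KE// (kap0_local x ng g1 Sg).
Qed.

Lemma kap_semigroup f s t x : (0 <= s)%R -> (0 <= t)%R -> nnmf f ->
  kint (kap (s + t)) f x = kint (kap s) (kint (kap t) f) x.
Proof.
move=> s0 t0 nf; have [K KE] := pkernel_comp (kap s) (kap t).
rewrite -[RHS]KE//; apply: eq_local_pker => // S g ng g1 Sg.
by rewrite KE// (kap_semigroup_local x s0 t0 ng g1 Sg).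
Qed.

(** The list [S2] collects the sites read by the generator of [f]. As soon as a box contains [S] and
    [S2], its estimate has the same constant, which therefore passes to the limit. *)
Lemma kap_generator S f : nnmf f -> (forall y, f y <= 1) -> local S f ->
  uniq S -> exists D : R, forall t x, (0 <= t)%R ->
  (`|fine (kint (kap t) f x) - fine (f x) -
     t * \sum_(k <- S) (fine (kint (th k) f x) - fine (f x))| <= D * t ^+ 2)%R.
Proof.
move=> nf f1 Sf uS.
pose S2 := undup (S ++ flatten [seq nb k | k <- S]).
have S2H : local S2 (fun y => \sum_(k <- S) kint (th k) f y).
  move=> x y xy; apply: eq_big_seq => k kS; apply: (th_local nf Sf) => i iS.
  apply: xy; rewrite mem_undup mem_cat; move: iS; rewrite mem_cat.
  case/orP => [->//|ik]; apply/orP; right; apply/flattenP.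
  by exists (nb k) => //; apply/mapP; exists k.
pose D : R := ((size S2)%:R * (size S)%:R + (size S)%:R * (size S)%:R)%R.
exists (D / 2)%R => t x t0.
have fin_th k : kint (th k) f x \is a fin_num by exact: kint_fin.
have fx : f x \is a fin_num.
  by rewrite ge0_fin_numE ?(le_lt_trans (f1 x)) ?ltry//; exact: nf.2.
pose b := fine (f x); pose a k := fine (kint (th k) f x).
have Hfin : \sum_(k <- S) kint (th k) f x = (\sum_(k <- S) a k)%:E.
  by rewrite -sumEFin; apply: eq_bigr => k _; rewrite fineK.
have [n1 Hn1] := Lam_exhaust S; have [n2 Hn2] := Lam_exhaust S2.
have c1 := kap_local_fvol (x := x) t0 nf f1 Sf.
have bound n : (maxn n1 n2 <= n)%N ->
  (`|fine (kint (fvol th (Lam n) t) f x) - b - t * \sum_(k <- S) (a k - b)|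
    <= D / 2 * t ^+ 2)%R.
  rewrite geq_max => /andP[n1n n2n].
  have [] := @fvol_generator R I th th_out (Lam n) S S2 f t x
    (Lam_uniq n) t0 nf f1 Sf uS (Hn1 n n1n) (undup_uniq _) (Hn2 n n2n) S2H.
  have -> : kint (fvol th (Lam n) t) f x =
      (fine (kint (fvol th (Lam n) t) f x))%:E by rewrite fineK//; exact: kint_fin.
  have -> : f x = b%:E by rewrite fineK.
  rewrite Hfin -!EFinM -!EFinD !lee_fin -/D => h1 h2.
  rewrite big_split /= sumrN big_const_seq count_predT iter_addr_0 -mulr_natl.
  move: h1 h2; set u := fine _; rewrite mulrBr !mulrA mulrAC.
  by move=> h1 h2; rewrite ler_norml; apply/andP; split; lra.
have c2 : (fun n => `|fine (kint (fvol th (Lam n) t) f x) - b -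
    t * \sum_(k <- S) (a k - b)|)%R @ \oo -->
    `|fine (kint (kap t) f x) - b - t * \sum_(k <- S) (a k - b)|%R.
  apply: cvg_norm; apply: cvgB; last exact: cvg_cst.
  by apply: cvgB => //; exact: cvg_cst.
rewrite -(cvg_lim _ c2)//; apply: limr_le.
  by apply/cvg_ex; eexists; exact: c2.
by exists (maxn n1 n2).
Qed.

End limit_semigroup.
Local Close Scope ereal_scope.

(** * Lyapunov functions *)

Local Open Scope ereal_scope.
Section lyapunov.
Context {R : realType} {I : choiceType}.
Notation C := (prodsp I R).
Variable th : I -> R.-pker C ~> C.
Implicit Types (f g : C -> \bar R) (L S : seq I).
Variable B : R.
Hypothesis B_ge0 : (0 <= B)%R.
Variable v : nat -> C -> \bar R.
Hypothesis nv : forall n, nnmf (v n).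
Hypothesis v_local : forall n, exists S, local S (v n).
Let V x := \sum_(0 <= n <oo) v n x.
Hypothesis V_drift : forall L x, uniq L ->
  \sum_(k <- L) kint (th k) V x <= ((size L)%:R + B)%:E * V x.

Let nV : nnmf V. Proof. exact: nnmf_series. Qed.

(** The drift condition makes one step multiply [V] by at most [1 + B / c.+1]; the Poisson
    generating function gives [expR (B * t)], independent of the volume. *)
Lemma fvol_lyapunov L t x : uniq L -> (0 <= t)%R ->
  kint (fvol th L t) V x <= (expR (B * t))%:E * V x.
Proof.
move=> uL t0; set c := size L.
pose q : R := (1 + B / c.+1%:R)%R.
have q0 : (0 <= q)%R by rewrite addr_ge0// divr_ge0.
have V0 x' : 0 <= V x' := nV.2 x'.
have step y : kint (stepk th L c) V y <= q%:E * V y.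
  rewrite stepkE// subSnn mul1e.
  apply: (@le_trans _ _ ((c.+1%:R^-1)%:E * ((((size L)%:R + B)%:E * V y) + V y))).
    by apply: lee_wpmul2l; rewrite ?lee_fin// leeD2r// V_drift.
  rewrite -[X in _ + X]mul1e -ge0_muleDl ?lee_fin ?addr_ge0// -EFinD muleA -EFinM.
  rewrite le_eqVlt; apply/orP; left; apply/eqP.
  by congr (_%:E * _); rewrite /q; field; rewrite nat1r.
have iterV m y : iter m (kint (stepk th L c)) V y <= (q ^+ m)%:E * V y.
  elim: m y => [|m IH] y; first by rewrite expr0 mul1e.
  rewrite iterS; apply: (@le_trans _ _ (kint (stepk th L c)
      (fun z => (q ^+ m)%:E * V z) y)).
    apply: kint_le => //; first exact: nnmf_iter.
    by apply: nnmfZ => //; rewrite lee_fin exprn_ge0.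
  rewrite kintZ ?lee_fin ?exprn_ge0// exprSr EFinM -muleA.
  by apply: lee_wpmul2l => //; rewrite lee_fin exprn_ge0.
rewrite /fvol poiskE ?mulr_ge0//.
have l0 : (0 <= c.+1%:R * t)%R by rewrite mulr_ge0.
apply: (@le_trans _ _ (psum (c.+1%:R * t) (fun m => (q ^+ m)%:E * V x))).
  by apply: le_psum => // m; exact: (nnmf_iter _ _ nV).2.
have -> : expR (B * t) = expR (c.+1%:R * t * (q - 1)).
  by congr expR; rewrite /q; field; rewrite nat1r.
rewrite -psum_geom//.
have [->|Vfin] := eqVneq (V x) +oo.
  apply: (@le_trans _ _ +oo); first by rewrite leey.
  rewrite gt0_muley// psum_geom// lte_fin; exact: expR_gt0.
have {}Vfin : V x = (fine (V x))%:E by rewrite fineK// ge0_fin_numE// lt_neqAle Vfin leey.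
rewrite Vfin /psum muleC -nneseriesZl => [|m _]; last first.
  by rewrite -EFinM lee_fin mulr_ge0 ?pw_ge0// exprn_ge0.
rewrite le_eqVlt; apply/orP; left; apply/eqP; apply: eq_eseriesr => m _.
by rewrite [RHS]muleC muleA.
Qed.

Variables (phi : I -> R) (Cn : R).
Variable Lam : nat -> seq I.
Hypothesis Lam_uniq : forall n, uniq (Lam n).
Variable kap : R -> R.-pker C ~> C.
Hypothesis kapE : forall t n S f x, (0 <= t)%R -> nnmf f -> (forall y, f y <= 1) ->
  local S f ->
  (`|fine (kint (kap t) f x) - fine (kint (fvol th (Lam n) t) f x)|
    <= box_err phi Cn S t n)%R.

Let Vn n x := \sum_(0 <= i < n) v i x.

Let nVn n : nnmf (Vn n). Proof. exact: nnmf_sum. Qed.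

Let Vn_local n : exists S, local S (Vn n).
Proof.
elim: n => [|n [S IH]]; first by exists [::] => x y _; rewrite /Vn !big_nil.
have [S' S'v] := v_local n; exists (S ++ S') => x y xy.
rewrite /Vn !big_nat_recr//=; congr (_ + _).
  by apply: IH => i iS; apply: xy; rewrite mem_cat iS.
by apply: S'v => i iS; apply: xy; rewrite mem_cat iS orbT.
Qed.

(** Since [V] need not be local, Markov's inequality is applied to its partial sums, for which the
    box bounds pass to the limit. The number of terms then tends to infinity at a fixed level, and
    finally the level does. *)
Lemma kap_lyapunov t x : (0 <= t)%R -> V x < +oo ->
  kap t x [set y | V y = +oo] = 0.
Proof.
move=> t0 Vx.
have V0 x' : 0 <= V x' := nV.2 x'.
pose E : R := (expR (B * t) * fine (V x))%R.
have VE : (expR (B * t))%:E * V x = E%:E.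
  by rewrite EFinM fineK// ge0_fin_numE.
have E0 : (0 <= E)%R by rewrite mulr_ge0 ?expR_ge0// fine_ge0.
pose A (M : nat) n := [set y | M.+1%:R%:E < Vn n y].
have mA M n : measurable (A M n).
  rewrite -[A M n]setTI; apply: emeasurable_fun_o_infty => //; exact: (nVn n).1.
have kA M n : kap t x (A M n) <= (E / M.+1%:R)%:E.
  have [S SV] := Vn_local n.
  have SA : local_set S (A M n) by move=> y z yz; rewrite /A /= (SV _ _ yz).
  pose f y : \bar R := (\1_(A M n) y)%:E.
  have nf : nnmf f by exact: nnmf_indic.
  have f1 y : f y <= 1 by rewrite lee_fin indicE; case: (_ \in _).
  have Sf : local S f by move=> y z yz; rewrite /f (local_indic SA yz).
  have fvA m : (fine (kint (fvol th (Lam m) t) f x) <= E / M.+1%:R)%R.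
    rewrite ler_pdivlMr ?ltr0n// mulrC -lee_fin EFinM fineK; last exact: kint_fin.
    rewrite -kintZ// -VE; apply: (le_trans _ (fvol_lyapunov x (Lam_uniq m) t0)).
    apply: kint_le => //; first exact: nnmfZ.
    move=> y; apply: (@le_trans _ _ (Vn n y)); last first.
      by apply: nneseries_lim_ge => i _ _; exact: (nv i).2.
    rewrite /f indicE; have [yA|yA] := boolP (y \in A M n).
      by rewrite mule1; move: yA; rewrite inE => /ltW.
    by rewrite mule0; exact: (nVn n).2.
  rewrite -kint_indic// -/f -[leLHS]fineK; last exact: kint_fin.
  rewrite lee_fin; have c := kap_local_fvol kapE (x := x) t0 nf f1 Sf.
  rewrite -(cvg_lim _ c)//; apply: limr_le; last exact: nearW.
  by apply/cvg_ex; eexists; exact: c.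
have kU M : kap t x (\bigcup_n A M n) <= (E / M.+1%:R)%:E.
  have ndA : nondecreasing_seq (A M).
    move=> n m nm; apply/subsetPset => y /= /lt_le_trans; apply.
    by apply: lee_sum_nneg_natr => // i _ _; exact: (nv i).2.
  have c := nondecreasing_cvg_mu (mu := kap t x) (mA M)
    (bigcupT_measurable _ (mA M)) ndA.
  rewrite -(cvg_lim _ c)//; apply: lime_le; last by apply: nearW => n; exact: kA.
  by apply/cvg_ex; eexists; exact: c.
have mV : measurable [set y | V y = +oo].
  rewrite -[X in measurable X]setTI.
  exact: (nV.1 measurableT [set +oo] (emeasurable_set1 _)).
have le M : kap t x [set y | V y = +oo] <= (E / M.+1%:R)%:E.
  apply: le_trans (kU M); apply: le_measure; rewrite ?inE//.
    exact: bigcupT_measurable.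
  move=> y /= Vy.
  have : M.+1%:R%:E < V y by rewrite Vy ltry.
  apply: contraPP => nA; apply/negP; rewrite -leNgt.
  apply: lime_le; first by apply: is_cvg_nneseries => i _ _; exact: (nv i).2.
  apply: nearW => n; rewrite leNgt; apply/negP => h; apply: nA; exists n => //.
apply/eqP; rewrite eq_le measure_ge0 andbT; apply/lee_addgt0Pr => e e0.
rewrite add0e; apply: le_trans (le (Num.truncn (E / e))) _.
rewrite lee_fin ler_pdivrMr ?ltr0n// mulrC -ler_pdivrMr//.
exact/ltW/truncnS_gt.
Qed.

End lyapunov.
Local Close Scope ereal_scope.

(** * The lattice dynamics *)

Section norm_equivalence.
Context {R : realType} {d : nat}.
Variable N : 'rV[R]_d -> R.
Hypothesis N_norm : is_norm N.

Lemma is_norm0 : N 0 = 0.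
Proof. by have [_ NZ _] := N_norm; rewrite -(scale0r 0) NZ normr0 mul0r. Qed.

Lemma is_normN v : N (- v) = N v.
Proof. by have [_ NZ _] := N_norm; rewrite -scaleN1r NZ normrN1 mul1r. Qed.

Lemma is_norm_ge0 v : 0 <= N v.
Proof.
have [_ _ ND] := N_norm; rewrite -(pmulr_rge0 (x := 2))// mulr_natl mulr2n.
by rewrite -[X in _ <= _ + X]is_normN -is_norm0 -(subrr v).
Qed.

Lemma coord_le_norm (v : 'rV[R]_d) i : `|v 0 i| <= `|v|.
Proof.
have /mapP[j Hj ->] : `|v 0 i| \in [seq `|v x.1 x.2| | x : 'I_1 * 'I_d].
  by apply/mapP; exists (0, i) => //=; rewrite mem_enum.
by rewrite [leRHS]/Num.norm /= mx_normrE; apply/bigmax_geP; right => /=; exists j.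
Qed.

Lemma is_norm_le : exists2 K, 0 <= K & forall v, N v <= K * `|v|.
Proof.
have [_ NZ ND] := N_norm.
exists (\sum_i N (delta_mx 0 i)); first by apply: sumr_ge0 => i _; exact: is_norm_ge0.
move=> v; rewrite {1}[v]row_sum_delta mulr_suml.
apply: (@le_trans _ _ (\sum_i N (v 0 i *: delta_mx 0 i))).
  elim/big_ind2 : _ => [|x a y b xa yb|//]; first by rewrite is_norm0.
  by rewrite (le_trans (ND _ _))// lerD.
apply: ler_sum => i _; rewrite NZ mulrC ler_wpM2l ?is_norm_ge0//.
exact: coord_le_norm.
Qed.

(** The minimum of [N] on the compact unit sphere; [N] is Lipschitz, hence continuous, by
    [is_norm_le]. *)
Lemma is_norm_ge : exists2 c, 0 < c & forall v, c * `|v| <= N v.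
Proof.
have [N0 NZ ND] := N_norm.
have [K K0 NK] := is_norm_le.
have Nlip u v : `|N u - N v| <= K * `|u - v|.
  rewrite (le_trans _ (NK _))//.
  have h1 := ND (u - v) v; rewrite subrK in h1.
  have h2 := ND (v - u) u; rewrite subrK -opprB is_normN in h2.
  by rewrite ler_norml; apply/andP; split; lra.
have Ncont : continuous N.
  move=> v; have FF := nbhs_filter v; apply/cvgrPdist_le => e e0.
  have eK : 0 < e / (K + 1) by rewrite divr_gt0// ltr_wpDl.
  have : nbhs v (ball v (e / (K + 1))) by exact: nbhsx_ballx.
  apply: filterS.
  move=> u; rewrite -ball_normE /= => vu; rewrite (le_trans (Nlip v u))//.
  apply: (@le_trans _ _ ((K + 1) * `|v - u|)); first by rewrite ler_wpM2r// lerDl.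
  by rewrite mulrC -ler_pdivlMr ?ltr_wpDl// ltW.
pose A := [set v : 'rV[R]_d | `|v| = 1].
(* The sphere is empty in dimension zero, where every vector vanishes. *)
have [A0|/set0P A0] := eqVneq A set0.
  exists 1 => // v; have [->|v0] := eqVneq v 0; first by rewrite normr0 mulr0 is_norm0.
  have : A (`|v|^-1 *: v).
    by rewrite /A /= normrZ normfV normr_id mulVf// normr_eq0.
  by rewrite A0.
have cA : compact A.
  apply: bounded_closed_compact.
    exists 1; split => // M M1 v /= ->; exact: ltW.
  have -> : A = (fun v : 'rV[R]_d => `|v|) @^-1` [set 1] by [].
  apply: closed_comp; last exact: closed_eq.
  by move=> v _; exact: norm_continuous.
have [v vA vmin] := EVT_min_rV A0 cA (continuous_subspaceT Ncont).
have v1 : `|v| = 1 by move: vA; rewrite inE.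
exists (N v).
  rewrite lt_neqAle is_norm_ge0 andbT eq_sym; apply/eqP => /N0 v0.
  by move: v1; rewrite v0 normr0 => /eqP; rewrite eq_sym oner_eq0.
move=> u; have [->|u0] := eqVneq u 0; first by rewrite normr0 mulr0 is_norm0.
have u1 : 0 < `|u| by rewrite normr_gt0.
have := vmin (`|u|^-1 *: u); rewrite inE /A /= normrZ normfV normr_id mulVf ?gt_eqF//.
by move=> /(_ erefl); rewrite NZ normfV normr_id mulrC ler_pdivlMr.
Qed.

End norm_equivalence.

Section lattice.
Context {d : nat}.
Implicit Types (i j k : Zd d).

Definition norm1 j : nat := (\sum_i `|j ord0 i|%N)%N.

Lemma norm1D i j : (norm1 (i + j) <= norm1 i + norm1 j)%N.
Proof.
rewrite /norm1 -big_split /=; apply: leq_sum => a _; rewrite mxE.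
by rewrite -lez_nat PoszD !abszE ler_normD.
Qed.

Definition box_point n (f : {ffun 'I_d -> 'I_n.*2.+1}) : Zd d :=
  \row_i ((f i)%:Z - n%:Z).

Definition box n : seq (Zd d) := undup [seq box_point f | f : {ffun 'I_d -> 'I_n.*2.+1}].

Lemma box_uniq n : uniq (box n). Proof. exact: undup_uniq. Qed.

Lemma mem_box n j : (forall a, (`|j ord0 a| <= n)%N) -> j \in box n.
Proof.
move=> jn; rewrite mem_undup; apply/mapP.
have ja a : exists u : 'I_n.*2.+1, u%:Z - n%:Z = j ord0 a.
  have := jn a; rewrite -lez_nat abszE ler_norml => /andP[j1 j2].
  have j0 : 0 <= j ord0 a + n%:Z by rewrite -lerBlDr sub0r.
  pose z : int := j ord0 a + n%:Z.
  have lt : (absz z < n.*2.+1)%N.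
    by rewrite ltnS -lez_nat abszE ger0_norm// -addnn PoszD lerD2r.
  by exists (Ordinal lt); rewrite /= abszE ger0_norm// addrK.
have [u uE] := choice ja.
exists [ffun a => u a]; first by rewrite mem_enum.
by apply/rowP => a; rewrite mxE ffunE uE.
Qed.

Lemma notin_box n j : j \notin box n -> (n < norm1 j)%N.
Proof.
apply: contraNT; rewrite -leqNgt => jn; apply: mem_box => a.
by rewrite (leq_trans _ jn)// /norm1 (bigD1 a)//= leq_addr.
Qed.

End lattice.

Section weights.
Context {R : realType} {d : nat}.
Implicit Types (i j k : Zd d).

Lemma geometric_sum_le (b : R) n : 0 <= b < 1 ->
  \sum_(0 <= m < n) b ^+ m <= (1 - b)^-1.
Proof.
move=> /andP[b0 b1]; have b1' : 0 < 1 - b by rewrite subr_gt0.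
rewrite -[leRHS]mul1r ler_pdivlMr// mulrC big_mkord -opprB mulNr -subrX1 opprB.
by rewrite gerBl exprn_ge0.
Qed.

(** The weight is a product over coordinates, so the sum over the box is the [d]-th power of a
    two-sided geometric sum, bounded by [2 / (1 - b)]. *)
Lemma box_geometric_sum (b : R) n : 0 <= b < 1 ->
  \sum_(j <- box n) b ^+ norm1 (j : Zd d) <= (2 / (1 - b)) ^+ d.
Proof.
move=> b01; have /andP[b0 b1] := b01.
have b1' : 0 < 1 - b by rewrite subr_gt0.
pose F : seq (Zd d) := [seq box_point f | f : {ffun 'I_d -> 'I_n.*2.+1}].
apply: (@le_trans _ _ (\sum_(j <- F) b ^+ norm1 j)).
  rewrite /box -/F; elim: F => [|j F IH] //=; rewrite big_cons; case: ifP => _.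
    by rewrite (le_trans IH)// lerDr exprn_ge0.
  by rewrite big_cons lerD2l.
rewrite /F big_image /=.
have -> : \sum_(f : {ffun 'I_d -> 'I_n.*2.+1}) b ^+ norm1 (box_point f) =
    \sum_(f : {ffun 'I_d -> 'I_n.*2.+1}) \prod_(i < d) b ^+ `|(f i)%:Z - n%:Z|%N.
  apply: eq_bigr => f _; rewrite /norm1 -prodrXr; apply: eq_bigr => i _.
  by rewrite mxE.
rewrite -(bigA_distr_bigA (fun (i : 'I_d) (a : 'I_n.*2.+1) => b ^+ `|a%:Z - n%:Z|%N)).
rewrite prodr_const card_ord; apply: lerXn2r; rewrite ?nnegrE.
- by apply: sumr_ge0 => a _; exact: exprn_ge0.
- by rewrite divr_ge0// ltW.
(* The index [a] stands for the coordinate [a - n]; the sum is split between nonpositive and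
   positive coordinates. *)
have sumE : \sum_(a < n.*2.+1) b ^+ `|a%:Z - n%:Z|%N =
    \sum_(0 <= a < n.+1) b ^+ (n - a) + \sum_(0 <= a < n) b ^+ a.+1.
  rewrite -(big_mkord xpredT (fun a => b ^+ `|a%:Z - n%:Z|%N)).
  have nn : (n.+1 <= n.*2.+1)%N by rewrite ltnS -addnn leq_addr.
  rewrite (big_cat_nat (leq0n _) nn) /=; congr (_ + _).
    by apply: eq_big_nat => a /andP[_ an]; congr (b ^+ _); rewrite distnC distnEl.
  rewrite -[in LHS](add0n n.+1) -[in X in \sum_(_ <= _ < X) _]addnn -addnS big_addn.
  rewrite addnK; apply: eq_big_nat => a _; congr (b ^+ _).
  by rewrite distnEl ?addnS ?subSn ?leq_addl ?addnK// ltnW// ltnS leq_addl.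
rewrite sumE big_nat_rev /= add0n.
rewrite mulr_natl mulr2n; apply: lerD.
  rewrite (eq_big_nat _ _ (F2 := fun a => b ^+ a)) => [|a /andP[_ an]].
    exact: geometric_sum_le.
  by rewrite subSS subKn -1?ltnS.
apply: le_trans (geometric_sum_le n b01); apply: ler_sum => a _.
by rewrite exprSr ler_piMr ?exprn_ge0// ltW.
Qed.

End weights.

Local Open Scope ereal_scope.

(** * Tail and first absolute moment of the standard Gaussian *)

Section gaussian_moment.
Context {R : realType}.
Notation G := (normal_prob (0 : R) 1).

(** Comparison with the Gaussian density of variance 2: the ratio of densities is
    [K * expR (- z ^+ 2 / 4)], where [K] is the ratio of the peaks, and [z ^+ 2 >= n] on the
    tail. *)
Lemma normal_tail : exists2 K : R, (0 <= K)%R & forall n : nat,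
  G [set z : R | (n%:R <= `|z|)%R] <= (K * expR (- (4%:R^-1)) ^+ n)%:E.
Proof.
pose s : R := Num.sqrt 2%:R.
have s2 : (s ^+ 2 = 2 :> R)%R by rewrite sqr_sqrtr.
have s0 : (s != 0)%R by rewrite gt_eqF// sqrtr_gt0.
have peak_s := normal_peak_gt0 s0.
have peak_1 := normal_peak_gt0 (oner_neq0 R).
pose K : R := (normal_peak 1 / normal_peak s)%R.
have K0 : (0 <= K)%R by rewrite divr_ge0// ltW.
exists K => // n; pose q : R := (K * expR (- (4%:R^-1)) ^+ n)%R.
have q0 : (0 <= q)%R by rewrite mulr_ge0// exprn_ge0// expR_ge0.
pose A := [set z : R | (n%:R <= `|z|)%R].
have mA : measurable A.
  have -> : A = (fun z : R => `|z|)%R @^-1` [set` Interval (BLeft n%:R) +oo%O].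
    by apply/seteqP; split => z; rewrite /A /= in_itv /= andbT.
  by rewrite -[X in measurable X]setTI; exact: normr_measurable.
have pdf_le z : A z -> (normal_pdf 0 1 z <= q * normal_pdf 0 s z)%R.
  rewrite /A /= => nz; rewrite !normal_pdfE ?oner_neq0// /normal_fun.
  rewrite /q /K -!mulrA [leRHS](_ : _ = normal_peak 1 *
    (expR (- 4%:R^-1) ^+ n * expR (- (z - 0) ^+ 2 / (s ^+ 2 *+ 2))))%R; last first.
    by field; rewrite gt_eqF.
  rewrite ler_wpM2l ?(ltW peak_1)// -expRM_natl -expRD ler_expR s2 subr0.
  have -> : (1 ^+ 2 *+ 2 = 2 :> R)%R by rewrite expr1n.
  have -> : (2 *+ 2 = 4 :> R)%R by rewrite -mulrnA.
  have nz2 : (n%:R <= z ^+ 2)%R.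
    rewrite -real_normK ?num_real//; apply: (@le_trans _ _ (n%:R ^+ 2)%R).
      by rewrite -natrX ler_nat; case: (n) => // n'; rewrite -{1}[n'.+1]expn1 leq_pexp2l.
    by rewrite ler_pXn2r// nnegrE.
  rewrite -subr_ge0; have -> : (n%:R * - 4%:R^-1 + - z ^+ 2 / 4 - (- z ^+ 2 / 2) =
    (z ^+ 2 - n%:R) / 4)%R by field.
  by rewrite divr_ge0// subr_ge0.
rewrite -/A -/q /normal_prob.
have mpdf s' : measurable_fun setT (fun z : R => (normal_pdf 0 s' z)%:E).
  by apply/measurable_EFinP; exact: measurable_normal_pdf.
apply: (@le_trans _ _ (\int[lebesgue_measure]_(z in A) (q%:E * (normal_pdf 0 s z)%:E))).
  have mq : measurable_fun setT (fun z : R => q%:E * (normal_pdf 0 s z)%:E).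
    exact: measurable_funeM.
  apply: ge0_le_integral => //.
  - by move=> z _; rewrite lee_fin normal_pdf_ge0.
  - exact: (measurable_funTS (mpdf 1%R)).
  - exact: (measurable_funTS mq).
rewrite ge0_integralZl ?lee_fin//; last 2 first.
- exact: (measurable_funTS (mpdf s)).
- by move=> z _; rewrite lee_fin normal_pdf_ge0.
rewrite -[leRHS]mule1 lee_wpmul2l ?lee_fin// -(integral_normal_pdf 0 s).
apply: ge0_subset_integral => //; first exact: mpdf.
by move=> z _; rewrite lee_fin normal_pdf_ge0.
Qed.

(** The absolute value is at most 1 plus the number of integer levels [i.+1] that it reaches;
    summing the tails gives a geometric series. *)
Lemma normal_abs_moment : exists2 m : R, (0 <= m)%R &
  \int[G]_z (`|z|%R)%:E <= m%:E.
Proof.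
have [K K0 tail] := normal_tail.
pose b : R := expR (- (4%:R^-1)).
have b01 : (0 <= b < 1)%R by rewrite expR_ge0 expR_lt1 oppr_lt0 invr_gt0 ltr0n.
have /andP[b0 b1] := b01.
have b1' : (0 <= (1 - b)^-1)%R by rewrite invr_ge0 subr_ge0 ltW.
exists (1 + K * (1 - b)^-1)%R; first by rewrite addr_ge0// mulr_ge0.
pose A n := [set z : R | (n%:R <= `|z|)%R].
have mA n : measurable (A n).
  have -> : A n = (fun z : R => `|z|)%R @^-1` [set` Interval (BLeft n%:R) +oo%O].
    by apply/seteqP; split => z; rewrite /A /= in_itv /= andbT.
  by rewrite -[X in measurable X]setTI; exact: normr_measurable.
have nA n : nnmf (fun z : R => (\1_(A n) z)%:E : \bar R) by exact: nnmf_indic.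
have [mS S0] := nnmf_series (fun i => nA i.+1).
apply: (@le_trans _ _ (\int[G]_z (1 + \sum_(0 <= i <oo) (\1_(A i.+1) z)%:E))).
  apply: ge0_le_integral => //.
  - by apply/measurable_EFinP; exact: normr_measurable.
  - by apply: emeasurable_funD.
  - move=> z _; have [N zN] : exists N : nat, (`|z| <= N%:R)%R.
      by exists (Num.truncn `|z|).+1; exact/ltW/truncnS_gt.
    have [_] := @layer_count R N `|z|%R (normr_ge0 z).
    move=> /(_ zN) le; apply: (@le_trans _ _
        (\sum_(0 <= i < N) (i.+1%:R <= `|z|)%R%:R + 1)%R%:E); first by rewrite lee_fin.
    rewrite EFinD addeC leeD2l// -sumEFin.
    apply: (@le_trans _ _ (\sum_(0 <= i < N) (\1_(A i.+1) z)%:E)).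
      apply: lee_sum => i _; rewrite lee_fin indicE le_eqVlt; apply/orP; left; apply/eqP.
      by congr (_%:R); congr nat_of_bool; apply/idP/idP; rewrite inE.
    by apply: nneseries_lim_ge => i _ _; rewrite lee_fin.
rewrite ge0_integralD// integral_cst// mul1e (@probability_setT _ _ _ G).
rewrite EFinD leeD2l// integral_nneseries//; last by move=> i; exact: (nA _).1.
apply: lime_le; first by apply: is_cvg_nneseries => i _ _; exact: integral_ge0.
apply: nearW => N; apply: (@le_trans _ _ (\sum_(0 <= i < N) (K * b ^+ i)%:E)).
  apply: lee_sum => i _; rewrite integral_indic ?setIT//; last exact: mA.
  apply: le_trans (tail i.+1) _; rewrite lee_fin ler_wpM2l//.
  by rewrite exprSr ler_piMr ?exprn_ge0// ltW.
by rewrite sumEFin -mulr_sumr lee_fin ler_wpM2l// geometric_sum_le.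
Qed.

End gaussian_moment.
Local Close Scope ereal_scope.

(** * Update kernels of the model and drift of the weighted norm *)

Section lattice_dynamics.
Context {R : realType} {d : nat} (N : 'rV[R]_d -> R) (alpha r : R)
  (p : Zd d -> Zd d -> R) (dat : conf R d).
Hypothesis d_gt0 : (0 < d)%N.
Hypothesis N_norm : is_norm N.
Hypothesis alpha01 : 0 < alpha < 1.
Hypothesis r_gt0 : 0 < r.
Hypothesis p_ge0 : forall i j, 0 <= p i j.
Hypothesis p_sum1 : forall i, (\esum_(j in [set: Zd d]) (p i j)%:E = 1)%E.
Hypothesis p_homogeneous : forall i j, p i (i + j) = p 0 j.
Hypothesis p_symmetric : forall i j, p i j = p j i.
Hypothesis p_range : forall j, r <= Znorm N j -> p 0 j = 0.
Hypothesis dat_XX : XX N alpha r dat.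
Notation C := (prodsp (Zd d) R).
Notation G := (normal_prob (0 : R) 1).
Implicit Types (i j k : Zd d) (x : C) (f : C -> \bar R).

Lemma Znorm_ge_norm1 : exists2 c, 0 < c & forall j, c * (norm1 j)%:R <= Znorm N j.
Proof.
have [c c0 cN] := is_norm_ge N_norm.
have d0 : 0 < d%:R :> R by rewrite ltr0n.
exists (c / d%:R); first by rewrite divr_gt0.
move=> j; rewrite /Znorm; apply: le_trans (cN _).
rewrite -mulrA ler_pM2l// ler_pdivrMl// /norm1 natr_sum.
apply: (@le_trans _ _ (\sum_(a < d) `|map_mx intr j : 'rV[R]_d|)).
  apply: ler_sum => a _; apply: le_trans (coord_le_norm _ a).
  by rewrite mxE -intr_norm -abszE.
by rewrite sumr_const card_ord mulr_natl.
Qed.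

Lemma Znorm_triangle i j : Znorm N i <= Znorm N j + Znorm N (i - j).
Proof.
have [_ _ ND] := N_norm; rewrite /Znorm.
have -> : map_mx intr i = map_mx intr j + map_mx intr (i - j) :> 'rV[R]_d.
  by apply/rowP => a; rewrite !mxE -rmorphD /= subrKC.
exact: ND.
Qed.

(** Equivalence of norms: leaving a large box forces [Znorm N j >= r]. *)
Lemma finite_range : exists n0, forall j, j \notin box n0 -> p 0 j = 0.
Proof.
have [c c0 cN] := Znorm_ge_norm1.
exists (Num.truncn (r / c)) => j /notin_box jn; apply: p_range.
apply: le_trans (cN j); rewrite mulrC -ler_pdivrMr//.
by apply: (le_trans (ltW (truncnS_gt _))); rewrite ler_nat.
Qed.

Definition range_radius : nat := projT1 (cid finite_range).

Definition nbr k : seq (Zd d) := [seq k + b | b <- box range_radius].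

Lemma p_shift k i : p k i = p 0 (i - k).
Proof. by rewrite -[in LHS](subrKC k i) p_homogeneous. Qed.

Lemma notin_nbr k i : i \notin nbr k -> p k i = 0.
Proof.
move=> ik; rewrite p_shift; rewrite /nbr /range_radius in ik.
case: cid ik => n0 /= n0P ik; apply: n0P; apply: contra ik => ik.
by apply/mapP; exists (i - k) => //; rewrite subrKC.
Qed.

Lemma nbr_uniq k : uniq (nbr k).
Proof. by rewrite map_inj_uniq ?box_uniq//; exact: addrI. Qed.

Lemma Theta_sum k (x : conf R d) : \sum_(i \in [set: Zd d]) p k i * x i =
  \sum_(i <- nbr k) p k i * x i.
Proof.
rewrite [RHS]fsbig_seq ?nbr_uniq//; symmetry.
by apply: fsbig_widen => // i [_ /= /negP ik]; rewrite notin_nbr// mul0r.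
Qed.

Lemma measurable_Theta k :
  measurable_fun setT (fun xz : C * R => Theta alpha p dat k xz.2 xz.1 : C).
Proof.
apply: measurable_fun_prodsp => j; rewrite /Theta; case: (j == k); last first.
  by apply: (measurableT_comp (measurable_coord j)); exact: measurable_fst.
under eq_fun do rewrite Theta_sum.
apply: measurable_funD; last exact: measurable_snd.
apply: measurable_funD => //; apply: measurable_funM => //.
apply: measurable_sum => i; apply: measurable_funM => //.
by apply: (measurableT_comp (measurable_coord i)); exact: measurable_fst.
Qed.

Lemma theta_kernel_exists k : exists K : R.-pker C ~> C, forall x f, nnmf f ->
  kint K f x = (\int[G]_z f (Theta alpha p dat k z x))%E.
Proof.
have [K KE] := pkernel_random G (measurable_Theta k).
by exists K => x f nf; rewrite KE.
Qed.

Definition theta k : R.-pker C ~> C := projT1 (cid (theta_kernel_exists k)).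

Lemma thetaE k x f : nnmf f ->
  kint (theta k) f x = (\int[G]_z f (Theta alpha p dat k z x))%E.
Proof. by move=> nf; rewrite /theta; case: cid => K /= ->. Qed.

Lemma theta_out k S f : nnmf f -> local S f -> k \notin S ->
  forall x, kint (theta k) f x = f x.
Proof.
move=> nf Sf kS x; rewrite thetaE//.
transitivity (\int[G]_z (f x))%E.
  apply: eq_integral => z _; apply: Sf => j jS; rewrite /Theta.
  by case: eqP => // jk; rewrite -jk jS in kS.
by rewrite integral_cst// (@probability_setT _ _ _ G) mule1.
Qed.

Lemma theta_local k S f : nnmf f -> local S f -> local (S ++ nbr k) (kint (theta k) f).
Proof.
move=> nf Sf x y xy; rewrite !thetaE//; apply: eq_integral => z _; apply: Sf => j jS.
rewrite /Theta; case: eqP => [_|_]; last by rewrite xy// mem_cat jS.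
rewrite !Theta_sum; congr (_ * _ + _ + _); apply: eq_big_seq => i ik.
by rewrite xy// mem_cat ik orbT.
Qed.

Definition size_weight j : R := (norm1 j).+1%:R.

Definition size_const : R := \sum_(b <- box range_radius) size_weight b.

(** The weight is submultiplicative under translation, because [1 + |k + b|_1 <= (1 + |k|_1) * (1 +
    |b|_1)]. *)
Lemma size_weight_nbr k : \sum_(j <- nbr k) size_weight j <= size_const * size_weight k.
Proof.
rewrite /nbr big_map mulr_suml; apply: ler_sum => b _.
rewrite /size_weight -natrM ler_nat; apply: (@leq_trans (norm1 k + norm1 b).+1).
  by rewrite ltnS norm1D.
by rewrite -addSn mulSn leq_add2l leq_pmulr.
Qed.

Lemma size_weight_box n j : j \notin box n -> n.+1%:R <= size_weight j.
Proof. by move=> /notin_box jn; rewrite ler_nat ltnW. Qed.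

Definition weight j : R := alpha `^ (Znorm N j / r).

Lemma weight_ge0 j : 0 <= weight j. Proof. exact: powR_ge0. Qed.

(** A positive rate forces [Znorm N (i - k) < r], so by the triangle inequality the exponent at [i]
    exceeds that at [k] by at most 1. *)
Lemma weight_step i k : p k i != 0 -> alpha * weight k <= weight i.
Proof.
have /andP[a0 a1] := alpha01.
move=> pki; have ki : Znorm N (i - k) < r.
  by rewrite ltNge; apply/negP => /p_range; rewrite -p_shift => /eqP; exact/negP.
rewrite /weight -{1}[alpha]powRr1 ?(ltW a0)//.
rewrite -powRD; last by rewrite (gt_eqF a0) implybT.
apply: ger_powR; first by rewrite a0 ltW.
rewrite ler_pdivrMr// mulrDl mul1r divfK ?gt_eqF//.
by rewrite (le_trans (Znorm_triangle i k))// addrC lerD2r ltW.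
Qed.

(** Norm equivalence bounds [weight j] by [b ^+ norm1 j] with [b < 1]. Summability makes the total
    contribution of the noise at all sites finite. *)
Lemma weight_summable : (\esum_(j in [set: Zd d]) (weight j)%:E < +oo)%E.
Proof.
have /andP[a0 a1] := alpha01.
have [c c0 cN] := Znorm_ge_norm1.
pose b : R := alpha `^ (c / r).
have b0 : 0 < b by rewrite powR_gt0.
have b1 : b < 1.
  have <- : 1 `^ (c / r) = 1 :> R by rewrite powR1.
  by apply: gt0_ltr_powR; rewrite ?divr_gt0// nnegrE ltW.
have wb j : weight j <= b ^+ norm1 j.
  rewrite /weight /b -powR_mulrn ?powR_ge0// -powRrM.
  apply: ger_powR; first by rewrite a0 ltW.
  by rewrite mulrAC ler_pM2r ?invr_gt0.
apply: (@le_lt_trans _ _ (((2 / (1 - b)) ^+ d)%:E)); last by rewrite ltry.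
apply: ge_ereal_sup => _ [A [finA _] <-].
rewrite fsbig_finite//.
pose s : seq (Zd d) := finmap.enum_fset (fset_set A).
have [n sn] : exists n, {subset s <= box n}.
  exists (\max_(j <- s) norm1 j)%N => j js.
  apply: contraT => /notin_box; rewrite ltnNge => /negP[].
  exact: (leq_bigmax_seq (F := @norm1 d)).
apply: (@le_trans _ _ (\sum_(j <- box n) b ^+ norm1 j)%:E); last first.
  by rewrite lee_fin; apply: box_geometric_sum; rewrite ltW.
rewrite sumEFin lee_fin.
apply: (@le_trans _ _ (\sum_(j <- s) b ^+ norm1 j)).
  by apply: ler_sum => j _; exact: wb.
rewrite [leRHS](bigID (mem (s))) /=.
rewrite -[leLHS]addr0; apply: lerD; last by apply: sumr_ge0 => j _; rewrite exprn_ge0 ?ltW.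
rewrite le_eqVlt; apply/orP; left; apply/eqP; rewrite -[RHS]big_filter.
apply: perm_big; apply: uniq_perm; first exact: finmap.fset_uniq.
  by apply: filter_uniq; exact: box_uniq.
move=> j; rewrite mem_filter; case js : (j \in s) => //=.
by rewrite sn.
Qed.

Local Open Scope ereal_scope.

Lemma sum_le_esum (a : Zd d -> R) (L : seq (Zd d)) : uniq L -> (forall j, (0 <= a j)%R) ->
  (\sum_(j <- L) a j)%R%:E <= \esum_(j in [set: Zd d]) (a j)%:E.
Proof.
move=> uL a0; apply: esum_ge; exists [set` L].
  by split => //; exact: finite_seq.
by rewrite -sumEFin fsbig_seq.
Qed.

Definition wnorm x : \bar R := \esum_(j in [set: Zd d]) (`|x j| * weight j)%R%:E.

(** The sites are enumerated by [pickle], which writes the weighted norm as a series of local terms,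
    the form required of a Lyapunov function; indices that code no site contribute 0. *)
Let wterm x (n : nat) : \bar R :=
  if (pickle_inv n : option (Zd d)) is Some j then (`|x j| * weight j)%R%:E else 0.

Let wterm_ge0 x n : 0 <= wterm x n.
Proof.
by rewrite /wterm; case: pickle_inv => // j; rewrite lee_fin mulr_ge0// weight_ge0.
Qed.

Lemma wnorm_series x : wnorm x = \sum_(0 <= n <oo) wterm x n.
Proof.
rewrite nneseries_esumT// /wnorm.
transitivity (\esum_(n in [set pickle j | j in [set: Zd d]]) wterm x n).
  rewrite esum_image.
    by apply: eq_esum => j _; rewrite /wterm pickleK_inv.
  by move=> i j _ _; exact: (pcan_inj (@pickleK _)).
rewrite esum_mkcond; apply: eq_esum => n _; case: ifPn => //.
rewrite notin_setE /= => nj; rewrite /wterm; case E : (pickle_inv n) => [j|//].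
by exfalso; apply: nj; exists j => //; have := @pickle_invK (Zd d) n; rewrite E.
Qed.

Let nnmf_wterm n : nnmf (wterm ^~ n).
Proof.
rewrite /wterm; case: (pickle_inv n) => [j|]; last by split=> [|x]; [exact: measurable_cst|].
split; last by move=> x; rewrite lee_fin mulr_ge0// weight_ge0.
apply/measurable_EFinP; apply: measurable_funM => //.
apply: (measurableT_comp (@normr_measurable _ setT)); exact: measurable_coord.
Qed.

Lemma nnmf_wnorm : nnmf wnorm.
Proof.
rewrite (_ : wnorm = fun x => \sum_(0 <= n <oo) wterm x n); last exact/funext/wnorm_series.
exact: nnmf_series.
Qed.

Let m1 : R := projT1 (cid2 (@normal_abs_moment R)).

Let m1_ge0 : (0 <= m1)%R.
Proof. by rewrite /m1; case: cid2. Qed.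

Let m1P : \int[G]_z (`|z|%R)%:E <= m1%:E.
Proof. by rewrite /m1; case: cid2. Qed.

(** The total weighted input of data and noise over all sites. Adding it to the weighted norm turns
    an affine drift bound into a linear one. *)
Definition lyap_const : R := (fine (wnorm dat) + m1 * fine (wnorm (fun=> 1%R)))%R.

Let wnorm_fin : wnorm (fun=> 1%R) \is a fin_num.
Proof.
rewrite ge0_fin_numE; last by apply: esum_ge0 => j _; rewrite lee_fin mulr_ge0// weight_ge0.
apply: le_lt_trans weight_summable; apply: le_esum => j _.
by rewrite normr1 mul1r.
Qed.

Let wnorm_dat_fin : wnorm dat \is a fin_num.
Proof.
rewrite ge0_fin_numE; first exact: dat_XX.
by apply: esum_ge0 => j _; rewrite lee_fin mulr_ge0// weight_ge0.
Qed.

Lemma lyap_const_ge0 : (0 <= lyap_const)%R.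
Proof.
have h x : (0 <= fine (wnorm x))%R.
  by apply: fine_ge0; apply: esum_ge0 => j _; rewrite lee_fin mulr_ge0// weight_ge0.
by rewrite addr_ge0 ?mulr_ge0.
Qed.

Definition lyap_term (n : nat) x : \bar R :=
  if n is n'.+1 then wterm x n' else lyap_const%:E.

Lemma nnmf_lyap_term n : nnmf (lyap_term n).
Proof.
case: n => [|n]; last exact: nnmf_wterm.
by split => [|x]; [exact: measurable_cst|rewrite lee_fin lyap_const_ge0].
Qed.

Lemma lyap_term_local n : exists S, local S (lyap_term n).
Proof.
case: n => [|n] /=; first by exists [::].
rewrite /lyap_term /wterm; case: (pickle_inv n) => [j|]; last by exists [::].
by exists [:: j] => x y xy; rewrite xy ?inE.
Qed.

Definition lyap x : \bar R := \sum_(0 <= n <oo) lyap_term n x.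

Lemma lyapE x : lyap x = lyap_const%:E + wnorm x.
Proof.
rewrite /lyap nneseries_recl//; last by move=> n _; exact: (nnmf_lyap_term n).2.
rewrite -[in LHS]nneseries_addn; last by move=> n; exact: (nnmf_lyap_term n).2.
by rewrite wnorm_series; congr (_ + _); apply: eq_eseriesr => n _; rewrite addn1.
Qed.

(** Only site [k] changes. Its old contribution is kept on the right, so nothing is subtracted from
    a possibly infinite sum. *)
Lemma lyap_Theta k (z : R) x :
  lyap (Theta alpha p dat k z x) <= lyap x + (weight k * `|Theta alpha p dat k z x k|)%R%:E.
Proof.
rewrite !lyapE -addeA leeD2l//.
set y := Theta _ _ _ _ _ _.
have wy0 : (0 <= weight k * `|y k|)%R by rewrite mulr_ge0// weight_ge0.
have -> : (weight k * `|y k|)%R%:E =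
    \esum_(j in [set: Zd d]) (if j \in [set k] then (weight k * `|y k|)%R%:E else 0).
  by rewrite -esum_mkcond esum_set1// lee_fin.
rewrite -esumD; last 2 first.
- by move=> j _; rewrite lee_fin mulr_ge0// weight_ge0.
- by move=> j _; case: ifP.
apply: le_esum => j _; case: ifPn; rewrite ?inE ?notin_setE /=.
  by move=> ->; rewrite -EFinD lee_fin mulrC lerDr mulr_ge0// weight_ge0.
by move=> /eqP jk; rewrite adde0 /y /Theta (negbTE jk).
Qed.

Lemma Theta_abs k (z : R) x : (`|Theta alpha p dat k z x k| <=
  alpha * (\sum_(i <- nbr k) p k i * `|x i|) + `|dat k| + `|z|)%R.
Proof.
have /andP[a0 a1] := alpha01.
rewrite /Theta eqxx Theta_sum (le_trans (ler_normD _ _))// lerD2r.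
rewrite (le_trans (ler_normD _ _))// lerD//.
  rewrite normrM (gtr0_norm a0) ler_pM2l// (le_trans (ler_norm_sum _ _ _))//.
  by apply: ler_sum => i _; rewrite normrM ger0_norm.
by rewrite normrM gtr0_norm ?subr_gt0// ler_piMl// gerBl ltW.
Qed.

Lemma theta_lyap k x : kint (theta k) lyap x <= lyap x +
  (weight k * (alpha * (\sum_(i <- nbr k) p k i * `|x i|) + `|dat k| + m1))%R%:E.
Proof.
have /andP[a0 a1] := alpha01.
have nl : nnmf lyap by apply: nnmf_series => n; exact: nnmf_lyap_term.
pose e : R := (alpha * (\sum_(i <- nbr k) p k i * `|x i|) + `|dat k|)%R.
have e0 : (0 <= e)%R.
  rewrite addr_ge0// mulr_ge0 ?(ltW a0)//; apply: sumr_ge0 => i _.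
  by rewrite mulr_ge0.
have w0 := weight_ge0 k.
have lx0 := nl.2 x.
rewrite thetaE//.
have mabs : measurable_fun setT (fun z : R => (`|z|%R)%:E).
  by apply/measurable_EFinP; exact: normr_measurable.
have mF : measurable_fun setT (fun z : R => lyap (Theta alpha p dat k z x)).
  apply: (measurableT_comp nl.1).
  exact: (measurableT_comp (measurable_Theta k) (measurable_pair1 x)).
have abs0 (z : R) : 0 <= (`|z|%R)%:E by rewrite lee_fin.
pose B (z : R) : \bar R := (lyap x + (weight k * e)%R%:E) + (weight k)%:E * (`|z|%R)%:E.
have c0 : 0 <= lyap x + (weight k * e)%R%:E by rewrite adde_ge0// lee_fin mulr_ge0.
have mwabs : measurable_fun setT (fun z : R => (weight k)%:E * (`|z|%R)%:E).
  exact: measurable_funeM.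
have wabs0 (z : R) : 0 <= (weight k)%:E * (`|z|%R)%:E by rewrite mule_ge0// lee_fin.
apply: (@le_trans _ _ (\int[G]_z B z)).
  apply: ge0_le_integral => //.
  - by move=> z _; exact: nl.2.
  - exact: emeasurable_funD.
  - move=> z _; apply: le_trans (lyap_Theta k z x) _; rewrite /B -addeA leeD2l//.
    by rewrite -EFinM -EFinD lee_fin -mulrDr ler_wpM2l// Theta_abs.
rewrite /B ge0_integralD//.
rewrite integral_cst// (@probability_setT _ _ _ G) mule1 ge0_integralZl ?lee_fin//.
rewrite -addeA leeD2l// [in leRHS]mulrDr EFinD leeD2l// [leRHS]EFinM.
by rewrite lee_wpmul2l// lee_fin.
Qed.

(* Within range [r] weights grow by at most [alpha^-1], which cancels the factor
   [alpha] of [Theta]; then symmetry of [p] makes its columns sum to [1]. *)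
Lemma weighted_influence (L : seq (Zd d)) x : uniq L ->
  (\sum_(k <- L) weight k * (alpha * (\sum_(i <- nbr k) p k i * `|x i|)))%R%:E <= wnorm x.
Proof.
have /andP[a0 a1] := alpha01.
(* A common index list for the inner sums, so that the two sums can be exchanged. *)
move=> uL; pose U := undup (flatten [seq nbr k | k <- L]).
have sumU k (F : Zd d -> R) : k \in L -> (forall i, i \notin nbr k -> F i = 0%R) ->
    (\sum_(i <- nbr k) F i = \sum_(i <- U) F i)%R.
  move=> kL F0; rewrite fsbig_seq ?nbr_uniq// [RHS]fsbig_seq ?undup_uniq//.
  apply: fsbig_widen => [i ik|i [_ /= /negP /F0 //]].
  rewrite /= mem_undup; apply/flattenP; exists (nbr k) => //.
  by apply/mapP; exists k.
apply: le_trans (sum_le_esum (undup_uniq (flatten [seq nbr k | k <- L]))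
  (a := fun j => `|x j| * weight j)%R _); last first.
  by move=> j; rewrite mulr_ge0// weight_ge0.
rewrite lee_fin -/U.
have -> : (\sum_(k <- L) weight k * (alpha * (\sum_(i <- nbr k) p k i * `|x i|)) =
    \sum_(i <- U) `|x i| * \sum_(k <- L) alpha * weight k * p k i)%R.
  under [RHS]eq_bigr do rewrite mulr_sumr.
  rewrite exchange_big /=; apply: eq_big_seq => k kL.
  rewrite (sumU k)// => [|i ik]; last by rewrite notin_nbr// mul0r.
  by rewrite !mulr_sumr; apply: eq_bigr => i _; ring.
apply: ler_sum => i _; rewrite ler_wpM2l//.
apply: (@le_trans _ _ (\sum_(k <- L) weight i * p i k)%R).
  apply: ler_sum => k _; rewrite (p_symmetric i k).
  have [->|pki] := eqVneq (p k i) 0%R; first by rewrite !mulr0.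
  by rewrite ler_wpM2r// weight_step.
rewrite -mulr_sumr -[leRHS]mulr1 ler_wpM2l ?weight_ge0// -lee_fin -(p_sum1 i).
exact: sum_le_esum.
Qed.

(** The increments add up to at most [lyap_const] from data and noise plus [wnorm x] from the
    neighbours, that is, to [lyap x]; hence the rate 1. *)
Lemma lyap_drift (L : seq (Zd d)) x : uniq L ->
  \sum_(k <- L) kint (theta k) lyap x <= ((size L)%:R + 1)%R%:E * lyap x.
Proof.
move=> uL.
have lx0 : 0 <= lyap x by apply: nneseries_ge0 => n _ _; exact: (nnmf_lyap_term n).2.
apply: (@le_trans _ _ (\sum_(k <- L) (lyap x +
  (weight k * (alpha * (\sum_(i <- nbr k) p k i * `|x i|) + `|dat k| + m1))%R%:E))).
  by apply: lee_sum => k _; exact: theta_lyap.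
rewrite big_split /= EFinD ge0_muleDl ?lee_fin// mul1e; apply: leeD.
  rewrite (eq_bigr (fun=> 1 * lyap x)) => [|k _]; last by rewrite mul1e.
  by rewrite -ge0_sume_distrl// sumEFin big_const_seq count_predT iter_addr_0.
rewrite sumEFin lyapE.
have -> : (\sum_(k <- L) weight k *
    (alpha * (\sum_(i <- nbr k) p k i * `|x i|) + `|dat k| + m1) =
  (\sum_(k <- L) `|dat k| * weight k + m1 * \sum_(k <- L) `|1| * weight k) +
  \sum_(k <- L) weight k * (alpha * (\sum_(i <- nbr k) p k i * `|x i|)))%R.
  rewrite mulr_sumr -!big_split /=; apply: eq_bigr => k _.
  by rewrite normr1; ring.
rewrite EFinD; apply: leeD; last exact: weighted_influence.
rewrite lee_fin /lyap_const; apply: lerD.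
  rewrite -lee_fin fineK//; apply: sum_le_esum => // j.
  by rewrite mulr_ge0// weight_ge0.
rewrite ler_wpM2l// -lee_fin fineK//; apply: sum_le_esum => // j.
by rewrite mulr_ge0// weight_ge0.
Qed.

Local Close Scope ereal_scope.
End lattice_dynamics.

(** * The Markov process of a semigroup of kernels *)

Local Open Scope ereal_scope.

Lemma pkernel_bind {R : realType} {d d' d1 d2} {X : measurableType d}
    {X' : measurableType d'} {Y : measurableType d1} {Z : measurableType d2}
    (K : R.-pker X' ~> Y) (g : X -> X') (F : X * Y -> Z) :
  measurable_fun setT g -> measurable_fun setT F ->
  exists M : R.-pker X ~> Z, forall (x : X) (f : Z -> \bar R), nnmf f ->
    kint M f x = kint K (fun y => f (F (x, y))) (g x).
Proof.
move=> mg mF.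
have [||L LE] := @pkernel_of_measure R _ _ X Y (fun x => K (g x)).
- by move=> x; exact: pkerT.
- by move=> U mU; exact: (measurableT_comp (@measurable_kernel _ _ _ _ _ K U mU)).
have [||M ME] := @pkernel_of_measure R _ _ X Z (mkcomp L (kdirac mF)).
- move=> x; rewrite /mkcomp /= /kcomp.
  under eq_integral do rewrite pkerT.
  by rewrite integral_cst// mul1e pkerT.
- by move=> U mU; exact: measurable_kernel.
exists M => x f [mf f0]; rewrite ME integral_kcomp// -[LHS]kintE LE.
by rewrite kintE; apply: eq_integral => y _; rewrite integral_dirac// diracT mul1e.
Qed.

Section eq_integral_pi.
Context {R : realType} {d} {T : measurableType d} (P : probability T R).
Variables (F1 F2 : T -> \bar R) (c : R).
Hypothesis nF1 : nnmf F1.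
Hypothesis nF2 : nnmf F2.
Hypothesis F2c : forall x, F2 x <= c%:E.

Let int_fin F (A : set T) : nnmf F -> (forall x, F x <= c%:E) -> measurable A ->
  \int[P]_(x in A) F x \is a fin_num.
Proof.
move=> [mF F0] Fc mA; rewrite ge0_fin_numE; last by apply: integral_ge0 => x _.
apply: (@le_lt_trans _ _ (\int[P]_(x in A) c%:E)).
  by apply: ge0_le_integral => //; exact: measurable_funS mF.
rewrite integral_cst// (@le_lt_trans _ _ (`|c|%:E))// ?ltry//.
rewrite (@le_trans _ _ (`|c|%:E * P A))//.
  by rewrite lee_wpmul2r// lee_fin ler_norm.
rewrite -[leRHS]mule1 lee_wpmul2l//; exact: probability_le1.
Qed.

(** A Dynkin argument; the bound on [F2] makes its integrals finite, which allows the cancellation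
    needed for complements. *)
Lemma eq_integral_pi (G : set (set T)) : setI_closed G ->
  (forall A, G A -> measurable A) ->
  \int[P]_x F1 x = \int[P]_x F2 x ->
  (forall A, G A -> \int[P]_(x in A) F1 x = \int[P]_(x in A) F2 x) ->
  forall A, <<s G >> A -> \int[P]_(x in A) F1 x = \int[P]_(x in A) F2 x.
Proof.
move=> GI Gm eqT eqG.
have sGm A : <<s G >> A -> measurable A.
  by apply: smallest_sub; [exact: sigma_algebra_measurable|exact: Gm].
have split F A : nnmf F -> measurable A ->
    \int[P]_x F x = \int[P]_(x in A) F x + \int[P]_(x in ~` A) F x.
  move=> [mF F0] mA; rewrite -ge0_integral_setU ?setUv//.
  - exact: measurableC.
  - by apply/disj_setPS; rewrite setICr.
have mS (F : T -> \bar R) A : measurable A -> nnmf F -> measurable_fun A F.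
  by move=> mA [mF _]; exact: measurable_funS mF.
apply: (@dynkin_induction _ (g_sigma_algebraType G) G
  (fun A => \int[P]_(x in A) F1 x = \int[P]_(x in A) F2 x)) => //.
- move=> A mA eqA; have {}mA := sGm _ mA.
  have := split F1 A nF1 mA; rewrite eqT eqA (split F2 A nF2 mA).
  have fA : \int[P]_(x in A) F2 x \is a fin_num by exact: int_fin.
  rewrite ![\int[P]_(x in A) F2 x + _]addeC.
  by move=> /(congr1 (fun z => z - \int[P]_(x in A) F2 x)); rewrite !addeK.
- move=> A mA tA eqA.
  have {}mA n : measurable (A n : set T) by apply: sGm; exact: mA.
  have mU : measurable (\bigcup_k A k : set T) by exact: bigcupT_measurable.
  rewrite !ge0_integral_bigcup//.
  + by apply: eq_eseriesr => n _; exact: eqA.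
  + exact: mS.
  + by move=> x _; exact: nF2.2.
  + exact: mS.
  + by move=> x _; exact: nF1.2.
Qed.

End eq_integral_pi.

Section markov_chain.
Context {R : realType} {d} {T : measurableType d}.
Variable K : R -> R.-pker T ~> T.
Hypothesis K_dirac : forall f x, nnmf f -> kint (K 0) f x = f x.
Hypothesis K_semigroup : forall s t f x, (0 <= s)%R -> (0 <= t)%R -> nnmf f ->
  kint (K (s + t)) f x = kint (K s) (kint (K t) f) x.

Notation path_space := (prodsp R T).
Implicit Types (a b c t : R) (s : seq R) (w : path_space) (f : path_space -> \bar R).

Definition set_at b w (y : T) : path_space := fun c => if c == b then y else w c.

Lemma measurable_set_at b :
  measurable_fun setT (fun wy : path_space * T => set_at b wy.1 wy.2).
Proof.
apply: measurable_fun_prodsp => c; rewrite /set_at; case: (c == b).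
  exact: measurable_snd.
by apply: (measurableT_comp (measurable_coord c)); exact: measurable_fst.
Qed.

Lemma nnmf_set_at b w f : nnmf f -> nnmf (fun y => f (set_at b w y)).
Proof.
move=> [mf f0]; split; last by move=> y; exact: f0.
apply: (measurableT_comp mf).
exact: (measurableT_comp (measurable_set_at b) (measurable_pair1 w)).
Qed.

Lemma jump_exists a b : exists M : R.-pker path_space ~> path_space,
  forall w f, nnmf f -> kint M f w = kint (K (b - a)%R) (fun y => f (set_at b w y)) (w a).
Proof.
have [M ME] := pkernel_bind (K (b - a)%R) (@measurable_coord _ _ T a) (measurable_set_at b).
by exists M => w f nf; rewrite ME.
Qed.

(** The transition from time [a] to time [b] acts on whole paths, overwriting the coordinate [b], so
    that chains along different lists of times live on one space and can be compared. *)
Definition jump a b : R.-pker path_space ~> path_space :=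
  projT1 (cid (jump_exists a b)).

Lemma jumpE a b w f : nnmf f ->
  kint (jump a b) f w = kint (K (b - a)%R) (fun y => f (set_at b w y)) (w a).
Proof. by move=> nf; rewrite /jump; case: cid => M /= ->. Qed.

Lemma chain_exists s a : exists M : R.-pker path_space ~> path_space,
  forall w f, nnmf f -> kint M f w =
    foldr (fun b (F : R -> path_space -> \bar R) a' => kint (jump a' b) (F b)) (fun=> f) s a w.
Proof.
elim: s a => [|b s IH] a /=; first by have [M ME] := @pkernel_dirac R _ path_space; exists M.
have [M ME] := IH b; have [M' M'E] := pkernel_comp (jump a b) M.
exists M' => w f nf; rewrite M'E//; apply: eq_kint => w'; exact: ME.
Qed.

Definition chain a s : R.-pker path_space ~> path_space :=
  projT1 (cid (chain_exists s a)).

Lemma chain_nil a f w : nnmf f -> kint (chain a [::]) f w = f w.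
Proof. by move=> nf; rewrite /chain; case: cid => M /= ->. Qed.

Lemma chain_cons a b s f w : nnmf f ->
  kint (chain a (b :: s)) f w = kint (jump a b) (kint (chain b s) f) w.
Proof.
move=> nf; rewrite {1}/chain; case: cid => M /= -> //.
by apply: eq_kint => w'; rewrite /chain; case: cid => M' /= ->.
Qed.

Lemma chain_rcons a s b f w : nnmf f ->
  kint (chain a (rcons s b)) f w = kint (chain a s) (kint (jump (last a s) b) f) w.
Proof.
move=> nf; elim: s a w => [|c s IH] a w /=.
  rewrite chain_cons// chain_nil; last exact: nnmf_kint.
  by apply: eq_kint => w'; rewrite chain_nil.
rewrite !chain_cons//; last exact: nnmf_kint.
by apply: eq_kint => w'; exact: IH.
Qed.

(** The coordinate [b] is neither read nor overwritten along the chain, and [f] ignores it. *)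
Lemma chain_indep a s b f : nnmf f -> a != b -> b \notin s ->
  (forall w y, f (set_at b w y) = f w) ->
  forall w y, kint (chain a s) f (set_at b w y) = kint (chain a s) f w.
Proof.
move=> nf + + fb; elim: s a => [|c s IH] a ab bs w y; first by rewrite !chain_nil.
move: bs; rewrite inE negb_or => /andP[bc bs].
rewrite !chain_cons// !jumpE; [|exact: nnmf_kint..].
have -> : set_at b w y a = w a by rewrite /set_at (negbTE ab).
apply: eq_kint => z.
rewrite -[RHS](IH c _ _ _ y)// 1?eq_sym//; congr (kint _ _ _).
apply/funext => e; rewrite /set_at; case: (eqVneq e c) => [->|//].
by rewrite eq_sym (negbTE bc).
Qed.

(* Chapman-Kolmogorov makes intermediate times irrelevant. *)
Lemma chain_filter a s (q : pred R) f : nnmf f -> path <=%R a s -> uniq (a :: s) ->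
  (forall b, b \in s -> ~~ q b -> forall w y, f (set_at b w y) = f w) ->
  forall w, kint (chain a s) f w = kint (chain a (seq.filter q s)) f w.
Proof.
move=> nf; elim: s a => [//|b s IH] a /= /andP[ab bs] /and3P[ans bns us] fq w.
have fs : forall c, c \in s -> ~~ q c -> forall w y, f (set_at c w y) = f w.
  by move=> c cs; apply: fq; rewrite inE cs orbT.
have IHb w' : kint (chain b s) f w' = kint (chain b (seq.filter q s)) f w'.
  by apply: IH => //=; rewrite bns.
rewrite chain_cons// (eq_kint _ _ IHb).
case: ifPn => [qb|nqb]; first by rewrite chain_cons.
have fb := fq b (mem_head _ _) nqb.
have subs : {subset seq.filter q s <= s} by move=> c; rewrite mem_filter => /andP[].
have bsq : b \notin seq.filter q s by apply: contra bns; exact: subs.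
have bsq' : path <=%R b (seq.filter q s).
  by apply: path_filter => //; exact: le_trans.
rewrite jumpE; last exact: nnmf_kint.
(* If no later time is kept, the jump to [b] integrates out; otherwise the jumps from [a] to [b] and
   from [b] to [c] merge into one by the semigroup property. *)
case: (seq.filter q s) bsq subs bsq' => [|c s'] bsq subs /=.
  move=> _; rewrite chain_nil// -[RHS](@kint_cst _ _ _ _ _ (K (b - a)%R) (f w) (w a)) ?nf.2//.
  by apply: eq_kint => y; rewrite chain_nil.
move=> /andP[bc _]; move: bsq; rewrite inE negb_or => /andP[bnc bs'].
rewrite chain_cons// jumpE; last exact: nnmf_kint.
rewrite (_ : (c - a = (b - a) + (c - b))%R); last by rewrite [RHS]addrC addrA subrK.
rewrite (@K_semigroup (b - a)%R (c - b)%R) ?subr_ge0//; last first.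
  by apply: nnmf_set_at; exact: nnmf_kint.
apply: eq_kint => y; rewrite chain_cons// jumpE; last exact: nnmf_kint.
have -> : set_at b w y b = y by rewrite /set_at eqxx.
apply: eq_kint => z.
rewrite -[RHS](@chain_indep c s' b _ nf _ _ _ _ y) 1?eq_sym//.
congr (kint _ _ _); apply/funext => e; rewrite /set_at.
by case: (eqVneq e c) => [->|//]; rewrite eq_sym (negbTE bnc).
Qed.

(** A normal form: lists with the same elements give the same chain. Time 0 is left out because
    [chain 0] starts there. *)
Definition times s : seq R := sort <=%R (undup (seq.filter (> 0)%R s)).

Lemma mem_times s b : (b \in times s) = (0 < b)%R && (b \in s).
Proof. by rewrite mem_sort mem_undup mem_filter. Qed.

Lemma times_sorted s : sorted <%R (times s).
Proof. by rewrite sort_lt_sorted undup_uniq. Qed.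

Lemma times_path s : path <=%R 0%R (times s).
Proof.
have := times_sorted s; case E : (times s) => [//|b s'] /= bs.
rewrite (sub_path _ bs) ?andbT; last by move=> ? ?; exact: ltW.
by have := mem_times s b; rewrite E mem_head => /esym/andP[/ltW].
Qed.

Lemma times_uniq s : uniq (0%R :: times s).
Proof. by rewrite /= mem_times ltxx sort_uniq undup_uniq. Qed.

Lemma eq_times s s' : s =i s' -> times s = times s'.
Proof.
move=> ss'; apply: lt_sorted_eq; [exact: times_sorted..|].
by move=> b; rewrite !mem_times ss'.
Qed.

Lemma times_rcons s b : (0 < b)%R -> (forall c, c \in s -> (c < b)%R) ->
  times (b :: s) = rcons (times s) b.
Proof.
move=> b0 sb; apply: lt_sorted_eq; first exact: times_sorted.
  have := times_sorted s; case E : (times s) => [//|c s'] /= cs.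
  rewrite rcons_path cs /=; apply: sb.
  have : last c s' \in times s by rewrite E mem_last.
  by rewrite mem_times => /andP[].
move=> c; rewrite mem_times mem_rcons !inE mem_times.
by case: eqVneq => [->|//]; rewrite b0.
Qed.

Lemma last_times s t : (0 <= t)%R -> (forall c, c \in s -> (c <= t)%R) ->
  last 0%R (times (t :: s)) = t.
Proof.
(* For [t = 0] no positive time remains, and the default of [last] is the required value. *)
rewrite le_eqVlt => /predU1P[<- s0|t0 st].
  case E : (times _) => [//|b s'].
  have : b \in times (0%R :: s) by rewrite E mem_head.
  rewrite mem_times inE => /andP[b0 /predU1P[b00|/s0]].
    by rewrite b00 ltxx in b0.
  by rewrite leNgt b0.
rewrite (@eq_times _ (t :: seq.filter (< t)%R s)).
  rewrite times_rcons ?last_rcons// => c; by rewrite mem_filter => /andP[].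
move=> c; rewrite !inE mem_filter; case: eqVneq => //= ct.
by case cs : (c \in s); rewrite ?andbT ?andbF// lt_neqAle ct st.
Qed.

Section markov_extension.
Context {J : choiceType} (enc : T -> J -> bool) (dec : prodsp J bool -> T).
Hypothesis menc : forall j, measurable [set x | enc x j].
Hypothesis mdec : measurable_fun setT dec.
Hypothesis encK : forall x, dec (enc x) = x.
Variable x0 : T.

Let w0 : path_space := fun=> x0.

(* Coordinates at times [t <= 0] are frozen at [x0]. *)
Lemma path_measure_exists : exists P : probability path_space R,
  forall s (A : set path_space), measurable A -> local_set s A ->
    P A = chain 0 (times s) w0 A.
Proof.
have [mu muE] := choice (fun s =>
  probability_of_measure (@pkerT R _ _ _ _ (chain 0 (times s)) w0)).
have [s s' A ss' mA sA|P PE] := kolmogorov_extension menc mdec encK (mu := mu).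
  rewrite !muE -!kint_indic//.
  have nA := @nnmf_indic R _ path_space A mA.
  rewrite (@chain_filter 0 (times s') (mem s) _ nA); last 3 first.
  - exact: times_path.
  - exact: times_uniq.
  - move=> b _ bs w y; congr (_%:E); apply: (local_indic sA) => c cs.
    by rewrite /set_at; case: eqP => // cb; rewrite -cb /= cs in bs.
  congr (kint (chain _ _) _ _); apply: lt_sorted_eq.
  - by apply: lt_sorted_filter; exact: times_sorted.
  - exact: times_sorted.
  - move=> b; rewrite mem_filter !mem_times /=.
    by case bs : (b \in s); rewrite ?(ss' _ bs)//= ?andbF.
by exists P => s A mA sA; rewrite (PE s)// muE.
Qed.

(** The two measures are known to agree only on sets depending on [s]. Pushing both forward by the
    map that freezes all other times makes every preimage such a set, and [f] does not notice the
    map. *)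
Lemma path_integral (P : probability path_space R) :
  (forall s (A : set path_space), measurable A -> local_set s A ->
    P A = chain 0 (times s) w0 A) ->
  forall s f, nnmf f -> local s f ->
    \int[P]_w f w = kint (chain 0 (times s)) f w0.
Proof.
move=> PE s f nf sf.
pose rs (w : path_space) : path_space := fun b => if b \in s then w b else x0.
have mrs : measurable_fun setT rs.
  apply: measurable_fun_prodsp => b; rewrite /rs.
  by case: (b \in s) => //; exact: measurable_coord.
have frs w : f (rs w) = f w by apply: sf => b bs; rewrite /rs bs.
have pushE (m : {measure set path_space -> \bar R}) :
    \int[m]_w f w = \int[pushforward m rs]_w f w.
  rewrite [RHS]ge0_integral_pushforward//.
  - by rewrite preimage_setT; apply: eq_integral => w _ /=; rewrite frs.
  - exact: nf.1.
  - by move=> w _; exact: nf.2.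
rewrite kintE (pushE P) [RHS]pushE; apply: eq_measure_integral => A mA _.
rewrite /pushforward /=; apply: PE.
  by rewrite -[X in measurable X]setTI; exact: mrs.
apply: local_preimage => w w' ww'; apply/funext => b; rewrite /rs.
by case: ifPn => // /ww'.
Qed.

Let past_pi t : set (set path_space) := [set A : set path_space | measurable A /\
  exists s, (forall c, c \in s -> (0 <= c <= t)%R) /\ local_set s A].

(** Proved on the pi-system of past events depending on finitely many times, where [t + u] is the
    last time of the chain and its jump integrates out, and then extended to the whole past. *)
Lemma path_markov (P : probability path_space R) :
  (forall s (A : set path_space), measurable A -> local_set s A ->
    P A = chain 0 (times s) w0 A) ->
  forall t u (g : T -> \bar R) (c : R) A, (0 <= t)%R -> (0 <= u)%R -> nnmf g ->
    (forall x, g x <= c%:E) -> past (fun b (w : path_space) => w b) t A ->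
    \int[P]_(w in A) g (w (t + u)%R) = \int[P]_(w in A) kint (K u) g (w t).
Proof.
(* The case [u = 0] is separate, since below [t + u] must lie strictly after every time of the
   past. *)
move=> PE t u g c A t0; rewrite le_eqVlt => /predU1P[<- ng gc _|u0 ng gc pA].
  by rewrite addr0; apply: eq_integral => w _; rewrite K_dirac.
have nK : nnmf (kint (K u) g) by exact: nnmf_kint.
have nw b (h : T -> \bar R) : nnmf h -> nnmf (fun w : path_space => h (w b)).
  by move=> [mh h0]; split => //; exact: (measurableT_comp mh (measurable_coord b)).
have key B : past_pi t B ->
    \int[P]_(w in B) g (w (t + u)%R) = \int[P]_(w in B) kint (K u) g (w t).
  move=> [mB [s [st sB]]].
  have nM (h : path_space -> \bar R) : nnmf h -> nnmf (fun w => h w * (\1_B w)%:E).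
    move=> [mh h0]; split.
      by apply: emeasurable_funM => //; exact: (nnmf_indic mB).1.
    by move=> w; rewrite mule_ge0// lee_fin.
  rewrite [LHS]integral_mkcond [RHS]integral_mkcond !epatch_indic.
  (* Including [t] in the list makes the last jump start at [t], with duration exactly [u]. *)
  rewrite (@path_integral P PE ((t + u)%R :: t :: s)); last 2 first.
  - exact: nM (nw _ _ ng).
  - move=> w w' ww'; rewrite /= ww' ?mem_head// (local_indic sB (y := w'))//.
    by move=> b bs; apply: ww'; rewrite !inE bs !orbT.
  rewrite (@path_integral P PE (t :: s)); last 2 first.
  - exact: nM (nw _ _ nK).
  - move=> w w' ww'; rewrite /= ww' ?mem_head// (local_indic sB (y := w'))//.
    by move=> b bs; apply: ww'; rewrite !inE bs !orbT.
  rewrite (@times_rcons (t :: s)); last 2 first.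
  - by rewrite ltr_wpDl.
  - move=> b; rewrite inE => /predU1P[->|/st /andP[_ bt]]; first by rewrite ltrDl.
    by rewrite (le_lt_trans bt)// ltrDl.
  rewrite chain_rcons; last exact: nM (nw _ _ ng).
  rewrite last_times//; last by move=> b /st /andP[].
  apply: eq_kint => w; rewrite jumpE; last exact: nM (nw _ _ ng).
  rewrite (_ : t + u - t = u)%R; last by rewrite addrC addKr.
  rewrite /= [RHS]muleC -kintZ ?lee_fin//.
  apply: eq_kint => y; rewrite muleC /set_at eqxx.
  congr (_%:E * _); apply: (local_indic sB) => b bs.
  rewrite /set_at; case: eqP => // btu; have /andP[_] := st _ bs.
  by rewrite btu leNgt ltrDl u0.
have Kwc w : kint (K u) g (w t) <= c%:E.
  rewrite -(@kint_cst _ _ _ _ _ (K u) c%:E (w t)).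
    by apply: kint_le => //; split => // x; exact: le_trans (ng.2 x) (gc x).
  exact: le_trans (ng.2 x0) (gc x0).
apply: (eq_integral_pi (nw (t + u)%R _ ng) (nw t _ nK) Kwc (G := past_pi t)).
- move=> B B' [mB [s [st sB]]] [mB' [s' [st' sB']]]; split; first exact: measurableI.
  exists (s ++ s'); split; last exact: local_setI.
  by move=> b; rewrite mem_cat => /orP[/st|/st'].
- by move=> B [].
- apply: key; split => //; exists [::]; split => //.
- exact: key.
- move: pA; apply: sub_smallest2r; first exact: smallest_sigma_algebra.
  move=> B [b bt [D mD <-]]; split.
    exact: measurable_coord.
  exists [:: b]; split => [b'|w w' ww']; rewrite ?setTI /preimage /=.
    by rewrite inE => /eqP ->; move: bt; rewrite /= in_itv.
  by rewrite ww' ?inE.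
Qed.

End markov_extension.
End markov_chain.
Local Close Scope ereal_scope.

(** * The process with values in X *)

Section local_continuous.
Context {R : realType} {I : choiceType}.
Notation C := (prodsp I R).
Notation upd i x y := (@dfwith I (fun=> R) x i y).

Let grid (n : nat) (y : R) : R := (Num.floor (y * n.+1%:R))%:~R / n.+1%:R.

Let grid_cvg y : grid n y @[n --> \oo] --> y.
Proof.
have h n : `|grid n y - y| <= n.+1%:R^-1.
  have n0 : 0 < n.+1%:R :> R by rewrite ltr0n.
  have /andP[h1 h2] := floor_itv (y * n.+1%:R).
  rewrite -(ler_pM2r n0) mulVf ?gt_eqF// -[X in _ * X](gtr0_norm n0) -normrM mulrBl.
  rewrite /grid divfK ?gt_eqF// distrC ger0_norm ?subr_ge0//.
  by rewrite lerBlDl (le_trans (ltW h2))// intrD.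
apply/cvgrPdist_le => e e0.
have := @cvg_harmonic R => /cvgrPdist_le /(_ e e0); apply: filterS => n.
rewrite /harmonic /= sub0r normrN => hn; rewrite distrC (le_trans (h n))//.
by rewrite (le_trans (ler_norm _)).
Qed.

(* A Caratheodory argument, one coordinate at a time. *)
Lemma local_continuous_measurable (S : seq I) (f : C -> R) : local S f ->
  (forall i x, continuous (fun y => f (upd i x y))) -> measurable_fun setT f.
Proof.
elim: S f => [|i S IH] f Sf fc.
  rewrite (_ : f = cst (f point)); first exact: measurable_cst.
  by apply/funext => x; apply: Sf.
apply: (@measurable_fun_cvg _ C R setT (fun n x => f (upd i x (grid n (x i)))) f).
  move=> n _ B mB; rewrite setTI.
  (* The rounded coordinate takes countably many values; on each of them coordinate [i] is frozen
     and the function depends on [S] only. *)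
  rewrite (_ : _ @^-1` B = \bigcup_(m : int)
    ([set x : C | Num.floor (x i * n.+1%:R) = m] `&`
     [set x : C | B (f (upd i x (m%:~R / n.+1%:R)))])).
    apply: countable_bigcupT_measurable => // m; apply: measurableI.
      rewrite (_ : mkset _ =
          (fun x : C => x i * n.+1%:R) @^-1` [set` `[m%:~R, (m + 1)%:~R[]).
        rewrite -[X in measurable X]setTI.
        by apply: (measurable_funM (measurable_coord i)).
      apply/seteqP; split => x /=; rewrite in_itv /=.
        by move=> <-; exact: floor_itv.
      exact: floor_def.
    have : measurable_fun setT (fun x : C => f (upd i x (m%:~R / n.+1%:R))).
      apply: IH => [x x' xx'|j x].
        apply: Sf => j; rewrite inE eq_sym; have [<- _|ij] := eqVneq i j.
          by rewrite !dfwithin.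
        by rewrite !dfwithout// => /xx'.
      have [<-|ij] := eqVneq i j.
        rewrite (_ : (fun y => _) = cst (f (upd i x (m%:~R / n.+1%:R)))).
          exact: cst_continuous.
        apply/funext => y; congr f; apply/funext => k.
        by have [<-|ik] := eqVneq i k; rewrite ?dfwithin ?dfwithout.
      rewrite (_ : (fun y => _) =
          (fun y => f (upd j (upd i x (m%:~R / n.+1%:R)) y))); first exact: fc.
      apply/funext => y; congr f; apply/funext => k.
      have [<-|ik] := eqVneq i k; first by rewrite dfwithin dfwithout 1?eq_sym// dfwithin.
      rewrite dfwithout//; have [<-|jk] := eqVneq j k; first by rewrite !dfwithin.
      by rewrite !dfwithout.
    by move=> /(_ measurableT _ mB); rewrite setTI.
  apply/seteqP; split => x /=; first by move=> fB; exists (Num.floor (x i * n.+1%:R)).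
  by move=> [m _ [<-]].
move=> x _; rewrite (_ : f x = f (upd i x (x i))).
  exact: (cvg_comp (fun n => grid n (x i)) (fun y => f (upd i x y))
    (@grid_cvg (x i)) (fc i x (x i))).
congr f; apply/funext => k.
by have [<-|ik] := eqVneq i k; rewrite ?dfwithin ?dfwithout.
Qed.

End local_continuous.

Section interacting_process.
Context {R : realType} {d : nat} (N : 'rV[R]_d -> R) (alpha r : R)
  (p : Zd d -> Zd d -> R) (dat : conf R d).
Hypothesis d_gt0 : (0 < d)%N.
Hypothesis N_norm : is_norm N.
Hypothesis alpha01 : 0 < alpha < 1.
Hypothesis r_gt0 : 0 < r.
Hypothesis p_ge0 : forall i j, 0 <= p i j.
Hypothesis p_sum1 : forall i, (\esum_(j in [set: Zd d]) (p i j)%:E = 1)%E.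
Hypothesis p_homogeneous : forall i j, p i (i + j) = p 0 j.
Hypothesis p_symmetric : forall i j, p i j = p j i.
Hypothesis p_range : forall j, r <= Znorm N j -> p 0 j = 0.
Hypothesis dat_XX : XX N alpha r dat.
Notation C := (prodsp (Zd d) R).
Notation G := (normal_prob (0 : R) 1).
Implicit Types (f : C -> \bar R).

Lemma infinite_system_kernel : exists kap : R -> R.-pker C ~> C,
  [/\ forall f x, nnmf f -> kint (kap 0) f x = f x,
      forall s t f x, 0 <= s -> 0 <= t -> nnmf f ->
        kint (kap (s + t)) f x = kint (kap s) (kint (kap t) f) x,
      forall (S : seq (Zd d)) f, nnmf f -> (forall y, f y <= 1)%E -> local S f ->
        uniq S -> exists D : R, forall t x, 0 <= t ->
        `|fine (kint (kap t) f x) - fine (f x) -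
          t * \sum_(k <- S) (fine (\int[G]_z f (Theta alpha p dat k z x))%E - fine (f x))|
        <= D * t ^+ 2
    & forall t x, 0 <= t -> XX N alpha r x -> kap t x (~` XX N alpha r) = 0%E].
Proof.
pose th := theta alpha dat d_gt0 N_norm p_homogeneous p_range.
have out : forall k S f, nnmf f -> local S f -> k \notin S ->
    forall x, kint (th k) f x = f x.
  by move=> k S f nf Sf kS x; exact: theta_out nf Sf kS x.
have loc : forall k S f, nnmf f -> local S f ->
    local (S ++ nbr d_gt0 N_norm p_range k) (kint (th k) f).
  by move=> k S f nf Sf; exact: theta_local.
have phi0 (j : Zd d) : 0 <= size_weight j :> R by rewrite ler0n.
have Cn0 : 0 <= size_const d_gt0 N_norm p_range by apply: sumr_ge0 => j _.
have nbP := size_weight_nbr d_gt0 N_norm p_range.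
have boxP := @size_weight_box R d.
(* The kernel is taken at time [|t|], so that a choice over all real [t] is possible. *)
have ker (t : R) := infinite_volume_kernel out loc phi0 Cn0 nbP (@box_uniq d)
  (fun n j => @size_weight_box R d n j) (normr_ge0 t).
have [kap kapE'] := choice ker.
have kapE (t : R) n S f x : 0 <= t -> nnmf f -> (forall y, f y <= 1)%E -> local S f ->
    `|fine (kint (kap t) f x) - fine (kint (fvol th (box n) t) f x)| <=
    box_err size_weight (size_const d_gt0 N_norm p_range) S t n.
  by move=> t0 nf f1 Sf; have := kapE' t n S f x nf f1 Sf; rewrite (ger0_norm t0).
exists kap; split.
- by move=> f x nf; exact: (kap_dirac kapE).
- move=> s t f x s0 t0 nf.
  by apply: (kap_semigroup out loc phi0 Cn0 nbP (@box_uniq d)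
    (fun n j => @size_weight_box R d n j) kapE).
- move=> S f nf f1 Sf uS.
  have [D DP] := kap_generator out loc (@box_uniq d)
    (fun n j => @size_weight_box R d n j) kapE nf f1 Sf uS.
  exists D => t x t0; have := DP t x t0.
  by under eq_bigr do rewrite /th (thetaE _ _ _ _ _ _ _ _ nf).
- move=> t x t0 Xx.
  (* The Lyapunov function is the weighted norm plus a finite constant, so it is infinite exactly
     off X. *)
  have lyapoo y : (lyap N alpha r dat y = +oo%E) <-> ~ XX N alpha r y.
    rewrite lyapE /XX /= -/(wnorm N alpha r y); split.
      by case: (wnorm N alpha r y) => // a.
    by move=> /negP; rewrite -leNgt leye_eq => /eqP ->.
  have xoo : (lyap N alpha r dat x < +oo)%E.
    by rewrite ltey; apply/eqP => /lyapoo.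
  have := kap_lyapunov ler01 (@nnmf_lyap_term _ _ N alpha r dat)
    (@lyap_term_local _ _ N alpha r dat)
    (@lyap_drift _ _ _ _ _ _ _ d_gt0 N_norm alpha01 r_gt0 p_ge0 p_sum1
       p_homogeneous p_symmetric p_range dat_XX)
    (@box_uniq d) kapE t0 xoo.
  rewrite (_ : [set y | _] = ~` XX N alpha r)//.
  by apply/seteqP; split => y /=; move/lyapoo.
Qed.

Notation state := (state N alpha r).

Lemma measurable_sval : measurable_fun setT (fun x : state => sval x : C).
Proof.
apply: measurable_fun_prodsp => j _ B mB; apply: sub_sigma_algebra.
by exists j => //; exists B => //; rewrite setTI.
Qed.

Lemma measurable_XX : measurable (XX N alpha r : set C).
Proof.
have [mw _] := @nnmf_wnorm R d N alpha r.
rewrite -[X in measurable X]setTI; exact: (emeasurable_fun_infty_o measurableT mw).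
Qed.

(** A measurable retraction onto X: configurations outside X go to the distinguished point, the zero
    configuration. *)
Definition to_state (x : C) : state :=
  if @idP (x \in XX N alpha r) is ReflectT xX
  then exist (fun x : conf R d => x \in XX N alpha r) x xX else point.

Lemma to_stateE (x : C) : sval (to_state x) = if x \in XX N alpha r then x else fun=> 0.
Proof. by rewrite /to_state; case: {-}_ / idP => [xX|/negP/negbTE ->] //=; rewrite xX. Qed.

Lemma svalK (x : state) : to_state (sval x) = x.
Proof.
case: x => x xX; rewrite /to_state /=; case: {-}_ / idP => [xX'|//].
by congr exist; exact: bool_irrelevance.
Qed.

Lemma measurable_to_state : measurable_fun setT (to_state : C -> state).
Proof.
apply: (measurability (@coord_sets R d N alpha r)) => //.
move=> _ [_ [j _ [B mB <-]] <-]; rewrite !setTI.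
(* As the default is the zero configuration, the coordinates of [to_state x] are those of [x] times
   the indicator of X. *)
have mj : measurable_fun setT (fun x : C => x j * \1_(XX N alpha r : set C) x).
  apply: measurable_funM; first exact: measurable_coord.
  by apply: measurable_indic; exact: measurable_XX.
have := mj measurableT B mB; rewrite setTI.
rewrite (_ : _ @^-1` B = to_state @^-1` ((fun x : state => sval x j) @^-1` B))//.
apply/seteqP; split => x; rewrite /preimage /= to_stateE indicE;
  by case: ifPn => _; rewrite ?mulr1 ?mulr0.
Qed.

(** The image of [kap] under [to_state]. From a point of X, the complement of X is null for [kap t],
    so the default value of the retraction is never seen. *)
Lemma state_kernel : exists K : R -> R.-pker state ~> state,
  [/\ forall (g : state -> \bar R) x, nnmf g -> kint (K 0) g x = g x,
      forall s t (g : state -> \bar R) x, 0 <= s -> 0 <= t -> nnmf g ->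
        kint (K (s + t)) g x = kint (K s) (kint (K t) g) x
    & forall (S : seq (Zd d)) f, nnmf f -> (forall y, f y <= 1)%E -> local S f ->
        uniq S -> exists D : R, forall t (x : state), 0 <= t ->
        `|fine (kint (K t) (fun y => f (sval y)) x) - fine (f (sval x)) -
          t * \sum_(k <- S) (fine (\int[G]_z f (Theta alpha p dat k z (sval x)))%E
                             - fine (f (sval x)))|
        <= D * t ^+ 2].
Proof.
have [kap [kap0 kapD kapL kapX]] := infinite_system_kernel.
have mts : measurable_fun setT (fun xy : state * C => to_state xy.2).
  by apply: (measurableT_comp measurable_to_state); exact: measurable_snd.
have /choice[K KE] (t : R) := pkernel_bind (kap t) measurable_sval mts.
have XX_ae f (g : C -> \bar R) (t : R) (x : state) : 0 <= t -> nnmf f -> nnmf g ->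
    (forall y, XX N alpha r y -> f y = g y) -> kint (kap t) f (sval x) = kint (kap t) g (sval x).
  move=> t0 [mf f0] [mg g0] fg; rewrite !kintE; apply: ae_eq_integral => //.
  exists (~` XX N alpha r); split.
  - by apply: measurableC; exact: measurable_XX.
  - by apply: kapX => //; have := svalP x; rewrite inE.
  - by move=> y /= nfg Xy; apply: nfg => _; exact: fg.
have nts (g : state -> \bar R) : nnmf g -> nnmf (fun y : C => g (to_state y)).
  by move=> [mg g0]; split => //; exact: (measurableT_comp mg measurable_to_state).
have nsv f : nnmf f -> nnmf (fun y : state => f (sval y)).
  by move=> [mf f0]; split => //; exact: (measurableT_comp mf measurable_sval).
have svalts y : XX N alpha r y -> sval (to_state y) = y.
  by rewrite to_stateE => Xy; rewrite mem_set.
exists K; split.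
- by move=> g x ng; rewrite KE// kap0 ?svalK//; exact: nts.
- move=> s t g x s0 t0 ng; rewrite KE// kapD//; last exact: nts.
  rewrite [RHS]KE; last exact: nnmf_kint.
  apply: XX_ae => //.
  + by apply: nnmf_kint; exact: nts.
  + by apply: (nts (kint (K t) g)); exact: nnmf_kint.
  + by move=> y Xy; rewrite KE// svalts.
- move=> S f nf f1 Sf uS; have [D DP] := kapL S f nf f1 Sf uS.
  exists D => t x t0; rewrite KE; last exact: nsv.
  rewrite (XX_ae _ f)//; first exact: DP.
  + by apply: (nts (fun y => f (sval y))); exact: nsv.
  + by move=> y Xy; rewrite /= svalts.
Qed.

End interacting_process.

(** * Conditional expectations under the path measure *)

Section bounded_conditional_expectation.
Context {R : realType} {d} {T : measurableType d}.
Variables (K : R -> R.-pker T ~> T) (P : probability (prodsp R T) R).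
Notation path_space := (prodsp R T).
Notation eta := (fun (b : R) (w : path_space) => w b).
Hypothesis P_markov : forall (t u : R) (g : T -> \bar R) (c : R) A, 0 <= t -> 0 <= u ->
  nnmf g -> (forall x, g x <= c%:E)%E -> past eta t A ->
  (\int[P]_(w in A) g (w (t + u)%R) = \int[P]_(w in A) kint (K u) g (w t))%E.

Lemma past_measurable (t : R) A : past eta t A -> measurable A.
Proof.
apply: smallest_sub; first exact: sigma_algebra_measurable.
by move=> _ [b _ [B mB <-]]; exact: measurable_coord.
Qed.

Lemma bounded_integrable (h : T -> R) (c b : R) (A : set path_space) :
  measurable A -> measurable_fun setT h -> (forall x, `|h x| <= c) ->
  P.-integrable A (fun w => (h (w b))%:E).
Proof.
move=> mA mh hc.
apply: (@measurable_bounded_integrable _ _ _ P (fun w : path_space => h (w b))) => //.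
- by rewrite (le_lt_trans (probability_le1 P mA))// ltry.
- apply: measurable_funTS; exact: (measurableT_comp mh (measurable_coord b)).
- exists c; split; first exact: num_real.
  by move=> x cx w _ /=; rewrite (le_trans (hc _))// ltW.
Qed.

Lemma is_cond_exp_coord (t c : R) (Y : path_space -> R) (h : T -> R) : 0 <= t ->
  measurable_fun setT h -> (forall x, `|h x| <= c) ->
  (forall A, past eta t A ->
     \int[P]_(w in A) (h (w t))%:E = \int[P]_(w in A) (Y w)%:E)%E ->
  is_cond_exp P (past eta t) Y (fun w => h (w t)).
Proof.
move=> t0 mh hc hY; split => //.
  move=> B mB; apply: sub_sigma_algebra; exists t; first by rewrite /= in_itv /= t0 lexx.
  exists (h @^-1` B); last by rewrite setTI.
  by rewrite -[X in measurable X]setTI; exact: mh.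
exact: bounded_integrable mh hc.
Qed.

Lemma kint_itv (u c : R) (g : T -> R) x : (forall y, 0 <= g y <= c) ->
  measurable_fun setT g -> (0 <= kint (K u) (EFin \o g) x <= c%:E)%E.
Proof.
move=> gc mg; have c0 : 0 <= c by have /andP[h1 h2] := gc x; exact: le_trans h1 h2.
have ng : nnmf (EFin \o g).
  by split=> [|y]; [exact/measurable_EFinP|rewrite lee_fin; case/andP: (gc y)].
rewrite (nnmf_kint _ ng).2 -(@kint_cst _ _ _ _ _ (K u) c%:E x) ?lee_fin//.
by apply: kint_le => // y; rewrite lee_fin; case/andP: (gc y).
Qed.

Lemma kernel_cond_exp_int (t u c : R) (g : T -> R) A : 0 <= t -> 0 <= u ->
  measurable_fun setT g -> (forall x, 0 <= g x <= c) -> past eta t A ->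
  (\int[P]_(w in A) (fine (kint (K u) (EFin \o g) (w t)))%:E =
   \int[P]_(w in A) (g (w (t + u)%R))%:E)%E.
Proof.
move=> t0 u0 mg gc pA.
have ng : nnmf (EFin \o g).
  by split=> [|y]; [exact/measurable_EFinP|rewrite lee_fin; case/andP: (gc y)].
rewrite [RHS](P_markov (g := EFin \o g) (c := c))//; last first.
  by move=> x; rewrite lee_fin; case/andP: (gc x).
apply: eq_integral => w _; rewrite fineK//.
have /andP[h1 h2] := kint_itv u (w t) gc mg.
by rewrite ge0_fin_numE// (le_lt_trans h2)// ltry.
Qed.

Lemma measurable_fine_kint (u : R) (g : T -> \bar R) : nnmf g ->
  measurable_fun setT (fun x => fine (kint (K u) g x)).
Proof.
move=> ng; apply: (measurableT_comp (@fine_measurable R setT measurableT)).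
by have [] := nnmf_kint (K u) ng.
Qed.

Lemma fine_kint_bound (u c : R) (g : T -> R) x : (forall y, 0 <= g y <= c) ->
  measurable_fun setT g -> `|fine (kint (K u) (EFin \o g) x)| <= c.
Proof.
move=> gc mg; have := kint_itv u x gc mg.
case: (kint _ _ _) => [a| |] /=; rewrite ?leye_eq ?leeNy_eq ?andbF//.
by rewrite !lee_fin => /andP[a0 ac]; rewrite ger0_norm.
Qed.

Lemma kernel_markov_process : transition_function K -> markov_process P eta.
Proof.
move=> Ktr; split; first by move=> t _; exact: measurable_coord.
exists K; split => // t u t0 u0 B mB.
have g01 (x : T) : 0 <= (\1_B x : R) <= 1.
  by rewrite indicE; case: (x \in B); rewrite /= ?lexx ?ler01.
have mg : measurable_fun setT (\1_B : T -> R) by exact: measurable_indic.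
rewrite (_ : (fun w => fine (K u (w t) B)) =
    (fun w => fine (kint (K u) (EFin \o \1_B) (w t)))); last first.
  by apply/funext => w; rewrite kint_indic.
apply: (@is_cond_exp_coord t 1 _ (fun x => fine (kint (K u) (EFin \o \1_B) x))) => //.
- by apply: measurable_fine_kint; exact: nnmf_indic.
- by move=> x; exact: fine_kint_bound.
- by move=> A pA; exact: (kernel_cond_exp_int t0 u0 mg g01 pA).
Qed.

(** The kernel calculus covers nonnegative functions only, so [f] is rescaled to [g] with values in
    [[0, 1]]. The additive shift cancels in the increment, and the factor [2 * M] undoes the
    scaling. *)
Lemma kernel_increment_cond_exp (t u M : R) (f : T -> R) (g := fun x => (f x + M) / (2 * M)) :
  0 < M -> 0 <= t -> 0 <= u -> measurable_fun setT f -> (forall x, `|f x| <= M) ->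
  is_cond_exp P (past eta t) (fun w => f (w (t + u)) - f (w t))
    (fun w => 2 * M * (fine (kint (K u) (EFin \o g) (w t)) - g (w t))).
Proof.
move=> M0 t0 u0 mf fM.
have M20 : 0 < 2 * M by rewrite mulr_gt0.
have mg : measurable_fun setT g by apply: measurable_funM => //; exact: measurable_funD.
have g01 x : 0 <= g x <= 1.
  have := fM x; rewrite ler_norml => /andP[h1 h2].
  by rewrite /g divr_ge0 ?(ltW M20)// ?ler_pdivrMr//; lra.
have gn x : `|g x| <= 1 by case/andP: (g01 x) => h1 h2; rewrite ger0_norm.
have ng : nnmf (EFin \o g).
  by split=> [|y]; [exact/measurable_EFinP|rewrite lee_fin; case/andP: (g01 y)].
have mk := measurable_fine_kint u ng.
have kn x := fine_kint_bound u x g01 mg.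
apply: (@is_cond_exp_coord t (2 * M * 2) _
  (fun x => 2 * M * (fine (kint (K u) (EFin \o g) x) - g x))) => //.
- by apply: measurable_funM => //; exact: measurable_funB.
- move=> x; rewrite normrM (gtr0_norm M20) ler_pM2l//.
  by rewrite (le_trans (ler_normB _ _))// (_ : 2 = 1 + 1)// lerD.
- move=> A pA; have mA := past_measurable pA.
  have ig (b : R) := bounded_integrable b mA mg gn.
  have ik := bounded_integrable t mA mk kn.
  transitivity ((2 * M)%:E * (\int[P]_(w in A) (g (w (t + u)%R))%:E -
                              \int[P]_(w in A) (g (w t))%:E))%E.
    under eq_integral do rewrite EFinM EFinB.
    rewrite integralZl//; last exact: integrableB.
    by rewrite integralB// (kernel_cond_exp_int t0 u0 mg g01 pA).
  rewrite -integralB// -integralZl//; last exact: integrableB.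
  apply: eq_integral => w _; rewrite -EFinB -EFinM /g; congr (_%:E).
  by field; rewrite gt_eqF.
Qed.

End bounded_conditional_expectation.

Lemma transition_function_kint {R : realType} {d} {T : measurableType d}
    (K : R -> R.-pker T ~> T) :
  (forall (g : T -> \bar R) x, nnmf g -> kint (K 0) g x = g x) ->
  (forall s t (g : T -> \bar R) x, 0 <= s -> 0 <= t -> nnmf g ->
     kint (K (s + t)) g x = kint (K s) (kint (K t) g) x) ->
  transition_function K.
Proof.
move=> K0 KD; split=> [x B mB|s t s0 t0 x B mB]; rewrite -kint_indic//.
  by rewrite K0 ?diracE//; exact: nnmf_indic.
rewrite KD//; last exact: nnmf_indic.
by rewrite kintE; apply: eq_integral => y _; rewrite kint_indic.
Qed.

Lemma gen_local {R : realType} {d : nat} (alpha : R) (p : Zd d -> Zd d -> R)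
    (dat : conf R d) (S : seq (Zd d)) (f : conf R d -> R) (x : conf R d) :
  uniq S -> local S f ->
  gen alpha p dat f x = \sum_(k <- S) gen_at alpha p dat k f x.
Proof.
move=> uS Sf; rewrite [RHS]fsbig_seq//; symmetry.
apply: fsbig_widen => // k [_ /= /negP kS]; rewrite /gen_at /Rintegral.
rewrite (eq_integral (fun=> 0%E)) ?integral0// => z _.
rewrite (Sf _ x) ?subrr// => j jS; rewrite /Theta.
by case: eqP => // jk; rewrite jk (negbTE kS) in jS.
Qed.

Lemma measurable_local_test {R : realType} {d : nat} (f : conf R d -> R) :
  local_test f -> measurable_fun setT (f : prodsp (Zd d) R -> R).
Proof.
move=> [[S Sf] _ fc]; apply: (local_continuous_measurable Sf) => i x y.
apply: (cvg_comp (fun y : R => dfwith (T := fun=> R) x i y : conf R d) f); last exact: fc.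
exact: dfwith_continuous.
Qed.

Section rescaling.
Context {R : realType} (M : R).
Hypothesis M0 : 0 < M.

Definition unit_scale (a : R) : R := (a + M) / (2 * M).

Lemma unit_scale_itv a : `|a| <= M -> 0 <= unit_scale a <= 1.
Proof.
have M20 : 0 < 2 * M by rewrite mulr_gt0.
rewrite ler_norml => /andP[h1 h2].
by rewrite /unit_scale divr_ge0 ?(ltW M20)// ?ler_pdivrMr//; lra.
Qed.

Lemma unit_scaleB a b : 2 * M * (unit_scale a - unit_scale b) = a - b.
Proof. by rewrite /unit_scale; field; rewrite gt_eqF. Qed.

End rescaling.

Lemma gen_at_unit_scale {R : realType} {d : nat} (N : 'rV[R]_d -> R) (alpha r : R)
    (p : Zd d -> Zd d -> R) (dat : conf R d) (d_gt0 : (0 < d)%N) (N_norm : is_norm N)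
    (p_homogeneous : forall i j, p i (i + j) = p 0 j)
    (p_range : forall j, r <= Znorm N j -> p 0 j = 0)
    (k : Zd d) (f : conf R d -> R) (M : R) (x : conf R d) :
  0 < M -> measurable_fun setT (f : prodsp (Zd d) R -> R) -> (forall y, `|f y| <= M) ->
  gen_at alpha p dat k f x = 2 * M *
    (fine (\int[normal_prob 0 1]_z (unit_scale M (f (Theta alpha p dat k z x)))%:E)
     - unit_scale M (f x)).
Proof.
move=> M0 mf fM; rewrite /gen_at /Rintegral.
pose g (z : R) := unit_scale M (f (Theta alpha p dat k z x)).
have mg : measurable_fun setT g.
  apply: measurable_funM => //; apply: measurable_funD => //.
  apply: (measurableT_comp mf).
  exact: (measurableT_comp (measurable_Theta alpha dat d_gt0 N_norm p_homogeneous p_range k)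
    (measurable_pair1 (x : prodsp (Zd d) R))).
have ig : (normal_prob 0 1).-integrable setT (EFin \o g).
  apply: measurable_bounded_integrable => //.
    by rewrite (@probability_setT _ _ _ (normal_prob 0 1)) ltry.
  exists 1; split; first exact: num_real.
  move=> y y1 z _ /=; have /andP[h0 h1] := unit_scale_itv M0 (fM (Theta alpha p dat k z x)).
  by rewrite ger0_norm// (le_trans h1)// ltW.
have ic : (normal_prob (0 : R) 1).-integrable setT (EFin \o cst (unit_scale M (f x))).
  exact: finite_measure_integrable_cst.
transitivity (fine (\int[normal_prob 0 1]_z
    ((2 * M)%:E * ((g z)%:E - (unit_scale M (f x))%:E)))%E).
  by congr fine; apply: eq_integral => z _; rewrite -EFinB -EFinM unit_scaleB.
rewrite integralZl//; last exact: integrableB.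
rewrite integralB// integral_cst// (@probability_setT _ _ _ (normal_prob 0 1)) mule1.
have fg : (\int[normal_prob 0 1]_z (g z)%:E)%E \is a fin_num by exact: integrable_fin_num.
by rewrite -(fineK fg) -EFinB -EFinM.
Qed.

(** Applied pointwise: [a u] is the semigroup increment of the rescaled test function at a fixed
    state, [s] its generator, and [c = 2 * M] undoes the rescaling. *)
Lemma cvg_right_derivative {R : realType} (a : R -> R) (s D c : R) : 0 <= c ->
  (forall u, 0 <= u -> `|a u - u * s| <= D * u ^+ 2) ->
  u^-1 * (c * a u) @[u --> 0^'+] --> c * s.
Proof.
move=> c0 aD; apply/cvgrPdist_le => e e0.
have b0 : 0 < c * `|D| + 1 by rewrite ltr_wpDl// mulr_ge0.
near=> u.
have u0 : 0 < u by [].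
have -> : c * s - u^-1 * (c * a u) = - (c * u^-1) * (a u - u * s).
  by field; rewrite gt_eqF.
have cu0 : 0 <= c * u^-1 by rewrite mulr_ge0// invr_ge0 ltW.
rewrite normrM normrN (ger0_norm cu0).
apply: (@le_trans _ _ (c * u^-1 * (`|D| * u ^+ 2))).
  rewrite (ler_wpM2l cu0)//.
  by rewrite (le_trans (aD _ (ltW u0)))// ler_wpM2r ?ler_norm// exprn_ge0// ltW.
have -> : c * u^-1 * (`|D| * u ^+ 2) = c * `|D| * u by field; rewrite gt_eqF.
apply: (@le_trans _ _ ((c * `|D| + 1) * u)); first by rewrite ler_pM2r// lerDl.
rewrite mulrC -ler_pdivlMr//; near: u.
exact: nbhs_right_le (divr_gt0 e0 b0).
Unshelve. all: by end_near. Qed.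

Unset Implicit Arguments.

Theorem theorem2p1 (R : realType) (d : nat) (N : 'rV[R]_d -> R) (alpha r : R)
    (p : Zd d -> Zd d -> R) (dat : conf R d)
    (d_gt0 : (0 < d)%N)
    (N_norm : is_norm N)
    (alpha01 : 0 < alpha < 1)
    (r_gt0 : 0 < r)
    (p_ge0 : forall i j, 0 <= p i j)
    (p_sum1 : forall i, (\esum_(j in [set: Zd d]) (p i j)%:E = 1)%E)
    (p_homogeneous : forall i j, p i (i + j) = p 0 j)
    (p_symmetric : forall i j, p i j = p j i)
    (p_range : forall j, r <= Znorm N j -> p 0 j = 0)
    (dat_XX : XX N alpha r dat) :
  exists (dO : measure_display) (Om : measurableType dO) (P : probability Om R)
         (eta : R -> Om -> state N alpha r),
    markov_process P eta /\
    forall f : conf R d -> R, local_test f -> forall t : R, 0 <= t ->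
      exists Y : R -> Om -> R,
        (forall u, 0 < u ->
           is_cond_exp P (past eta t)
             (fun w => f (sval (eta (t + u) w)) - f (sval (eta t w))) (Y u)) /\
        {ae P, forall w,
           u^-1 * Y u w @[u --> 0^'+] --> gen alpha p dat f (sval (eta t w))}.
Proof.
have [K [K0 KD KL]] := state_kernel d_gt0 N_norm alpha01 r_gt0 p_ge0 p_sum1
  p_homogeneous p_symmetric p_range dat_XX.
(* A state is coded by the rational cuts of all its coordinates; with this coding Kolmogorov's
   theorem applies to paths with values in X. *)
pose enc (x : state N alpha r) (kn : Zd d * nat) := cut_enc (sval x kn.1) kn.2.
pose dec (b : prodsp (Zd d * nat)%type bool) : state N alpha r :=
  to_state N alpha r (fun k => cut_dec (fun n => b (k, n))).
have menc kn : measurable [set x | enc x kn].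
  have mk : measurable_fun setT (fun x : state N alpha r => sval x kn.1).
    apply: (measurableT_comp (@measurable_coord (Zd d) _ R kn.1)).
    exact: measurable_sval.
  by have := mk measurableT _ (measurable_cut_enc kn.2); rewrite setTI.
have mdec : measurable_fun setT dec.
  apply: (measurableT_comp (@measurable_to_state R d N alpha r)).
  apply: measurable_fun_prodsp => k; apply: (measurableT_comp measurable_cut_dec).
  by apply: (@measurable_fun_prodsp nat) => n; exact: measurable_coord.
have encK x : dec (enc x) = x.
  rewrite -[RHS](svalK x) /dec; congr to_state.
  by apply/funext => k; rewrite /enc /= cut_encK.
(* The process is started from the zero configuration, the distinguished point of the state
   space. *)
have [P PE] := path_measure_exists KD menc mdec encK point.
have PM := path_markov K0 PE.
exists _, (prodsp R (state N alpha r)), P, (fun b w => w b); split.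
  exact: kernel_markov_process PM (transition_function_kint K0 KD).
move=> f ftest t t0; have mf := measurable_local_test ftest.
have [[S Sf] [M0 fM0] _] := ftest.
(* Adding 1 keeps the divisor [2 * M] of the rescaling positive. *)
pose M : R := `|M0| + 1.
have Mgt0 : 0 < M by rewrite ltr_wpDl.
have fM y : `|f y| <= M by rewrite (le_trans (fM0 y))// (le_trans (ler_norm _))// lerDl.
pose g (x : state N alpha r) := unit_scale M (f (sval x)).
(* This version of the conditional expectation is an explicit function of the state at time [t], so
   the limit holds along every path and not merely almost surely. *)
exists (fun u w => 2 * M * (fine (kint (K u) (EFin \o g) (w t)) - g (w t))); split.
  move=> u u0.
  apply: (kernel_increment_cond_exp (K := K) PM (f := fun x => f (sval x))) => //.
    exact: ltW.
  exact: (measurableT_comp mf (@measurable_sval R d N alpha r)).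
apply: aeW => w.
have Sf' : local (undup S) f.
  by apply: (local_sub (S := S)) => // j; rewrite mem_undup.
rewrite (gen_local _ _ _ _ (undup_uniq S) Sf').
under eq_bigr do rewrite (gen_at_unit_scale alpha dat d_gt0 N_norm p_homogeneous
  p_range _ _ Mgt0 mf fM).
rewrite -mulr_sumr.
pose F (y : prodsp (Zd d) R) : \bar R := (unit_scale M (f y))%:E.
have [D DP] : exists D : R, forall u (x : state N alpha r), 0 <= u ->
    `|fine (kint (K u) (fun y => F (sval y)) x) - fine (F (sval x)) -
      u * \sum_(k <- undup S)
        (fine (\int[normal_prob 0 1]_z F (Theta alpha p dat k z (sval x)))%E - fine (F (sval x)))|
    <= D * u ^+ 2.
  apply: KL; last exact: undup_uniq.
  - split=> [|y]; last by rewrite lee_fin; case/andP: (unit_scale_itv Mgt0 (fM y)).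
    apply/measurable_EFinP; apply: measurable_funM => //; exact: measurable_funD.
  - by move=> y; rewrite lee_fin; case/andP: (unit_scale_itv Mgt0 (fM y)).
  - by move=> y y' yy'; rewrite /F (Sf' _ _ yy').
apply: (cvg_right_derivative (D := D)); first by rewrite mulr_ge0// ltW.
by move=> u u0; exact: DP.
Qed.
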